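(* Fix $p\in\mathbb{Z}$, an integer $r\ge2$, and $\mathbf n=(n_1,\dots,n_r)\in\mathbb{Z}^r$, $\mathbf m=(m_1,\dots,m_r)\in\mathbb{Z}^r$. Suppose $\boldsymbol\alpha=(\alpha_1,\dots,\alpha_r)\in\mathbb{C}^r$ satisfies $\alpha_2=\alpha_1+p$ and $\alpha_i-\alpha_j\notin\mathbb{Z}$ for every pair $\{i,j\}\ne\{1,2\}$. Let $\boldsymbol\beta\in\mathbb{C}^r$ and put $\mathcal A=1-\boldsymbol\alpha_{[1,2]}+\alpha_1+p$, $\mathcal B=1-\boldsymbol\beta+\alpha_1+p$. Then for each integer $k\ge -m_{\min}$ $$ \begin{aligned} &\mathcal G_k\sum_{j\ge0}\mathcal H_j\Theta_j-\hat{\mathcal G}_k\sum_{j\ge0}\hat{\mathcal H}_j\hat\Theta_j=q_e(k)\\ &-\sum_{i=3}^r\frac{(1-\boldsymbol\beta+\alpha_i)_{\mathbf m+k}}{(\alpha_i-\boldsymbol\alpha_{[i]})_{\mathbf n_{[i]}+k+1}(k+n_i)!}\,{}_{2r}F_{2r-1}\!\left(\begin{matrix}-k-n_i,\ \boldsymbol\beta-\alpha_i,\ \boldsymbol\alpha_{[i]}-\alpha_i-\mathbf n_{[i]}-k\\ \boldsymbol\beta-\alpha_i-\mathbf m-k,\ 1+\boldsymbol\alpha_{[i]}-\alpha_i\end{matrix}\right)\\ &+\mathcal G_k\Psi_k\;{}_{2r}F_{2r-1}\!\left(\begin{matrix}-k-n_2,\ -p-n_1-k,\ 1-\mathcal B,\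 1-\mathcal A-\mathbf n_{[1,2]}-k\\ 1-p,\ 1-\mathcal B-\mathbf m-k,\ 2-\mathcal A\end{matrix}\right)\\ &+\hat{\mathcal G}_k\hat\Psi_k\;{}_{2r}F_{2r-1}\!\left(\begin{matrix}-k-n_1,\ p-n_2-k,\ 1-\mathcal B+p,\ 1-\mathcal A+p-\mathbf n_{[1,2]}-k\\ 1+p,\ 1-\mathcal B+p-\mathbf m-k,\ 2-\mathcal A+p\end{matrix}\right), \end{aligned} $$ where $$\mathcal G_k=\frac{(-1)^p\,\Gamma(\mathcal B+\mathbf m+k)\Gamma(\mathcal A-1)}{\Gamma(\mathcal B)\Gamma(\mathcal A+\mathbf n_{[1,2]}+k)\Gamma(1-p)\Gamma(p+n_1+k+1)(k+n_2)!},$$ $$\hat{\mathcal G}_k=\frac{(-1)^p\,\Gamma(\mathcal B-p+\mathbf m+k)\Gamma(\mathcal A-p-1)}{\Gamma(\mathcal B-p)\Gamma(\mathcal A-p+\mathbf n_{[1,2]}+k)\Gamma(1+p)\Gamma(-p+n_2+k+1)(k+n_1)!},$$ $$\mathcal H_j=\frac{(-k-n_2)_j(-p-n_1-k)_j(1-\mathcal B)_j(1-\mathcal A-\mathbf n_{[1,2]}-k)_j}{(1-p)_j(1-\mathcal B-\mathbf m-k)_j(2-\mathcal A)_j\,j!},$$ $$\hat{\mathcal H}_j=\frac{(-k-n_1)_j(p-n_2-k)_j(1-\mathcal B+p)_j(1-\mathcal A+p-\mathbf n_{[1,2]}-k)_j}{(1+p)_j(1-\mathcal B+p-\mathbf m-k)_j(2-\mathcal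 A+p)_j\,j!},$$ $$\begin{aligned}\Theta_j={}&-\psi(1-\mathcal B;j)-\psi(-p-n_1-k;j)-\psi(1-\mathcal A-\mathbf n_{[1,2]}-k;j)\\&+\psi(1-\mathcal B-\mathbf m-k;j)+\psi(1-p;j)+\psi(2-\mathcal A;j),\end{aligned}$$ $$\hat\Theta_j=\psi(p-n_2-k;j)-\psi(1+p;j),$$ $$\Psi_k=\psi(\mathcal B)-\psi(\mathcal B+\mathbf m+k)+\psi(\mathcal A+\mathbf n_{[1,2]}+k)-\psi(\mathcal A-1)+\psi(p+n_1+k+1)-\psi(1-p),$$ $$\hat\Psi_k=\psi(-p+n_2+k+1)-\psi(1+p).$$ All sums terminate, terms of the sum over $i$ with $k+n_i<0$ vanish by convention, and singular products of type $0\cdot\infty$ are interpreted by their common limit as $\alpha_2-\alpha_1\to p$ (see context).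
   Context: **Vectors.** Vector $\pm$ scalar and vector $\pm$ vector are componentwise; $\Gamma(\mathbf x)=\prod_i\Gamma(x_i)$, $\psi(\mathbf x)=\sum_i\psi(x_i)$ with $\psi=\Gamma'/\Gamma$; $\mathbf x_{[i]}$, $\mathbf x_{[1,2]}$ denote $\mathbf x$ with component $i$, respectively components $1,2$, removed; $(x)_n=\Gamma(x+n)/\Gamma(x)$, $(\mathbf x)_n=\prod_i(x_i)_n$, $(\mathbf x)_{\mathbf k}=\prod_i(x_i)_{k_i}$. Empty sums are $0$, empty products $1$. All ${}_{2r}F_{2r-1}$ (standard generalized hypergeometric series) have argument $1$. **Integers.** $M=\sum m_i$, $N=\sum n_i$, $e=\max\{-1,M-N-r+1\}$, $m_{\min}=\min_i m_i$. **Polynomial $q_e$.** $q_{-1}\equiv0$, $q_0\equiv1$, and $q_e(y)=\frac1e\sum_{j=1}^e\frac{(-1)^{j+1}}{j+1}Q_j(y)\,q_{e-j}(y)$ for $e\ge1$, where $$Q_j(y)=\sum_{i=1}^r\big[\mathbf B_{j+1}(-\alpha_i-y)-\mathbf B_{j+1}(1-\beta_i-y)+\mathbf B_{j+1}(1-\beta_i+m_i)-\mathbf B_{j+1}(1-\alpha_i+n_i)\big]$$ and $\mathbf B_n(x)$ are the Bernoulli polynomials. **Digamma increments.** $\psi(x;j)=\psi(x+j)-\psi(x)=\sum_{l=0}^{j-1}\frac1{x+l}$, and $\psi(\mathbf x;j)=\sum_\ell\psi(x_\ell;j)$ for vectors. For integers $0\le j\le n$, $\psi(-n;j)=H_{n-j}-H_n$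 with $H_n$ the harmonic numbers. For $n\in\{0,1,2,\ldots\}$, $1/\Gamma(-n)=0$ and $\psi(-n)/\Gamma(-n)$ is read as $(-1)^{n+1}n!$. **Interpretation of singular products.** The two hypergeometric series in the last two lines of the identity are $\sum_j\mathcal H_j$ and $\sum_j\hat{\mathcal H}_j$. For small $\varepsilon\neq0$ let a superscript $\varepsilon$ mean that $\alpha_2-\alpha_1=p+\varepsilon$, i.e. $p,\mathcal A,\mathcal B$ are replaced by $p+\varepsilon,\mathcal A+\varepsilon,\mathcal B+\varepsilon$ everywhere except in the sign $(-1)^p$. Where individual factors are singular, the combination $\mathcal G_k\sum_j\mathcal H_j\Theta_j-\mathcal G_k\Psi_k\sum_j\mathcal H_j$ means $\lim_{\varepsilon\to0}\sum_{j=0}^{k+n_2}\mathcal G_k^\varepsilon\mathcal H_j^\varepsilon(\Theta_j^\varepsilon-\Psi_k^\varepsilon)$ (zero if $k+n_2<0$), and $\hat{\mathcal G}_k\sum_j\hat{\mathcal H}_j\hat\Theta_j+\hat{\mathcal G}_k\hat\Psi_k\sum_j\hat{\mathcal H}_j$ means $\lim_{\varepsilon\to0}\sum_{j=0}^{k+n_1}\hat{\mathcal G}_k^\varepsilon\hat{\mathcal H}_j^\varepsilon(\hat\Theta_j^\varepsilon+\hat\Psi_k^\varepsilon)$ (zero if $k+n_1<0$). Removable singularities in $\boldsymbol\beta$ are read by continuity. *)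

(* Defs.v *)
From HB Require Import structures.
From mathcomp Require Import all_boot all_order all_algebra.
From mathcomp Require Import complex.
From mathcomp Require Import all_classical all_reals all_analysis.
Set Implicit Arguments.
Unset Strict Implicit.
Unset Printing Implicit Defensive.
Import Order.TTheory GRing.Theory Num.Theory.
Import numFieldNormedType.Exports.
Local Open Scope classical_set_scope.
Local Open Scope ring_scope.

(* The ascription to numClosedFieldType gives R[i] the topology and the normed
   space structure induced by its modulus. *)
Definition Cplx (R : realType) : numClosedFieldType := R[i].

Section SpecialFunctions.
Context {R : realType}.
Local Notation C := (Cplx R).
Implicit Types (x y z : C) (a b : seq C) (j : nat).

(* a ^ z = exp (z ln a) for real a > 0 *)
Definition cpow (a : R) z : C :=
  let t := complex.Im z * ln a in
  let u := expR (complex.Re z * ln a) in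
  Complex (u * cos t) (u * sin t).

(* Gauss's product; since 0^-1 = 0, Gamma takes the value 0 at the poles, so
   that (Gamma (- n))^-1 = 0. *)
Definition Gamma z : C :=
  lim ((fun N : nat =>
    N`!%:R * cpow N%:R z / \prod_(l < N.+1) (z + l%:R)) @ \oo).

Definition Gamma_pole z : Prop := exists j : nat, z = - j%:R.

Definition digamma z : C := derive1 Gamma z / Gamma z.

Definition digamma_incr x j : C := \sum_(l < j) (x + l%:R)^-1.

(* (x)_s = Gamma (x + s) / Gamma x; for s >= 0 it is the rising factorial,
   which also makes sense at the poles of Gamma. *)
Definition poch x (s : int) : C :=
  match s with
  | Posz j => \prod_(l < j) (x + l%:R)
  | Negz _ => Gamma (x + s%:~R) / Gamma x
  end.

(* The inverse of this is 1 / s! = 1 / Gamma (s + 1), also for s < 0. *)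
Definition factz (s : int) : C := if s is Posz j then j`!%:R else 0.

Definition hyp_term a b j : C :=
  (\prod_(x <- a) poch x j) / ((\prod_(x <- b) poch x j) * j`!%:R).

Definition hypergeometric a b z : C :=
  lim ((fun N : nat => \sum_(0 <= j < N) hyp_term a b j * z ^+ j) @ \oo).

(* bernoulli_numbers n = [:: b_0; ...; b_n], from
   \sum_(l <= n) 'C(n.+1, l) * b_l = 0 for n >= 1. *)
Fixpoint bernoulli_numbers (n : nat) : seq C :=
  if n is n'.+1 then
    let s := bernoulli_numbers n' in
    rcons s (- (n.+1%:R^-1 * \sum_(l < n) 'C(n.+1, l)%:R * s`_l))
  else [:: 1].

Definition bernoulli_poly (n : nat) x : C :=
  \sum_(l < n.+1) 'C(n, l)%:R * (bernoulli_numbers n)`_l * x ^+ (n - l).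

(* Number of terms of a series 0 <= j <= s. *)
Definition nterms (s : int) : nat := if s is Posz j then j.+1 else 0%N.

End SpecialFunctions.

(* Value at x, by continuity, of an expression f whose individual factors are
   all finite on D. If x belongs to D, then convergence along D forces this
   value to be f x. *)
Section ByContinuity.
Context {R : realType} {T : topologicalType}.
Implicit Types (f : T -> Cplx R) (D : set T) (x : T).

Definition extends_to f D x : Prop :=
  closure D x /\ cvg (f @ within D (nbhs x)).

Definition value_at f D x : Cplx R := lim (f @ within D (nbhs x)).

End ByContinuity.

Section Identity.
Context {R : realType} {r : nat}.
Local Notation C := (Cplx R).
Variables (n m : 'rV[int]_r) (alpha : 'rV[C]_r).

Definition deg_e : int :=
  Order.max (- 1) (\sum_i m 0 i - \sum_i n 0 i - r%:Z + 1).

Definition Q_ (beta : 'rV[C]_r) (j : nat) (y : C) : C :=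
  \sum_i (bernoulli_poly j.+1 (- alpha 0 i - y)
        - bernoulli_poly j.+1 (1 - beta 0 i - y)
        + bernoulli_poly j.+1 (1 - beta 0 i + (m 0 i)%:~R)
        - bernoulli_poly j.+1 (1 - alpha 0 i + (n 0 i)%:~R)).

(* [:: q_0 y; ...; q_s y] *)
Fixpoint q_seq (beta : 'rV[C]_r) (y : C) (s : nat) : seq C :=
  if s is s'.+1 then
    let t := q_seq beta y s' in
    rcons t (s%:R^-1 * \sum_(1 <= j < s.+1)
      (- 1) ^+ j.+1 / j.+1%:R * Q_ beta j y * t`_(s - j))
  else [:: 1].

Definition q_poly (beta : 'rV[C]_r) (s : int) (y : C) : C :=
  if s is Posz d then (q_seq beta y d)`_d else 0.

Variable k : int.

Section TermI.
Variable i : 'I_r.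

Definition term_upper (beta : 'rV[C]_r) : seq C :=
  (- k - n 0 i)%:~R
  :: [seq beta 0 l - alpha 0 i | l <- enum 'I_r]
  ++ [seq alpha 0 l - alpha 0 i - (n 0 l)%:~R - k%:~R
        | l <- enum 'I_r & l != i].

Definition term_lower (beta : 'rV[C]_r) : seq C :=
  [seq beta 0 l - alpha 0 i - (m 0 l)%:~R - k%:~R | l <- enum 'I_r]
  ++ [seq 1 + alpha 0 l - alpha 0 i | l <- enum 'I_r & l != i].

Definition term_i (beta : 'rV[C]_r) : C :=
  (\prod_l poch (1 - beta 0 l + alpha 0 i) (m 0 l + k))
  / ((\prod_(l | l != i) poch (alpha 0 i - alpha 0 l) (n 0 l + k + 1))
     * factz (k + n 0 i))
  * hypergeometric (term_upper beta) (term_lower beta) 1.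

Definition term_i_regular : set 'rV[C]_r :=
  [set beta | forall c j, c \in term_lower beta ->
     (j < nterms (k + n 0 i)%R)%N -> poch c j != 0].

End TermI.

Variables (i1 i2 : 'I_r) (p : int).

(* alpha_[1,2] and n_[1,2] are indexed by the l such that rest l. *)
Definition rest (l : 'I_r) : bool := (l != i1) && (l != i2).
Local Notation rests := [seq l <- enum 'I_r | rest l].

(* eps is the perturbation of p, A, B; the original quantities have eps = 0. *)
Section Perturbed.
Variables (eps : C) (beta : 'rV[C]_r).

Definition p_ : C := p%:~R + eps.
Definition A_ (l : 'I_r) : C := 1 - alpha 0 l + alpha 0 i1 + p_.
Definition B_ (l : 'I_r) : C := 1 - beta 0 l + alpha 0 i1 + p_.
Local Notation kC := (k%:~R : C).
Local Notation nC l := ((n 0 l)%:~R : C).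
Local Notation mC l := ((m 0 l)%:~R : C).

Definition G_ : C :=
  (- 1) ^ p * (\prod_l Gamma (B_ l + mC l + kC))
  * (\prod_(l | rest l) Gamma (A_ l - 1))
  / ((\prod_l Gamma (B_ l))
     * (\prod_(l | rest l) Gamma (A_ l + nC l + kC))
     * Gamma (1 - p_) * Gamma (p_ + nC i1 + kC + 1) * factz (k + n 0 i2)).

Definition Gh_ : C :=
  (- 1) ^ p * (\prod_l Gamma (B_ l - p_ + mC l + kC))
  * (\prod_(l | rest l) Gamma (A_ l - p_ - 1))
  / ((\prod_l Gamma (B_ l - p_))
     * (\prod_(l | rest l) Gamma (A_ l - p_ + nC l + kC))
     * Gamma (1 + p_) * Gamma (- p_ + nC i2 + kC + 1) * factz (k + n 0 i1)).

Definition H_upper : seq C :=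
  [:: - kC - nC i2, - p_ - nC i1 - kC
    & [seq 1 - B_ l | l <- enum 'I_r]
      ++ [seq 1 - A_ l - nC l - kC | l <- rests]].

Definition H_lower : seq C :=
  (1 - p_) :: [seq 1 - B_ l - mC l - kC | l <- enum 'I_r]
  ++ [seq 2 - A_ l | l <- rests].

Definition Hh_upper : seq C :=
  [:: - kC - nC i1, p_ - nC i2 - kC
    & [seq 1 - B_ l + p_ | l <- enum 'I_r]
      ++ [seq 1 - A_ l + p_ - nC l - kC | l <- rests]].

Definition Hh_lower : seq C :=
  (1 + p_) :: [seq 1 - B_ l + p_ - mC l - kC | l <- enum 'I_r]
  ++ [seq 2 - A_ l + p_ | l <- rests].

Definition H_ (j : nat) : C := hyp_term H_upper H_lower j.
Definition Hh_ (j : nat) : C := hyp_term Hh_upper Hh_lower j.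

Definition Theta_ (j : nat) : C :=
  - (\sum_l digamma_incr (1 - B_ l) j)
  - digamma_incr (- p_ - nC i1 - kC) j
  - (\sum_(l | rest l) digamma_incr (1 - A_ l - nC l - kC) j)
  + (\sum_l digamma_incr (1 - B_ l - mC l - kC) j)
  + digamma_incr (1 - p_) j
  + (\sum_(l | rest l) digamma_incr (2 - A_ l) j).

Definition Thetah_ (j : nat) : C :=
  digamma_incr (p_ - nC i2 - kC) j - digamma_incr (1 + p_) j.

Definition Psi_ : C :=
  (\sum_l digamma (B_ l)) - (\sum_l digamma (B_ l + mC l + kC))
  + (\sum_(l | rest l) digamma (A_ l + nC l + kC))
  - (\sum_(l | rest l) digamma (A_ l - 1))
  + digamma (p_ + nC i1 + kC + 1) - digamma (1 - p_).

Definition Psih_ : C := digamma (- p_ + nC i2 + kC + 1) - digamma (1 + p_).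

(* Arguments of the Gamma and digamma functions in G_ and Psi_
   (resp. Gh_ and Psih_). *)
Definition Gamma_args : seq C :=
  [seq B_ l | l <- enum 'I_r] ++ [seq B_ l + mC l + kC | l <- enum 'I_r]
  ++ [seq A_ l - 1 | l <- rests] ++ [seq A_ l + nC l + kC | l <- rests]
  ++ [:: 1 - p_; p_ + nC i1 + kC + 1].

Definition Gammah_args : seq C :=
  [seq B_ l - p_ | l <- enum 'I_r]
  ++ [seq B_ l - p_ + mC l + kC | l <- enum 'I_r]
  ++ [seq A_ l - p_ - 1 | l <- rests]
  ++ [seq A_ l - p_ + nC l + kC | l <- rests]
  ++ [:: 1 + p_; - p_ + nC i2 + kC + 1].

End Perturbed.

(* The values at (0, beta) of comb and combh, by continuity, are
     G_k \sum_j H_j Theta_j - G_k Psi_k \sum_j H_j   and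
     Gh_k \sum_j Hh_j Thetah_j + Gh_k Psih_k \sum_j Hh_j:
   the limit is taken jointly in eps -> 0 and in beta, hence it is both the
   limit as alpha_2 - alpha_1 -> p at fixed beta and the extension through the
   removable singularities in beta. *)
Definition comb (x : C * 'rV[C]_r) : C :=
  let: (eps, beta) := x in
  \sum_(0 <= j < nterms (k + n 0 i2))
     G_ eps beta * H_ eps beta j * (Theta_ eps beta j - Psi_ eps beta).

Definition combh (x : C * 'rV[C]_r) : C :=
  let: (eps, beta) := x in
  \sum_(0 <= j < nterms (k + n 0 i1))
     Gh_ eps beta * Hh_ eps beta j * (Thetah_ eps j + Psih_ eps).

(* No Gamma or digamma function is evaluated at a pole, no denominator of H_ j
   vanishes, and no digamma increment in Theta_ j has a vanishing denominator,
   for j in the range of summation: digamma_incr c j is finite if and only if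
   (c)_j != 0. *)
Definition comb_regular : set (C * 'rV[C]_r) :=
  [set x | (forall z, z \in Gamma_args x.1 x.2 -> ~ Gamma_pole z) /\
     (forall c j, c \in behead (H_upper x.1 x.2) ++ H_lower x.1 x.2 ->
        (j < nterms (k + n 0 i2)%R)%N -> poch c j != 0)].

Definition combh_regular : set (C * 'rV[C]_r) :=
  [set x | (forall z, z \in Gammah_args x.1 x.2 -> ~ Gamma_pole z) /\
     (forall c j,
        c \in (p_ x.1 - (n 0 i2)%:~R - k%:~R) :: Hh_lower x.1 x.2 ->
        (j < nterms (k + n 0 i1)%R)%N -> poch c j != 0)].

End Identity.

(* Main.v *)
(* The j-th terms of the hypergeometric series are, up to their prefactors, the
   residues at s = alpha_i - j of the rational function
   f(s) = prod_l (1 - beta_l + s)_{m_l + k} / prod_l (s - alpha_l)_{n_l + k + 1}.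
   The sum of all residues of f is the coefficient of 1/s in its expansion at
   infinity; it is a complete homogeneous symmetric function of the poles minus
   the zeros, and Newton's identities together with
   B_{j+1}(x + 1) - B_{j+1}(x) = (j + 1) x^j identify it with q_e(k).

   When alpha_2 - alpha_1 = p + eps, the product G_k H_j is eps u(eps) times the
   residue at alpha_2 - j, and the hatted product is - eps u(eps) times the
   residue at alpha_1 - j, where u(eps) = 1 / (Gamma(1 - eps) Gamma(1 + eps)).
   The factors Theta_j - Psi_k and their hatted analogues are logarithmic
   derivatives in eps. Hence the difference of the two limits in the identity is
   the derivative at eps = 0 of eps u(eps) S(eps), that is, S(0), where S is the
   sum of the residues at the two confluent families of poles; this is q_e(k)
   minus the sum over i >= 3. *)

Require Import Defs.
From mathcomp Require Import all_boot all_order all_algebra.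
From mathcomp Require Import complex.
From mathcomp Require Import all_classical all_reals all_analysis.
From mathcomp Require Import ring lra zify.
Set Implicit Arguments.
Unset Strict Implicit.
Unset Printing Implicit Defensive.
Import Order.TTheory GRing.Theory Num.Theory.
Import numFieldNormedType.Exports.
Local Open Scope ring_scope.

(** * Newton's identities and residue sums *)

(** The factors of G_k H_j and Theta_j are singular at eps = 0, and the values wanted are limits
    jointly in (eps, beta) along a set of regular points that need not contain the base point. The
    singular Gamma quotient is therefore rewritten as [rgamma_pair]: u(eps) times rational functions
    of eps that are finite at 0. In this form the products extend across eps = 0 and can be
    differentiated there, while at regular points the same derivative formula reads G_k H_j (Theta_j
    - Psi_k); [eder] couples the two. Consequently the limit only involves Gamma near 1, and integer
    shifts do the rest. One estimate for a factor of Gauss's product, [gfac_est], yields the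
    convergence, the nonvanishing, a Taylor expansion with quadratic remainder and the digamma
    series. The residue sum is evaluated only for eps near 0 and different from 0, where all poles
    are simple. The residues of the two confluent families may blow up separately as eps -> 0; their
    sum S(eps) is controlled because it equals q_e(k) minus the sum over i >= 3, which is continuous
    in alpha. *)

Section Newton.
Variable F : numFieldType.
Implicit Types (p h : nat -> F) (a b : F) (s t : seq F).

(* Newton's identities: if p lists the power sums of a virtual alphabet, then h
   lists its complete homogeneous symmetric functions. *)
Definition newton p h : Prop :=
  h 0 = 1 /\
  forall d, d.+1%:R * h d.+1 = \sum_(j < d.+1) p j.+1 * h (d - j)%N.

Lemma newton_uniq p h h' : newton p h -> newton p h' -> h =1 h'.
Proof.
move=> [h0 hS] [h0' hS'] d; elim/ltn_ind: d => -[_|d IH]; first by rewrite h0 h0'.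
apply: (@mulfI _ d.+1%:R); first by rewrite pnatr_eq0.
rewrite hS hS'; apply: eq_bigr => j _; rewrite IH //.
by rewrite ltnS leq_subr.
Qed.

Lemma eq_newton p p' h :
  (forall j, p j.+1 = p' j.+1) -> newton p h -> newton p' h.
Proof.
move=> pp' [h0 hS]; split=> // d; rewrite hS.
by apply: eq_bigr => j _; rewrite pp'.
Qed.

(** Same recursion as [q_seq], with arbitrary power sums p in place of the factors built from
    Q_j. *)
Fixpoint newton_seq p d : seq F :=
  if d is d'.+1 then
    let t := newton_seq p d' in
    rcons t (d%:R^-1 * \sum_(1 <= j < d.+1) p j * t`_(d - j))
  else [:: 1].

Lemma size_newton_seq p d : size (newton_seq p d) = d.+1.
Proof. by elim: d => //= d IH; rewrite size_rcons IH. Qed.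

Lemma nth_newton_seq p d e :
  (d <= e)%N -> (newton_seq p e)`_d = (newton_seq p d)`_d.
Proof.
elim: e => [|e IH]; first by case: d.
rewrite leq_eqVlt => /predU1P[->//|]; rewrite ltnS => le_de.
by rewrite /= nth_rcons size_newton_seq ltnS le_de IH.
Qed.

Lemma newton_seqP p : newton p (fun d => (newton_seq p d)`_d).
Proof.
split=> // d /=.
rewrite nth_rcons size_newton_seq ltnn eqxx mulrA mulfV ?pnatr_eq0 // mul1r.
rewrite big_add1 /= big_mkord; apply: eq_bigr => j _.
by rewrite subSS (nth_newton_seq p (leq_subr j d)).
Qed.

(** The generating function of h is exp(sum_j p_j t^j / j); subtracting b^j from p_j multiplies it
    by 1 - b t. *)
Lemma newton_add_zero p h b : newton p h ->
  newton (fun j => p j - b ^+ j) (fun d => h d - (if d is d'.+1 then b * h d' else 0)).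
Proof.
move=> [h0 hS]; split=> [|d]; first by rewrite subr0.
(* Consecutive terms cancel, and the last one has no lower neighbour to cancel against. *)
have tele : \sum_(j < d.+1) b ^+ j.+1 * (h (d - j)%N
      - (if (d - j)%N is d'.+1 then b * h d' else 0)) = b * h d.
  have E (j : 'I_d.+1) : b ^+ j.+1 * (h (d - j)%N
      - (if (d - j)%N is d'.+1 then b * h d' else 0))
      = (b ^+ j.+1 * h (d - j)%N) - (if (j.+1 <= d)%N then b ^+ j.+2 * h (d - j.+1)%N else 0).
    have := ltn_ord j; rewrite ltnS subnS leq_eqVlt; case: (d - j)%N (subn_eq0 d j) => [|c] /=.
      by rewrite eqxx => /esym dj /predU1P[jd|jd]; [rewrite jd ltnn !subr0|lia].
    by rewrite eqn0Ngt /= => dj _; case: ifP => [_|]; [rewrite (exprS b j.+1); ring|lia].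
  rewrite (eq_bigr _ (fun j _ => E j)).
  pose g (i : nat) := if (i <= d)%N then b ^+ i.+1 * h (d - i)%N else 0.
  rewrite (eq_bigr (fun j : 'I_d.+1 => g j - g j.+1)) => [|j _]; last first.
    by have jd : (j <= d)%N by [rewrite -ltnS]; rewrite /g jd.
  rewrite -(big_mkord xpredT (fun j => g j - g j.+1)).
  rewrite -[LHS]opprK -sumrN.
  under eq_bigr do rewrite opprB.
  by rewrite telescope_sumr // /g ltnn sub0r opprK subn0 expr1.
under eq_bigr do rewrite mulrBl.
rewrite sumrB tele mulrBr hS.
under [in RHS]eq_bigr do rewrite mulrBr.
rewrite sumrB -addrA -opprD; congr (_ - _).
have -> : d.+1%:R * (b * h d) = b * (d%:R * h d) + b * h d by rewrite -natr1; ring.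
congr (_ + _); case: d {tele} => [|d].
  by rewrite big_ord1 /=; ring.
rewrite hS [RHS]big_ord_recr /= subnn /= mulr0 addr0.
rewrite mulr_sumr; apply: eq_bigr => j _.
have jd : (j <= d)%N by case: (j).
by rewrite subSn //=; exact: mulrCA.
Qed.

Definition psum s j : F := \sum_(a <- s) a ^+ j.

(** For distinct poles s, the sum of the residues of x^i prod_(b in t) (x - b) / prod_(a in s) (x -
    a). The power x^i makes the recursions in [residue_zero] and [residue_pole] close. *)
Definition residue s t i : F :=
  \sum_(a <- s) a ^+ i * (\prod_(b <- t) (a - b))
    / \prod_(a' <- s | a' != a) (a - a').

Lemma residue_zero s b t i :
  residue s (b :: t) i = residue s t i.+1 - b * residue s t i.
Proof.
rewrite /residue mulr_sumr -sumrB; apply: eq_bigr => a _.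
by rewrite big_cons exprS; ring.
Qed.

(** Multiplying the rational function by x - a cancels its pole at a. *)
Lemma residue_pole a s t i : uniq (a :: s) ->
  residue (a :: s) t i.+1 - a * residue (a :: s) t i = residue s t i.
Proof.
move=> /andP[as_ us]; rewrite /residue !big_cons mulrDr opprD addrACA.
rewrite -[X in X + _ = _](_ : 0 = _) ?add0r; last by rewrite exprS; ring.
rewrite mulr_sumr -sumrB; apply: eq_big_seq => x xs.
have xa : a != x by apply: contraNneq as_ => ->.
rewrite big_cons xa invfM exprS.
have : x - a != 0 by rewrite subr_eq0 eq_sym.
by move=> nz; set z := (\prod_(_ <- _ | _) _)^-1; field.
Qed.

(** Since b - a = (x - a) - (x - b), multiplication by b - a turns the sum into a difference of two
    sums with one pole fewer, and these are equal by induction. *)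
Lemma residue0 s : uniq s -> residue s [::] 0 = (size s == 1)%:R.
Proof.
have [n] := ubnP (size s); elim: n s => // n IH [_ _|a [_ _|b s]].
- by rewrite /residue big_nil.
- by rewrite /residue big_seq1 big_nil big_cons eqxx big_nil expr0 mul1r divr1.
rewrite ltnS /= => size_s /andP[]; rewrite inE negb_or => /andP[ab as_] /andP[bs us].
apply: (@mulfI _ (b - a)); first by rewrite subr_eq0 eq_sym.
rewrite mulr0 mulrBl.
have perm_residue s1 s2 t i : perm_eq s1 s2 -> residue s1 t i = residue s2 t i.
  move=> s12; rewrite /residue (perm_big _ s12); apply: eq_bigr => x _.
  by rewrite (perm_big _ s12).
have Ea := @residue_pole a (b :: s) [::] 0.
rewrite /= inE negb_or ab as_ bs us in Ea.
have Eb := @residue_pole b (a :: s) [::] 0.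
rewrite /= inE negb_or eq_sym ab as_ bs us in Eb.
have P : perm_eq (b :: a :: s) (a :: b :: s) by apply/permP => f /=; lia.
rewrite !(perm_residue _ _ _ _ P) in Eb.
have -> : b * residue [:: a, b & s] [::] 0 - a * residue [:: a, b & s] [::] 0
  = residue (b :: s) [::] 0 - residue (a :: s) [::] 0.
  by rewrite -Ea // -Eb //; ring.
by rewrite !IH //= ?as_ ?bs // subrr.
Qed.

(** The rational function grows like x^(i + |t| - |s|), so its coefficient of 1/x is the complete
    symmetric function of degree i + |t| + 1 - |s|. Zeros are peeled off with [residue_zero], then
    poles with [residue_pole]. *)
Lemma residue_newton s t h i : uniq s ->
  newton (fun j => psum s j - psum t j) h ->
  residue s t i =
    if (size s <= i + (size t).+1)%N then h (i + (size t).+1 - size s)%N else 0.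
Proof.
move=> us; elim: t h i => [|b t IH] h i hP; last first.
  have gP := newton_seqP (fun j => psum s j - psum t j).
  have gP' := newton_add_zero b gP.
  have E j : psum s j.+1 - psum t j.+1 - b ^+ j.+1 = psum s j.+1 - psum (b :: t) j.+1.
    by rewrite {4}/psum big_cons -/(psum t _); ring.
  have {E} gP' := eq_newton (p' := fun j => psum s j - psum (b :: t) j) E gP'.
  have {gP'} hP := newton_uniq hP gP'.
  rewrite residue_zero !(IH _ _ gP) /= addSnnS !addnS !hP.
  set g := fun d => (newton_seq _ d)`_d in gP hP *.
  case: leqP => le1; last by rewrite ifF ?mulr0 ?subr0 //; lia.
  case: leqP => le2.
    by rewrite -/(g _) [X in _ = g X - _]subSn // subSn.
  have -> : size s = (i + size t).+2 by lia.
  by rewrite subnn mulr0.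
have {}hP : newton (psum s) h.
  by apply: eq_newton hP => j; rewrite {2}/psum big_nil subr0.
rewrite addn1; elim: s us h hP i => [_ h hP i|a s IH us h hP].
  rewrite /residue big_nil /= subn0.
  (* Without poles the sum is empty, and h_(i+1) vanishes because all power sums do. *)
  have [h0 hS] := hP; apply: (@mulfI _ i.+1%:R); first by rewrite pnatr_eq0.
  by rewrite hS mulr0 big1 // => j _; rewrite /psum big_nil mul0r.
have us' : uniq s by case/andP: us.
(* Removing the pole a changes the power sums exactly as adding the zero a does. *)
have hP' := newton_add_zero a hP.
have {}hP' : newton (psum s) (fun d => h d - (if d is d'.+1 then a * h d' else 0)).
  apply: eq_newton hP' => j.
  by rewrite /psum big_cons; ring.
elim=> [|i IHi].
  rewrite residue0 //= ltnS leqn0 eqSS; case: eqP => // ->; by have [->] := hP.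
have := residue_pole [::] i us; move=> /eqP; rewrite subr_eq => /eqP ->.
rewrite (IH us' _ hP') IHi /= !ltnS subSS.
case: leqP => le1; last by rewrite ifF ?mulr0 ?addr0 //; lia.
case: leqP => le2; last first.
  have -> : size s = i.+1 by lia.
  by rewrite !subnn /= subr0 mulr0 addr0.
by rewrite [in RHS]subSS subSn // subrK.
Qed.

End Newton.

(** * Bernoulli polynomials *)

Section Bernoulli.
Context {R : realType}.
Local Notation C := (Cplx R).
Implicit Types (x : C) (n j : nat).

Definition bernoulli_number n : C := (bernoulli_numbers n)`_n.

Lemma size_bernoulli_numbers n : size (bernoulli_numbers n : seq C) = n.+1.
Proof. by elim: n => //= n IH; rewrite size_rcons IH. Qed.

Lemma nth_bernoulli_numbers j n :
  (j <= n)%N -> (bernoulli_numbers n)`_j = bernoulli_number j.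
Proof.
elim: n => [|n IH]; first by case: j.
rewrite leq_eqVlt => /predU1P[->//|]; rewrite ltnS => le_jn.
by rewrite /= nth_rcons size_bernoulli_numbers ltnS le_jn IH.
Qed.

Lemma bernoulli_numberS n :
  \sum_(l < n.+2) 'C(n.+2, l)%:R * bernoulli_number l = 0.
Proof.
rewrite big_ord_recr /= binSn [bernoulli_number n.+1]/bernoulli_number /=.
rewrite nth_rcons size_bernoulli_numbers ltnn eqxx mulrN mulrA mulfV ?pnatr_eq0 //.
rewrite mul1r; apply/eqP; rewrite subr_eq0; apply/eqP; apply: eq_bigr => j _.
by rewrite nth_bernoulli_numbers //; have := ltn_ord j; rewrite ltnS.
Qed.

Lemma bernoulli_polyE n x :
  bernoulli_poly n x = \sum_(i < n.+1) 'C(n, i)%:R * bernoulli_number (n - i) * x ^+ i.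
Proof.
rewrite /bernoulli_poly (reindex_inj rev_ord_inj) /=; apply: eq_bigr => i _.
have le_in : (i <= n)%N by rewrite -ltnS.
by rewrite subSS nth_bernoulli_numbers ?leq_subr // bin_sub // subKn.
Qed.

(** The left side is B_n(1); it differs from B_n(0) only for n = 1, the one case that the recursion
    for the b_l leaves out. *)
Lemma sum_binomial_bernoulli n :
  \sum_(l < n.+1) 'C(n, l)%:R * bernoulli_number l = bernoulli_number n + (n == 1)%:R.
Proof.
case: n => [|[|n]]; rewrite big_ord_recr /= binn mul1r.
- by rewrite big_ord0 addrC.
- by rewrite big_ord1 bin0 mul1r addrC.
- by rewrite bernoulli_numberS add0r addr0.
Qed.

(** Expand (x + 1)^(n+1-l) and exchange the sums, using C(n+1,l) C(n+1-l,i) = C(n+1,i) C(n+1-i,l).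
    By [sum_binomial_bernoulli] the inner sum reproduces the coefficient of B_(n+1)(x), with an
    excess for i = n only. *)
Lemma bernoulli_poly_succ n x :
  bernoulli_poly n.+1 (x + 1) - bernoulli_poly n.+1 x = n.+1%:R * x ^+ n.
Proof.
rewrite {1}/bernoulli_poly.
have E (l : 'I_n.+2) :
  'C(n.+1, l)%:R * (bernoulli_numbers n.+1)`_l * (x + 1) ^+ (n.+1 - l)
  = \sum_(i < n.+2) (if (i <= n.+1 - l)%N then
       'C(n.+1, i)%:R * x ^+ i * ('C(n.+1 - i, l)%:R * bernoulli_number l) else 0).
  have lel : (l <= n.+1)%N by rewrite -ltnS.
  rewrite nth_bernoulli_numbers // addrC exprDn mulr_sumr.
  rewrite (big_ord_widen n.+2 (fun i => 'C(n.+1, l)%:R * bernoulli_number l *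
    ((1 ^+ (n.+1 - l - i) * x ^+ i) *+ 'C(n.+1 - l, i)))) ?ltnS ?leq_subr //.
  rewrite big_mkcond; apply: eq_bigr => i _; rewrite ltnS; case: ifP => // le_i.
  rewrite expr1n mul1r -mulr_natr.
  have : 'C(n.+1, l) * 'C(n.+1 - l, i) = 'C(n.+1, i) * 'C(n.+1 - i, l).
    have fact_pos : (0 < l`! * (i`! * (n.+1 - l - i)`!))%N.
      by rewrite !muln_gt0 !fact_gt0.
    apply/eqP; rewrite -(eqn_pmul2r fact_pos); apply/eqP.
    have E1 := bin_fact lel; have E2 := bin_fact le_i.
    have le_i' : (i <= n.+1)%N by lia.
    have le_l' : (l <= n.+1 - i)%N by lia.
    have E3 := bin_fact le_i'; have E4 := bin_fact le_l'.
    have E5 : (n.+1 - i - l = n.+1 - l - i)%N by lia.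
    rewrite E5 in E4.
    transitivity (n.+1)`!; last symmetry.
      by rewrite -E1 -E2; ring.
    by rewrite -E3 -E4; ring.
  move=> /(congr1 (fun k => k%:R : C)); rewrite !natrM => EC.
  have -> : 'C(n.+1, i)%:R * x ^+ i * ('C(n.+1 - i, l)%:R * bernoulli_number l)
    = ('C(n.+1, i)%:R * 'C(n.+1 - i, l)%:R) * x ^+ i * bernoulli_number l by ring.
  by rewrite -EC; ring.
rewrite (eq_bigr _ (fun l _ => E l)) exchange_big /=.
have {}E (i : 'I_n.+2) :
  \sum_(l < n.+2) (if (i <= n.+1 - l)%N then
       'C(n.+1, i)%:R * x ^+ i * ('C(n.+1 - i, l)%:R * bernoulli_number l) else 0)
  = 'C(n.+1, i)%:R * x ^+ i * (bernoulli_number (n.+1 - i) + (n.+1 - i == 1)%N%:R).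
  have lei : (i <= n.+1)%N by rewrite -ltnS.
  rewrite -sum_binomial_bernoulli mulr_sumr.
  rewrite (big_ord_widen n.+2 (fun l => 'C(n.+1, i)%:R * x ^+ i *
     ('C(n.+1 - i, l)%:R * bernoulli_number l))) ?ltnS ?leq_subr //.
  rewrite [RHS]big_mkcond; apply: eq_bigr => l _; rewrite ltnS.
  by have := ltn_ord l; case: ifP; case: ifP => //; lia.
rewrite (eq_bigr _ (fun i _ => E i)) bernoulli_polyE -sumrB.
rewrite (bigD1 (inord n)) //= inordK; last by lia.
rewrite subSnn eqxx binSn big1 ?addr0 /=; first by ring.
move=> i /eqP ni; rewrite (_ : (n.+1 - i == 1)%N = false) ?addr0; first by ring.
apply/negP => /eqP in1; apply: ni; apply: val_inj; rewrite /= inordK; last by lia.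
by have := ltn_ord i; lia.
Qed.

Lemma sum_arith_bernoulli n j x :
  \sum_(l < n) (x + l%:R) ^+ j
  = (bernoulli_poly j.+1 (x + n%:R) - bernoulli_poly j.+1 x) / j.+1%:R.
Proof.
elim: n => [|n IH]; first by rewrite big_ord0 addr0 subrr mul0r.
rewrite big_ord_recr /= IH -[n.+1%:R]natr1 addrA.
have := bernoulli_poly_succ j (x + n%:R).
move/(congr1 (fun y => y / j.+1%:R)); rewrite mulrAC mulfV ?pnatr_eq0 // mul1r => <-.
by ring.
Qed.

End Bernoulli.

(** * Sequences and the exponential in the complex plane *)

Section Modulus.
Local Open Scope classical_set_scope.
Context {R : realType}.
Local Notation C := (Cplx R).
Implicit Types (x y z : C).
Local Notation "a %:C" := (Complex a 0 : C) (format "a %:C").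

(** The norm of [C] takes values in [C]; estimates are carried out with this version in the ordered
    field [R]. *)
Definition cabs z : R := complex.Re `|z|.

Lemma cabsE z : `|z| = (cabs z)%:C.
Proof.
rewrite /cabs; apply: esym; apply: RRe_real.
exact: ger0_real (normr_ge0 z).
Qed.

Lemma realc_le (a b : R) : (a%:C <= b%:C) = (a <= b).
Proof. exact: lecR. Qed.

Lemma realc_lt (a b : R) : (a%:C < b%:C) = (a < b).
Proof. exact: ltcR. Qed.

Lemma realcD (a b : R) : (a + b)%:C = a%:C + b%:C.
Proof. exact: (rmorphD (real_complex R)). Qed.

Lemma realcM (a b : R) : (a * b)%:C = a%:C * b%:C.
Proof. exact: (rmorphM (real_complex R)). Qed.

Lemma realcV (a : R) : (a^-1)%:C = (a%:C)^-1.
Proof. exact: (fmorphV (real_complex R)). Qed.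

Lemma realc_nat n : (n%:R : R)%:C = n%:R.
Proof. exact: (rmorph_nat (real_complex R)). Qed.

Lemma realcI (a b : R) : a%:C = b%:C -> a = b.
Proof. by case. Qed.

Lemma cabs_ge0 z : 0 <= cabs z.
Proof. by rewrite -realc_le -cabsE; exact: normr_ge0. Qed.

Lemma cabs0 : cabs 0 = 0.
Proof. by apply: realcI; rewrite -cabsE normr0. Qed.

Lemma cabs1 : cabs 1 = 1.
Proof. by apply: realcI; rewrite -cabsE normr1. Qed.

Lemma cabs_eq0 z : (cabs z == 0) = (z == 0).
Proof.
rewrite -[z == 0]normr_eq0 cabsE; apply/eqP/eqP => [->|] //.
by move/realcI.
Qed.

Lemma cabs_gt0 z : (0 < cabs z) = (z != 0).
Proof. by rewrite lt_def cabs_eq0 cabs_ge0 andbT. Qed.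

Lemma cabsM x y : cabs (x * y) = cabs x * cabs y.
Proof. by apply: realcI; rewrite realcM -!cabsE normrM. Qed.

Lemma cabsV x : cabs x^-1 = (cabs x)^-1.
Proof. by apply: realcI; rewrite realcV -!cabsE normfV. Qed.

Lemma cabsN x : cabs (- x) = cabs x.
Proof. by rewrite /cabs normrN. Qed.

Lemma cabsB x y : cabs (x - y) = cabs (y - x).
Proof. by rewrite -cabsN opprB. Qed.

Lemma cabsD x y : cabs (x + y) <= cabs x + cabs y.
Proof. by rewrite -realc_le realcD -!cabsE ler_normD. Qed.

Lemma cabs_leB x y : cabs (x - y) <= cabs x + cabs y.
Proof. by rewrite -(cabsN y) cabsD. Qed.

Lemma cabsDge x y : cabs x - cabs y <= cabs (x + y).
Proof. by rewrite lerBlDr; apply: le_trans (cabs_leB (x + y) y); rewrite addrK. Qed.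

Lemma cabs_sum n (F : nat -> C) :
  cabs (\sum_(l < n) F l) <= \sum_(l < n) cabs (F l).
Proof.
elim: n => [|n IH]; first by rewrite !big_ord0 cabs0.
rewrite !big_ord_recr /=; apply: le_trans (cabsD _ _) _.
by rewrite lerD2r.
Qed.

Lemma cabs_real (a : R) : cabs (a%:C) = `|a|.
Proof. by rewrite /cabs normc_def /= expr0n /= addr0 sqrtr_sqr. Qed.

Lemma cabs_nat n : cabs n%:R = n%:R.
Proof. by rewrite -realc_nat cabs_real ger0_norm. Qed.

Lemma cabs_Re z : `|complex.Re z| <= cabs z.
Proof. by rewrite -realc_le -cabsE; exact: normc_ge_Re. Qed.

Lemma cabs_Im z : `|complex.Im z| <= cabs z.
Proof.
rewrite /cabs normc_def /= -(sqrtr_sqr (complex.Im z)).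
by apply: ler_wsqrtr; rewrite lerDr sqr_ge0.
Qed.

Lemma cabs_le z : cabs z <= `|complex.Re z| + `|complex.Im z|.
Proof.
case: z => a b; rewrite /cabs normc_def /= -[leRHS]ger0_norm ?addr_ge0 //.
rewrite -sqrtr_sqr; apply: ler_wsqrtr.
rewrite -(real_normK (num_real a)) -(real_normK (num_real b)).
by have := normr_ge0 a; have := normr_ge0 b; nra.
Qed.

Lemma cvg_cabsP {T : Type} {F : set_system T} {FF : Filter F} (f : T -> C) (l : C) :
  f @ F --> l <-> forall e : R, 0 < e -> \forall t \near F, cabs (f t - l) < e.
Proof.
split=> [/cvgrPdist_lt fl e e0|fl].
  have e0' : 0 < e%:C by rewrite realc_lt.
  by apply: filterS (fl _ e0') => t; rewrite cabsE realc_lt cabsB.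
apply/cvgrPdist_lt => eps eps0.
have epsE : eps = (complex.Re eps)%:C.
  by apply: esym; apply: RRe_real; exact: gtr0_real eps0.
have e0 : 0 < complex.Re eps by move: eps0; rewrite {1}epsE realc_lt.
by apply: filterS (fl _ e0) => t; rewrite epsE cabsE realc_lt cabsB.
Qed.

Lemma near_cabsP (z : C) (P : C -> Prop) :
  (\forall x \near z, P x) <-> exists2 e : R, 0 < e & forall x, cabs (x - z) < e -> P x.
Proof.
split=> [/nbhs_ballP[eps /= eps0 epsP]|[e e0 eP]].
  have epsE : eps = (complex.Re eps)%:C.
    by apply: esym; apply: RRe_real; exact: gtr0_real eps0.
  exists (complex.Re eps); first by move: eps0; rewrite {1}epsE realc_lt.
  move=> x xz; apply: epsP; rewrite -ball_normE /= epsE cabsE realc_lt cabsB //.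
apply/nbhs_ballP; exists e%:C; first by rewrite /= realc_lt.
by move=> x; rewrite -ball_normE /= cabsE realc_lt => xz; apply: eP; rewrite cabsB.
Qed.

Lemma cabs_cvg_le {T : Type} {F : set_system T} {FF : ProperFilter F}
    (f : T -> C) (l : C) (e : R) :
  f @ F --> l -> (\forall t \near F, cabs (f t) <= e) -> cabs l <= e.
Proof.
move=> /cvg_cabsP fl fe; apply/ler_addgt0Pr => d d0.
have [t [tl te]] := filter_ex (filterI (fl _ d0) fe).
rewrite -[l](subKr (f t)); apply: le_trans (cabs_leB _ _) _.
by rewrite lerD // ltW.
Qed.

End Modulus.

(** * Sequences and products controlled by sum 1/l^2 *)

Section Sequences.
Local Open Scope classical_set_scope.
Context {R : realType}.
Local Notation C := (Cplx R).
Local Notation "a %:C" := (Complex a 0 : C) (format "a %:C").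

Lemma sum_inv_sqr n : \sum_(l < n.+1) (l.+1%:R ^- 2 : R) <= 2 - n.+1%:R^-1.
Proof.
elim: n => [|n IH]; first by rewrite big_ord1 expr1n invr1; lra.
rewrite big_ord_recr /=; apply: le_trans (lerD IH (lexx _)) _.
have a0 : 0 < n.+1%:R :> R by rewrite ltr0n.
rewrite -[n.+2%:R]natr1; move: (n.+1%:R : R) a0 => a a0.
have a1 : 0 < a + 1 by lra.
rewrite -(@ler_pM2r _ ((a + 1) ^+ 2 * a)) ?mulr_gt0 ?exprn_gt0 //.
have -> : (2 - a^-1 + (a + 1) ^- 2) * ((a + 1) ^+ 2 * a)
    = 2 * (a + 1) ^+ 2 * a - (a + 1) ^+ 2 + a.
  by field; rewrite !gt_eqF.
have -> : (2 - (a + 1)^-1) * ((a + 1) ^+ 2 * a) = 2 * (a + 1) ^+ 2 * a - (a + 1) * a.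
  by field; rewrite !gt_eqF.
nra.
Qed.

Lemma sum_inv_sqr_le2 n : \sum_(l < n) (l.+1%:R ^- 2 : R) <= 2.
Proof.
case: n => [|n]; first by rewrite big_ord0.
by apply: le_trans (sum_inv_sqr n) _; rewrite lerBlDr lerDl invr_ge0.
Qed.

(** Adding c times the partial sums of 1/(l+1)^2 makes u nondecreasing and keeps it bounded above,
    so u is a difference of two convergent sequences. *)
Lemma is_cvg_inv_sqr_increments (u : nat -> R) (c : R) :
  (forall n, `|u n.+1 - u n| <= c * n.+1%:R ^- 2) -> cvgn u.
Proof.
move=> uc.
have c0 : 0 <= c.
  by have := le_trans (normr_ge0 _) (uc 0); rewrite expr1n invr1 mulr1.
pose t n : R := \sum_(l < n) l.+1%:R ^- 2.
have tS n : t n.+1 = t n + n.+1%:R ^- 2 by rewrite /t big_ord_recr.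
have t_cvg : cvgn t.
  apply: nondecreasing_is_cvgn.
    by apply/nondecreasing_seqP => n; rewrite tS lerDl invr_ge0 exprn_ge0.
  by exists 2 => _ [n _ <-]; exact: sum_inv_sqr_le2.
pose v n := u n + c * t n.
have v_cvg : cvgn v.
  apply: nondecreasing_is_cvgn.
    apply/nondecreasing_seqP => n; rewrite /v tS mulrDr.
    have := uc n; rewrite ler_norml => /andP[].
    by move: (c / n.+1%:R ^+ 2) => q h1 h2; lra.
  have ut n : u n <= u 0 + c * t n.
    elim: n => [|n IH]; first by rewrite /t big_ord0 mulr0 addr0.
    rewrite tS mulrDr; have := uc n; rewrite ler_norml => /andP[].
    by move: (c / n.+1%:R ^+ 2) => q h1 h2; lra.
  exists (u 0 + c * 4) => _ [n _ <-]; rewrite /v.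
  have := ut n; have : c * t n <= c * 2 by rewrite ler_wpM2l // sum_inv_sqr_le2.
  lra.
have -> : u = (fun n => v n - c * t n).
  by apply/funext => n; rewrite /v addrK.
apply: is_cvgB => //; apply: is_cvgM => //; exact: is_cvg_cst.
Qed.

Lemma is_cvgC_inv_sqr_increments (u : nat -> C) (c : R) :
  (forall n, cabs (u n.+1 - u n) <= c * n.+1%:R ^- 2) -> exists l : C, u @ \oo --> l.
Proof.
move=> uc.
have ReB (x y : C) : complex.Re (x - y) = complex.Re x - complex.Re y by case: x; case: y.
have ImB (x y : C) : complex.Im (x - y) = complex.Im x - complex.Im y by case: x; case: y.
have /cvg_ex[/= a ua] : cvgn (fun n => complex.Re (u n)).
  apply: (@is_cvg_inv_sqr_increments _ c) => n; rewrite -ReB.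
  exact: le_trans (cabs_Re _) (uc n).
have /cvg_ex[/= b ub] : cvgn (fun n => complex.Im (u n)).
  apply: (@is_cvg_inv_sqr_increments _ c) => n; rewrite -ImB.
  exact: le_trans (cabs_Im _) (uc n).
exists (Complex a b : C); apply/cvg_cabsP => e e0.
have e2 : 0 < e / 2 by lra.
move/cvgrPdist_lt : ua => /(_ _ e2) ua; move/cvgrPdist_lt : ub => /(_ _ e2) ub.
near=> n; apply: le_lt_trans (cabs_le _) _.
rewrite ReB ImB /= [e]splitr.
by apply: ltrD; rewrite distrC; near: n.
Unshelve. all: by end_near. Qed.

(** With s the sum of the |x_l|, the error is at most s^2, and s <= 2 d. The induction closes
    because s^2 + 2 s |x| <= (s + |x|)^2; the condition on d gives s <= 1/2, hence |product - 1| <=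
    2 s. The bound does not depend on n and so survives the passage to infinite products. *)
Lemma cabs_prod_sub1 (x : nat -> C) (d : R) n :
  (forall l, cabs (x l) <= d * l.+1%:R ^- 2) -> d <= 4^-1 ->
  cabs (\prod_(l < n) (1 + x l) - 1 - \sum_(l < n) x l) <= 4 * d ^+ 2.
Proof.
move=> xd d1.
have d0 : 0 <= d.
  by have := le_trans (cabs_ge0 _) (xd 0); rewrite expr1n invr1 mulr1.
pose s n := \sum_(l < n) cabs (x l).
have s_ge0 m : 0 <= s m by apply: sumr_ge0 => l _; exact: cabs_ge0.
have s2 m : s m <= 2 * d.
  apply: le_trans (ler_sum _ (fun (l : 'I_m) _ => xd l)) _.
  by rewrite -mulr_sumr mulrC ler_wpM2r // sum_inv_sqr_le2.
suff H m : cabs (\prod_(l < m) (1 + x l) - 1 - \sum_(l < m) x l) <= s m ^+ 2.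
  by apply: le_trans (H n) _; have := s2 n; have := s_ge0 n; nra.
elim: m => [|m IH]; first by rewrite /s !big_ord0 subrr subr0 cabs0 expr0n.
have -> : \prod_(l < m.+1) (1 + x l) - 1 - \sum_(l < m.+1) x l
  = (\prod_(l < m) (1 + x l) - 1 - \sum_(l < m) x l)
    + x m * (\prod_(l < m) (1 + x l) - 1).
  by rewrite !big_ord_recr /=; ring.
apply: le_trans (cabsD _ _) _; rewrite cabsM.
have P : cabs (\prod_(l < m) (1 + x l) - 1) <= 2 * s m.
  rewrite -[X in cabs X](subrK (\sum_(l < m) x l)).
  apply: le_trans (cabsD _ _) _.
  have sx : cabs (\sum_(l < m) x l) <= s m by exact: (cabs_sum m x).
  by have := s2 m; have := s_ge0 m; nra.
have -> : s m.+1 = s m + cabs (x m) by rewrite /s big_ord_recr.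
have := cabs_ge0 (x m).
by have := ler_wpM2l (cabs_ge0 (x m)) P; have := s_ge0 m; nra.
Qed.

Lemma cabs_prod_le (x : nat -> C) (d : R) n :
  (forall l, cabs (x l) <= d * l.+1%:R ^- 2) ->
  cabs (\prod_(l < n) (1 + x l)) <= expR (2 * d).
Proof.
move=> xd.
have d0 : 0 <= d.
  by have := le_trans (cabs_ge0 _) (xd 0); rewrite expr1n invr1 mulr1.
apply: (@le_trans _ _ (expR (\sum_(l < n) (d * l.+1%:R ^- 2)))); last first.
  by rewrite ler_expR -mulr_sumr mulrC ler_wpM2r // sum_inv_sqr_le2.
elim: n => [|n IH]; first by rewrite !big_ord0 cabs1 expR0.
rewrite !big_ord_recr /= cabsM expRD.
apply: ler_pM => //; try exact: cabs_ge0.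
apply: le_trans (cabsD _ _) _; rewrite cabs1.
by apply: le_trans (expR_ge1Dx _); rewrite lerD2l.
Qed.

Lemma is_cvgC_prod (x : nat -> C) (d : R) :
  (forall l, cabs (x l) <= d * l.+1%:R ^- 2) ->
  exists l : C, (fun n => \prod_(l < n) (1 + x l)) @ \oo --> l.
Proof.
move=> xd; apply: (@is_cvgC_inv_sqr_increments _ (expR (2 * d) * d)) => n.
rewrite big_ord_recr /=.
rewrite -[X in _ - X]mulr1 -mulrBr addrC addKr cabsM -mulrA.
by apply: ler_pM; rewrite ?cabs_ge0 // cabs_prod_le.
Qed.

End Sequences.

(** * The complex exponential and its second-order estimate at 0 *)

Section CExp.
Local Open Scope classical_set_scope.
Context {R : realType}.
Local Notation C := (Cplx R).
Local Notation "a %:C" := (Complex a 0 : C) (format "a %:C").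
Implicit Types (s t : R) (w : C).

Definition cexp w : C :=
  Complex (expR (complex.Re w) * cos (complex.Im w))
          (expR (complex.Re w) * sin (complex.Im w)).

Lemma cpowE (a : R) w : cpow a w = cexp (w * (ln a)%:C).
Proof.
by case: w => x y; rewrite /cpow /cexp /= !mulr0 subr0 add0r.
Qed.

Lemma cexpD w1 w2 : cexp (w1 + w2) = cexp w1 * cexp w2.
Proof.
case: w1 w2 => x1 y1 [x2 y2]; rewrite /cexp /= expRD cosD sinD.
apply/eqP; rewrite eq_complex /=; apply/andP; split; apply/eqP; ring.
Qed.

Lemma cexp0 : cexp 0 = 1.
Proof. by rewrite /cexp /= expR0 cos0 sin0 mulr1 mulr0. Qed.

Lemma expR_sub1_le s : expR s - 1 <= s * expR s.
Proof.
have := ler_wpM2l (ltW (expR_gt0 s)) (expR_ge1Dx (- s)).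
rewrite expRxMexpNx_1; nra.
Qed.

Lemma expR_sub1 s : `|expR s - 1| <= `|s| * expR `|s|.
Proof.
have [s0|s0] := leP 0 s.
  rewrite (ger0_norm s0) ger0_norm ?expR_sub1_le //.
  by rewrite subr_ge0; apply: le_trans (expR_ge1Dx s); rewrite lerDl.
rewrite (ltr0_norm s0) ler0_norm ?subr_le0; last by rewrite expR_le1 ltW.
have := expR_ge1Dx s; have : 1 <= expR (- s) by apply: le_trans (expR_ge1Dx _); lra.
nra.
Qed.

Lemma expR_sub1s s : `|expR s - 1 - s| <= s ^+ 2 * expR `|s|.
Proof.
rewrite ger0_norm; last by have := expR_ge1Dx s; lra.
apply: (@le_trans _ _ (s * (expR s - 1))).
  by have := expR_sub1_le s; lra.
apply: le_trans (ler_norm _) _; rewrite normrM -(real_normK (num_real s)) expr2 -mulrA.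
by rewrite ler_wpM2l // expR_sub1.
Qed.

Lemma sin_mvt t : exists2 c, `|c| <= `|t| & sin t = cos c * t.
Proof.
wlog t0 : t / 0 <= t => [hw|].
  have [t0|t0] := leP 0 t; first exact: hw.
  have [c ct e] := hw (- t) (ltac:(by rewrite oppr_ge0 ltW)).
  by exists c; [rewrite -(normrN t)|rewrite -[LHS]opprK -sinN e mulrN opprK].
have [|c] := @MVT_segment R sin cos 0 t t0 (fun x _ => is_derive_sin x).
  by apply: continuous_subspaceT; exact: continuous_sin.
rewrite in_itv /= => /andP[c0 ct]; rewrite sin0 !subr0 => e.
by exists c => //; rewrite !ger0_norm.
Qed.

Lemma sin_le_norm t : `|sin t| <= `|t|.
Proof.
have [c _ ->] := sin_mvt t; rewrite normrM ler_piMl //; exact: cos_max.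
Qed.

Lemma cos_sub1 t : `|cos t - 1| <= t ^+ 2 / 2.
Proof.
have -> : cos t - 1 = - (2 * sin (t / 2) ^+ 2).
  by rewrite {1}[t]splitr -mulr2n cos_mulr2n cos2sin2; ring.
rewrite normrN normrM ger0_norm // normrX.
have := sin_le_norm (t / 2); rewrite normrM (@ger0_norm _ (2^-1)) //.
have := normr_ge0 (sin (t / 2)); rewrite -(real_normK (num_real t)).
have := normr_ge0 t; nra.
Qed.

Lemma cos_sub1_lin t : `|cos t - 1| <= `|t|.
Proof.
have -> : cos t - 1 = - (2 * sin (t / 2) ^+ 2).
  by rewrite {1}[t]splitr -mulr2n cos_mulr2n cos2sin2; ring.
rewrite normrN normrM ger0_norm // normrX.
have := sin_le_norm (t / 2); rewrite normrM (@ger0_norm _ (2^-1)) //.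
have := sin_max (t / 2); have := normr_ge0 (sin (t / 2)); have := normr_ge0 t; nra.
Qed.

Lemma sin_sub t : `|sin t - t| <= t ^+ 2.
Proof.
have [c ct ->] := sin_mvt t.
rewrite -{2}[t]mul1r -mulrBl normrM -(real_normK (num_real t)) expr2.
by rewrite ler_wpM2r //; exact: le_trans (cos_sub1_lin c) ct.
Qed.

(** With m = |w|, the real part contributes at most 3/2 m^2 e^m and the imaginary part at most 2 m^2
    e^m; 4 is a rounded-up sum. *)
Lemma cexp_sub1 w : cabs (cexp w - 1 - w) <= 4 * cabs w ^+ 2 * expR (cabs w).
Proof.
have hs := cabs_Re w; have ht := cabs_Im w.
case: w hs ht => s t /=; set m := cabs _ => hs ht.
have m0 : 0 <= m by exact: cabs_ge0.
apply: le_trans (cabs_le _) _; rewrite /= subr0.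
have E1 := expR_sub1s s; have E2 := expR_sub1 s.
have es := expR_gt0 s.
have eM : expR `|s| <= expR m by rewrite ler_expR.
have eM' : expR s <= expR m by rewrite ler_expR (le_trans (ler_norm _) hs).
have em1 : 1 <= expR m by apply: le_trans (expR_ge1Dx _); lra.
have c1 := cos_sub1 t; have s1 := sin_le_norm t; have s2 := sin_sub t.
have t2 : t ^+ 2 <= m ^+ 2 by rewrite -(real_normK (num_real t)) lerXn2r // nnegrE.
have s2' : s ^+ 2 <= m ^+ 2 by rewrite -(real_normK (num_real s)) lerXn2r // nnegrE.
have t0 := sqr_ge0 t; have s0 := sqr_ge0 s.
have A1 : `|expR s * cos t - 1 - s| <= m ^+ 2 * expR m + expR m * (m ^+ 2 / 2).
  have -> : expR s * cos t - 1 - s = (expR s - 1 - s) + expR s * (cos t - 1) by ring.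
  apply: le_trans (ler_normD _ _) _; rewrite normrM (ger0_norm (ltW es)).
  apply: lerD.
    apply: le_trans E1 _; apply: ler_pM => //; exact: expR_ge0.
  apply: ler_pM => //; lra.
have A2 : `|expR s * sin t - t| <= m * expR m * m + m ^+ 2.
  have -> : expR s * sin t - t = (expR s - 1) * sin t + (sin t - t) by ring.
  apply: le_trans (ler_normD _ _) _; rewrite normrM; apply: lerD; last lra.
  apply: ler_pM => //; last exact: le_trans s1 ht.
  by apply: le_trans E2 _; apply: ler_pM => //; exact: expR_ge0.
apply: le_trans (lerD A1 A2) _.
have m2 := sqr_ge0 m; nra.
Qed.

End CExp.

(** * The Gamma function *)

Section GammaProduct.
Local Open Scope classical_set_scope.
Context {R : realType}.
Local Notation C := (Cplx R).
Local Notation "a %:C" := (Complex a 0 : C) (format "a %:C").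
Implicit Types (z h : C) (l N : nat).

(** These terms sum to ln N ([ln_natS]), so that the power N^h in Gauss's product is distributed
    over the factors. *)
Definition lnr l : R := ln (1 + l.+1%:R^-1).

Lemma lnr_le l : 0 <= lnr l <= l.+1%:R^-1.
Proof.
have n0 : 0 < l.+1%:R^-1 :> R by rewrite invr_gt0 ltr0n.
rewrite /lnr; move: (l.+1%:R^-1) n0 => x x0.
apply/andP; split; first by apply: ln_ge0; lra.
by apply: le_ln1Dx; lra.
Qed.

Lemma lnr_ge l : l.+1%:R^-1 - lnr l <= l.+1%:R^-1 ^+ 2.
Proof.
have n0 : 0 < l.+1%:R^-1 :> R by rewrite invr_gt0 ltr0n.
rewrite /lnr; move: (l.+1%:R^-1) n0 => x x0.
have y0 : 0 < (1 + x)^-1 by rewrite invr_gt0; lra.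
have e : (1 + x) * (1 + x)^-1 = 1 by rewrite mulfV // gt_eqF //; lra.
have : ln (1 + ((1 + x)^-1 - 1)) <= (1 + x)^-1 - 1 by apply: le_ln1Dx; lra.
rewrite addrC subrK lnV ?posrE; last lra.
move: (ln _) ((1 + x)^-1) y0 e => w y y0 e.
nra.
Qed.

Lemma ln_natS N : ln N.+2%:R = ln N.+1%:R + lnr N :> R.
Proof.
have x0 : 0 < 1 + N.+1%:R^-1 :> R by rewrite addr_gt0 ?invr_gt0 ?ltr0n.
rewrite /lnr -lnM ?posrE ?ltr0n //.
by rewrite mulrDr mulr1 mulfV ?pnatr_eq0 // natr1.
Qed.

Lemma cexp_ln N : cexp (ln N.+1%:R)%:C = N.+1%:R :> C.
Proof.
by rewrite /cexp /= lnK ?posrE ?ltr0n // cos0 sin0 mulr1 mulr0 -realc_nat.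
Qed.

(** Factor of the infinite product for Gamma(1 + z + h) / Gamma(1 + z). Keeping z and h apart gives
    the cocycle rule [gprodD], from which the nonvanishing, the functional equation and the Taylor
    expansion of Gamma follow. *)
Definition gfac l z h : C :=
  cexp (h * (lnr l)%:C) * (l.+1%:R + z) / (l.+1%:R + z + h).

Definition gprod N z h : C := \prod_(l < N) gfac l z h.

(** Derivative of [gfac l z h] in h at h = 0; the sum of these terms is the classical series of
    digamma at 1 + z. *)
Definition bterm l z : C := (lnr l)%:C - (l.+1%:R + z)^-1.

Definition bsum N z : C := \sum_(l < N) bterm l z.

(** Says that 1 + z is not a pole of Gamma. *)
Definition offpole z : Prop := forall l, l.+1%:R + z != 0.

Lemma offpole0 : offpole 0.
Proof. by move=> l; rewrite addr0 pnatr_eq0. Qed.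

Lemma gprodD N z h1 h2 : offpole (z + h1) ->
  gprod N z (h1 + h2) = gprod N z h1 * gprod N (z + h1) h2.
Proof.
move=> oz; rewrite /gprod -big_split; apply: eq_bigr => l _ /=.
rewrite /gfac mulrDl cexpD !addrA.
have nz : l.+1%:R + z + h1 != 0 by rewrite -addrA oz.
move: nz; move: (_ + _ + h2)^-1 => v; set n := (_.+1)%:R; move: n => n nz.
by field.
Qed.

Lemma gprod0 N z : offpole z -> gprod N z 0 = 1.
Proof.
move=> oz; rewrite /gprod big1 // => l _.
by rewrite /gfac mul0r cexp0 mul1r addr0 mulfV.
Qed.

Lemma gprod0E N z : offpole z ->
  gprod N 0 z = cexp (z * (ln N.+1%:R)%:C) * N`!%:R / \prod_(l < N) (l.+1%:R + z).
Proof.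
move=> oz; elim: N => [|N IH].
  by rewrite /gprod !big_ord0 ln1 mulr0 cexp0 mulr1 divr1.
rewrite /gprod big_ord_recr /= -/(gprod N 0 z) IH big_ord_recr /= /gfac !addr0.
rewrite ln_natS realcD mulrDr cexpD factS natrM.
rewrite !invfM; move: (\prod_(_ < _) _)^-1 => v; move: (_ + z)^-1 => w.
ring.
Qed.

Lemma cvg_natS_ratio (a : C) : (fun N => N.+1%:R / (N.+1%:R + a)) @ \oo --> (1 : C).
Proof.
apply/cvg_cabsP => e e0; near=> N.
have aN : 2 * cabs a / e + 2 * cabs a < N%:R by near: N; exact: nbhs_infty_gtr.
have a0 := cabs_ge0 a.
have q0 : 0 <= 2 * cabs a / e by rewrite divr_ge0 ?(ltW e0) // mulr_ge0.
have q1 : 2 * cabs a / e * e = 2 * cabs a by rewrite divfK // gt_eqF.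
have Na : N.+1%:R / 2 <= cabs (N.+1%:R + a) :> R.
  apply: le_trans (cabsDge _ _); rewrite cabs_nat -natr1; lra.
have N0 : 0 < N.+1%:R :> R by rewrite ltr0n.
have Npos : 0 < cabs (N.+1%:R + a) by apply: lt_le_trans Na; rewrite divr_gt0.
have Nz : N.+1%:R + a != 0 by rewrite -cabs_gt0.
have -> : N.+1%:R / (N.+1%:R + a) - 1 = - a / (N.+1%:R + a).
  by move: (N.+1%:R : C) Nz => n nz; field.
rewrite cabsM cabsV cabsN ltr_pdivrMr //.
apply: lt_le_trans (ler_wpM2l (ltW e0) Na).
rewrite -natr1; nra.
Unshelve. all: by end_near. Qed.

(** The quotient defining Gamma(1 + z) has two more denominators than [gprod N 0 z]; they absorb the
    factors N + 1 coming from (N+1)! and from (N+1)^(1+z), and both resulting ratios tend to 1. *)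
Lemma gauss_gprod N z : offpole z ->
  N.+1`!%:R * cpow N.+1%:R (1 + z) / \prod_(l < N.+2) (1 + z + l%:R)
  = gprod N 0 z * (N.+1%:R / (N.+1%:R + z)) * (N.+1%:R / (N.+1%:R + (1 + z))).
Proof.
move=> oz; rewrite gprod0E // cpowE mulrDl mul1r cexpD cexp_ln factS natrM.
rewrite 2!big_ord_recr /=.
have -> : \prod_(i < N) (1 + z + i%:R) = \prod_(l < N) (l.+1%:R + z).
  by apply: eq_bigr => l _; rewrite -natr1; ring.
have -> : 1 + z + N%:R = N.+1%:R + z by rewrite -natr1; ring.
have -> : 1 + z + N.+1%:R = N.+1%:R + (1 + z) by ring.
rewrite !invfM; move: (\prod_(_ < _) _)^-1 => v.
move: (_ + z)^-1 (_ + (1 + z))^-1 => w w'.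
ring.
Qed.

Lemma cvg_Gamma z L : offpole z -> (fun N => gprod N 0 z) @ \oo --> L ->
  Gamma (1 + z) = L.
Proof.
move=> oz gL; apply/cvg_lim => //.
rewrite -cvg_shiftS; under eq_fun do rewrite gauss_gprod //.
rewrite -[L]mulr1 -[L * 1]mulr1; apply: cvgM; last exact: cvg_natS_ratio.
by apply: cvgM; last exact: cvg_natS_ratio.
Qed.

(** The terms of order 1/l in the exponential and in the rational part cancel, so b = [bterm l z] is
    O(1/l^2) and [gfac l z h] is 1 + h b up to O(h^2 / l^2). The constant K depends only on the
    bound H for z and h and on the separation c from the poles. *)
Lemma gfac_est (H c : R) : 0 <= H -> 0 < c -> exists2 K : R, 0 <= K & forall l z h,
  cabs z <= H -> cabs h <= H ->
  c * l.+1%:R <= cabs (l.+1%:R + z) -> c * l.+1%:R <= cabs (l.+1%:R + z + h) ->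
  cabs (gfac l z h - 1 - h * bterm l z) <= K * cabs h ^+ 2 * l.+1%:R ^- 2 /\
  cabs (bterm l z) <= K * l.+1%:R ^- 2.
Proof.
move=> H0 c0; set E := expR H.
have E0 : 0 < E by exact: expR_gt0.
have ci0 : 0 < c^-1 by rewrite invr_gt0.
pose K1 := (1 + H) * c^-1.
pose K2 := (4 * E * (1 + H) + K1) * c^-1.
have K10 : 0 <= K1 by rewrite mulr_ge0 ?ltW //; lra.
have K20 : 0 <= K2 by rewrite mulr_ge0 ?(ltW ci0) // addr_ge0 // !mulr_ge0 ?(ltW E0) //; lra.
exists (K1 + K2) => [|l z h zH hH zc zhc]; first by rewrite addr_ge0.
have n0 : 0 < l.+1%:R :> R by rewrite ltr0n.
have n1 : 1 <= l.+1%:R :> R by rewrite ler1n.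
have ni0 : 0 < l.+1%:R^-1 :> R by rewrite invr_gt0.
have cn0 : 0 < c * l.+1%:R by rewrite mulr_gt0.
have z0 : l.+1%:R + z != 0 by rewrite -cabs_gt0 (lt_le_trans cn0).
have zh0 : l.+1%:R + z + h != 0 by rewrite -cabs_gt0 (lt_le_trans cn0).
have iz : cabs (l.+1%:R + z)^-1 <= c^-1 * l.+1%:R^-1.
  by rewrite cabsV -invfM lef_pV2 ?posrE // (lt_le_trans cn0).
have izh : cabs (l.+1%:R + z + h)^-1 <= c^-1 * l.+1%:R^-1.
  by rewrite cabsV -invfM lef_pV2 ?posrE // (lt_le_trans cn0).
have /andP[w0 w1] := lnr_le l; have w2 := lnr_ge l.
set w := lnr l in w0 w1 w2 *.
set n : R := l.+1%:R in n0 n1 ni0 iz izh w1 w2 zc zhc *.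
have nC : l.+1%:R = n%:C :> C by rewrite -realc_nat.
have nn : n * n^-1 = 1 by rewrite mulfV // gt_eqF.
have B : cabs (bterm l z) <= K1 * n ^- 2.
  have -> : bterm l z = ((w * n - 1)%:C + w%:C * z) * (l.+1%:R + z)^-1.
    have -> : (w * n - 1)%:C = w%:C * l.+1%:R - 1.
      by rewrite realcD realcM nC; congr (_ + _); apply/eqP; rewrite eq_complex /= oppr0 !eqxx.
    by rewrite /bterm -/w; move: (l.+1%:R : C) z0 => k k0; field.
  rewrite cabsM.
  have P : cabs ((w * n - 1)%:C + w%:C * z) <= (1 + H) * n^-1.
    apply: le_trans (cabsD _ _) _; rewrite cabsM !cabs_real mulrDl mul1r (ger0_norm w0).
    apply: lerD; last by rewrite mulrC ler_pM // cabs_ge0.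
    have A1 : w * n <= 1 by rewrite -nn mulrC ler_wpM2l // ltW.
    have := ler_wpM2l (ltW n0) w2; rewrite mulrBr nn expr2 mulrA nn mul1r (mulrC n).
    move: ni0 A1; move: (w * n) (n^-1) => u x x0 u1 ux.
    by rewrite ler_norml; apply/andP; split; lra.
  have := ler_pM (cabs_ge0 _) (cabs_ge0 _) P iz.
  by rewrite /K1 -exprVn; move: n^-1 => x; nra.
split; last first.
  by apply: le_trans B _; rewrite ler_wpM2r ?invr_ge0 ?exprn_ge0 ?(ltW n0) // lerDl.
set b := bterm l z in B *.
set t := cexp (h * w%:C) - 1 - h * w%:C.
have T : cabs t <= 4 * E * (cabs h ^+ 2 * n ^- 2).
  have hw : cabs (h * w%:C) <= cabs h * n^-1.
    by rewrite cabsM cabs_real (ger0_norm w0) ler_wpM2l // cabs_ge0.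
  have hw' : cabs (h * w%:C) <= H.
    apply: le_trans hw _; rewrite -[H]mulr1 ler_pM ?cabs_ge0 ?(ltW ni0) //.
    by rewrite invf_le1.
  apply: le_trans (cexp_sub1 _) _.
  rewrite [leRHS]mulrAC; apply: ler_pM; rewrite ?expR_ge0 ?ler_expR //.
    by rewrite mulr_ge0 ?sqr_ge0 ?ler0n.
  rewrite ler_wpM2l // -exprVn -exprMn lerXn2r ?nnegrE ?cabs_ge0 //.
  by rewrite mulr_ge0 ?cabs_ge0 // ltW.
(* Exact form of the error, t being the second-order remainder of the exponential; both terms of the
   numerator are O(h^2 / l). *)
have -> : gfac l z h - 1 - h * b
    = (t * (l.+1%:R + z) - h ^+ 2 * b) * (l.+1%:R + z + h)^-1.
  rewrite /t /gfac /b /bterm -/w; move: (l.+1%:R : C) z0 zh0 => k k0 k1.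
  by field; apply/andP.
rewrite cabsM.
have nz : cabs (l.+1%:R + z) <= (1 + H) * n.
  apply: le_trans (cabsD _ _) _; rewrite cabs_nat mulrDl mul1r; apply: lerD => //.
  by apply: le_trans zH _; rewrite -[leLHS]mulr1 ler_wpM2l.
have P : cabs (t * (l.+1%:R + z) - h ^+ 2 * b)
    <= (4 * E * (1 + H) + K1) * (cabs h ^+ 2 * n^-1).
  apply: le_trans (cabs_leB _ _) _; rewrite !cabsM mulrDl.
  apply: lerD.
    apply: le_trans (ler_pM (cabs_ge0 _) (cabs_ge0 _) T nz) _.
    have -> : 4 * E * (cabs h ^+ 2 * n ^- 2) * ((1 + H) * n)
      = 4 * E * (1 + H) * (cabs h ^+ 2 * n^-1) by field; rewrite gt_eqF.
    exact: lexx.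
  have -> : K1 * (cabs h ^+ 2 * n^-1) = cabs h ^+ 2 * (K1 * n^-1) by ring.
  rewrite -expr2 ler_wpM2l ?sqr_ge0 //; apply: le_trans B _.
  rewrite ler_wpM2l // -exprVn expr2 -[leRHS]mulr1 ler_wpM2l ?(ltW ni0) //.
  by rewrite invf_le1.
apply: le_trans (ler_pM (cabs_ge0 _) (cabs_ge0 _) P izh) _.
have -> : (4 * E * (1 + H) + K1) * (cabs h ^+ 2 * n^-1) * (c^-1 * n^-1)
  = K2 * cabs h ^+ 2 * n ^- 2 by rewrite /K2 -exprVn; ring.
rewrite ler_wpM2r ?invr_ge0 ?exprn_ge0 ?(ltW n0) //.
by rewrite ler_wpM2r ?sqr_ge0 // lerDr.
Qed.

(** Once l + 1 >= 2 |z| the constant 1/2 works; the finitely many remaining l are handled by a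
    minimum. *)
Lemma offpole_sep z : offpole z -> exists2 c : R, 0 < c & forall l, c * l.+1%:R <= cabs (l.+1%:R + z).
Proof.
move=> oz.
have small L : exists2 c : R, 0 < c & forall l, (l < L)%N -> c * l.+1%:R <= cabs (l.+1%:R + z).
  elim: L => [|L [c c0 cL]]; first by exists 1.
  have aL : 0 < cabs (L.+1%:R + z) / L.+1%:R by rewrite divr_gt0 ?cabs_gt0 ?ltr0n.
  exists (Num.min c (cabs (L.+1%:R + z) / L.+1%:R)); first by rewrite lt_min c0.
  move=> l; rewrite ltnS leq_eqVlt => /predU1P[->|lL].
    by rewrite -ler_pdivlMr ?ltr0n // ge_min lexx orbT.
  by apply: le_trans (cL _ lL); rewrite ler_wpM2r // ge_min lexx.
have [c c0 cL] := small (Num.bound (2 * cabs z)).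
exists (Num.min c 2^-1); first by rewrite lt_min c0 invr_gt0 ltr0n.
move=> l; have [lt|ge] := ltnP l (Num.bound (2 * cabs z)).
  by apply: le_trans (cL _ lt); rewrite ler_wpM2r // ge_min lexx.
apply: (@le_trans _ _ (2^-1 * l.+1%:R)).
  by rewrite ler_wpM2r // ge_min lexx orbT.
apply: le_trans (cabsDge _ _); rewrite cabs_nat.
have : 2 * cabs z <= l.+1%:R.
  apply: le_trans (ltW (archi_boundP _)) _; first by rewrite mulr_ge0 ?cabs_ge0.
  by rewrite ler_nat ltnW.
lra.
Qed.

Lemma gprod_is_cvg z h : offpole z -> offpole (z + h) ->
  exists L : C, (fun N => gprod N z h) @ \oo --> L.
Proof.
move=> /offpole_sep[c c0 zc] /offpole_sep[d d0 zd].
pose H := cabs z + cabs h; pose e := Num.min c d.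
have e0 : 0 < e by rewrite lt_min c0.
have H0 : 0 <= H by rewrite addr_ge0 ?cabs_ge0.
have [K K0 est] := gfac_est H0 e0.
have -> : (fun N => gprod N z h) = (fun N => \prod_(l < N) (1 + (gfac l z h - 1))).
  by apply/funext => N; apply: eq_bigr => l _; rewrite addrC subrK.
apply: (@is_cvgC_prod _ (fun l => gfac l z h - 1) (K * cabs h ^+ 2 + cabs h * K)) => l.
have [||||e1 e2] := est l z h.
- by rewrite lerDl cabs_ge0.
- by rewrite lerDr cabs_ge0.
- by apply: le_trans (zc l); rewrite ler_wpM2r // ge_min lexx.
- by rewrite -addrA; apply: le_trans (zd l); rewrite ler_wpM2r // ge_min lexx orbT.
rewrite -[X in cabs X](subrK (h * bterm l z)) mulrDl.
apply: le_trans (cabsD _ _) _; apply: lerD => //.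
by rewrite cabsM -mulrA ler_wpM2l // cabs_ge0.
Qed.

Lemma gprod_cvg z : offpole z -> (fun N => gprod N 0 z) @ \oo --> Gamma (1 + z).
Proof.
move=> oz; have [||L gL] := @gprod_is_cvg 0 z; [exact: offpole0|by rewrite add0r|].
by rewrite (cvg_Gamma oz gL).
Qed.

Lemma cvgC_unique {T : Type} {F : set_system T} {FF : ProperFilter F}
    (f : T -> C) (l1 l2 : C) : f @ F --> l1 -> f @ F --> l2 -> l1 = l2.
Proof.
move=> h1 h2; have hC : hausdorff_space C by exact: norm_hausdorff.
by rewrite -(cvg_lim hC h1) -(cvg_lim hC h2).
Qed.

(** By the cocycle rule, moving from 0 to z and back gives 1 at every finite stage; the limit for
    the way back is an inverse of Gamma(1 + z). *)
Lemma Gamma1p_neq0 z : offpole z -> Gamma (1 + z) != 0.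
Proof.
move=> oz; have [||L gL] := @gprod_is_cvg z (- z) => //; first by rewrite subrr; exact: offpole0.
have H : (fun N => gprod N 0 z) \* (fun N => gprod N z (- z)) @ \oo --> Gamma (1 + z) * L.
  by apply: cvgM; [exact: gprod_cvg|].
move: H; have -> : (fun N => gprod N 0 z) \* (fun N => gprod N z (- z)) = fun=> 1.
  apply/funext => N /=; rewrite -[X in _ * gprod N X _]add0r -gprodD ?add0r //.
  by rewrite subrr gprod0 //; exact: offpole0.
move=> H; have E : Gamma (1 + z) * L = 1 by apply: cvgC_unique H (cvg_cst _).
by apply: contraPneq E => ->; rewrite mul0r => /esym/eqP; rewrite oner_eq0.
Qed.

Lemma Gamma1 : Gamma 1 = 1 :> C.
Proof.
rewrite -[X in Gamma X]addr0; apply: cvg_Gamma; first exact: offpole0.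
rewrite (_ : (fun N => gprod N 0 0) = fun=> 1); first exact: cvg_cst.
by apply/funext => N; rewrite gprod0 //; exact: offpole0.
Qed.

(** For h = 1 the product telescopes. Its limit z is the factor in Gamma(z + 1) = z Gamma(z). *)
Lemma gprod_one N z : offpole z -> z != 0 -> offpole (z - 1) ->
  gprod N (z - 1) 1 = N.+1%:R * z / (N%:R + z).
Proof.
move=> oz z0 oz1; elim: N => [|N IH]; first by rewrite /gprod big_ord0 add0r mul1r mulfV.
rewrite /gprod big_ord_recr /= -/(gprod N _ _) IH /gfac mul1r.
have -> : cexp (lnr N)%:C = N.+2%:R / N.+1%:R :> C.
  apply: (@mulfI _ N.+1%:R); first by rewrite pnatr_eq0.
  by rewrite -{1}cexp_ln -cexpD -realcD -ln_natS cexp_ln mulrCA mulfV ?mulr1 ?pnatr_eq0.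
have -> : N.+1%:R + (z - 1) = N%:R + z by rewrite -natr1; ring.
have -> : N%:R + z + 1 = N.+1%:R + z by rewrite -natr1; ring.
have n1 : N.+1%:R != 0 :> C by rewrite pnatr_eq0.
have n2 := oz N.
have n3 : N%:R + z != 0 by have := oz1 N; rewrite -natr1; congr (_ != _); ring.
move: (N.+2%:R : C) (N.+1%:R : C) (N%:R : C) n1 n2 n3 => a b d n1 n2 n3.
by field; apply/and3P.
Qed.

Lemma offpole_pred z : ~ Gamma_pole z -> offpole (z - 1).
Proof.
move=> npz l; apply/eqP => e; apply: npz; exists l.
by apply/eqP; rewrite -addr_eq0 -e -natr1; apply/eqP; ring.
Qed.

Lemma nonpole_neq0 z : ~ Gamma_pole z -> z != 0.
Proof. by move=> npz; apply/eqP => z0; apply: npz; exists 0; rewrite oppr0. Qed.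

Lemma nonpole_succ z : ~ Gamma_pole z -> ~ Gamma_pole (z + 1).
Proof.
move=> npz [j e]; apply: npz; exists j.+1.
by rewrite -natr1 opprD -e addrK.
Qed.

Lemma offpole_nonpole z : ~ Gamma_pole z -> offpole z.
Proof. by move=> /nonpole_succ/offpole_pred; rewrite addrK. Qed.

Lemma Gamma_neq0 z : ~ Gamma_pole z -> Gamma z != 0.
Proof. by move=> /offpole_pred/Gamma1p_neq0; rewrite [1 + _]addrC subrK. Qed.

Lemma GammaS z : ~ Gamma_pole z -> Gamma (z + 1) = z * Gamma z.
Proof.
move=> npz; have oz1 := offpole_pred npz; have oz := offpole_nonpole npz.
have z0 := nonpole_neq0 npz.
have H1 := gprod_cvg oz1; rewrite [1 + _]addrC subrK in H1.
rewrite [z + 1]addrC [RHS]mulrC; apply: (cvg_Gamma oz).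
have -> : (fun N => gprod N 0 z)
  = (fun N => gprod N 0 (z - 1) * (N.+1%:R / (N.+1%:R + (z - 1)) * z)).
  apply/funext => N.
  have := @gprodD N 0 (z - 1) 1; rewrite add0r subrK => ->; last exact: oz1.
  rewrite gprod_one //.
  by congr (_ * _); rewrite mulrAC -natr1; congr (_ / _ * _); ring.
apply: cvgM; first exact: H1.
rewrite -[X in _ --> X]mul1r; apply: cvgM; [exact: cvg_natS_ratio|exact: cvg_cst].
Qed.

End GammaProduct.

(** * Derivative of Gamma; series, recurrence and continuity at 1 of digamma *)

Section Digamma.
Local Open Scope classical_set_scope.
Context {R : realType}.
Local Notation C := (Cplx R).
Implicit Types (x z h : C) (l N : nat).

Lemma is_deriveCP (f : C -> C) x df :
  is_derive x 1 f df <-> (fun h => (f (x + h) - f x) / h) @ 0^' --> df.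
Proof.
have E : (fun h => h^-1 *: ((f \o shift x) (h *: 1) - f x))
    = (fun h => (f (x + h) - f x) / h).
  by apply/funext => h; rewrite /= [_%:A]mulr1 [h + x]addrC [LHS]mulrC.
split=> [[+ <-]|fx].
  by rewrite /derivable /derive E.
split; first by rewrite /derivable E; apply/cvg_ex; exists df.
by rewrite /derive E; exact/cvg_lim.
Qed.

Lemma is_deriveC_taylor (f : C -> C) x df (K d : R) : 0 < d ->
  (forall h, cabs h < d -> cabs (f (x + h) - f x - h * df) <= K * cabs h ^+ 2) ->
  is_derive x 1 f df.
Proof.
move=> d0 fK; apply/is_deriveCP/cvg_cabsP => e e0.
(* K is not assumed positive, and it is about to appear as a divisor. *)
have K0 : 0 < Num.max K 1 by rewrite lt_max ltr01 orbT.
apply/near_cabsP; exists (Num.min d (e / Num.max K 1)).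
  by rewrite lt_min d0 divr_gt0.
move=> h; rewrite subr0 lt_min => /andP[hd he] h0.
have hp : 0 < cabs h by rewrite cabs_gt0.
have -> : (f (x + h) - f x) / h - df = (f (x + h) - f x - h * df) / h by field.
rewrite cabsM cabsV ltr_pdivrMr //; apply: le_lt_trans (fK _ hd) _.
rewrite expr2 mulrA ltr_pM2r //.
move: he; rewrite ltr_pdivlMr //; apply: le_lt_trans; rewrite mulrC.
by rewrite ler_wpM2l ?cabs_ge0 // le_max lexx.
Qed.

(** Each partial product is 1 + h [bsum N z] up to a multiple of h^2 that does not depend on N, so
    the expansion passes to the limit and no limit has to be exchanged with a derivative. *)
Lemma Gamma_taylor z : offpole z -> exists2 B : C, (fun N => bsum N z) @ \oo --> B &
  exists K d : R, 0 < d /\ forall h, cabs h < d ->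
    cabs (Gamma (1 + z + h) - Gamma (1 + z) - h * (Gamma (1 + z) * B)) <= K * cabs h ^+ 2.
Proof.
move=> oz; have [c c0 zc] := offpole_sep oz.
have H0 : 0 <= cabs z + 1 by rewrite addr_ge0 ?cabs_ge0.
have c20 : 0 < c / 2 by rewrite divr_gt0.
have [K K0 est] := gfac_est H0 c20.
have zc2 l : c / 2 * l.+1%:R <= cabs (l.+1%:R + z).
  apply: le_trans (zc l); rewrite ler_wpM2r //; lra.
have zH : cabs z <= cabs z + 1 by rewrite lerDl.
have bK l : cabs (bterm l z) <= K * l.+1%:R ^- 2.
  have h0 : cabs (0 : C) <= cabs z + 1 by rewrite cabs0.
  by have [|//] := est l z 0 zH h0 (zc2 l); rewrite addr0.
have [B BB] : exists B : C, (fun N => bsum N z) @ \oo --> B.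
  apply: (@is_cvgC_inv_sqr_increments _ _ K) => N.
  have -> : bsum N.+1 z - bsum N z = bterm N z by rewrite /bsum big_ord_recr /=; ring.
  exact: bK.
exists B; first exact: BB.
have K8 : 0 < (8 * K + 8)^-1 by rewrite invr_gt0; lra.
exists (cabs (Gamma (1 + z)) * (16 * K ^+ 2 + 2 * K)).
(* The three bounds on |h| serve in turn to stay at relative distance c/2 from the poles, to have
   |h| <= |z| + 1, and to make 2 K |h| <= 1/4 as [cabs_prod_sub1] demands. That lemma accounts for
   16 K^2 and the summed remainders for 2 K. *)
exists (Num.min (c / 2) (Num.min 1 (8 * K + 8)^-1)); split.
  by rewrite !lt_min c20 ltr01.
move=> h; rewrite !lt_min => /and3P[hc h1 hK].
have zhc l : c / 2 * l.+1%:R <= cabs (l.+1%:R + z + h).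
  apply: le_trans (cabsDge _ _); rewrite lerBrDr; apply: le_trans (zc l).
  have : 1 <= l.+1%:R :> R by rewrite ler1n.
  move: (l.+1%:R : R) => n n1; nra.
have ozh : offpole (z + h).
  move=> l; rewrite addrA -cabs_gt0; apply: lt_le_trans (zhc l).
  by rewrite mulr_gt0.
have hH : cabs h <= cabs z + 1 by have := cabs_ge0 z; lra.
have hp := cabs_ge0 h.
have [L gL] := gprod_is_cvg oz ozh.
have GL : Gamma (1 + z + h) = Gamma (1 + z) * L.
  rewrite -addrA; apply: cvgC_unique (gprod_cvg ozh) _.
  have -> : (fun N => gprod N 0 (z + h)) = (fun N => gprod N 0 z * gprod N z h).
    by apply/funext => N; rewrite gprodD add0r.
  by apply: cvgM; [exact: gprod_cvg|exact: gL].
have gK l : cabs (gfac l z h - 1 - h * bterm l z) <= K * cabs h ^+ 2 * l.+1%:R ^- 2.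
  by have [] := est l z h zH hH (zc2 l) (zhc l).
have hK8 : (8 * K + 8) * cabs h <= 1.
  by rewrite mulrC -ler_pdivlMr ?mul1r ?(ltW hK) // -invr_gt0.
have g1 l : cabs (gfac l z h - 1) <= 2 * K * cabs h * l.+1%:R ^- 2.
  rewrite -[X in cabs X](subrK (h * bterm l z)).
  apply: le_trans (cabsD _ _) _; rewrite cabsM.
  have := gK l; have := bK l; have : 0 <= l.+1%:R ^- 2 :> R by rewrite invr_ge0 exprn_ge0.
  move: (l.+1%:R ^- 2 : R) => q q0 b1 b2.
  have b3 := ler_wpM2l hp b1.
  apply: le_trans (lerD b2 b3) _.
  have -> : K * cabs h ^+ 2 * q + cabs h * (K * q) = (K * cabs h * q) * (cabs h + 1) by ring.
  have -> : 2 * K * cabs h * q = (K * cabs h * q) * 2 by ring.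
  by rewrite ler_wpM2l ?mulr_ge0 //; lra.
have d1 : 2 * K * cabs h <= 4^-1 by nra.
have est2 N : cabs (gprod N z h - 1 - h * bsum N z) <= (16 * K ^+ 2 + 2 * K) * cabs h ^+ 2.
  have := cabs_prod_sub1 N g1 d1.
  have -> : \prod_(l < N) (1 + (gfac l z h - 1)) = gprod N z h.
    by apply: eq_bigr => l _; rewrite [1 + _]addrC subrK.
  move=> P1.
  have P2 : cabs (\sum_(l < N) (gfac l z h - 1) - h * bsum N z) <= 2 * K * cabs h ^+ 2.
    rewrite /bsum mulr_sumr -sumrB.
    apply: le_trans (cabs_sum N (fun l => gfac l z h - 1 - h * bterm l z)) _.
    apply: le_trans (ler_sum _ (fun (l : 'I_N) _ => gK l)) _.
    have -> : 2 * K * cabs h ^+ 2 = K * cabs h ^+ 2 * 2 by ring.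
    by rewrite -mulr_sumr ler_wpM2l ?sum_inv_sqr_le2 // mulr_ge0 ?sqr_ge0.
  have -> : gprod N z h - 1 - h * bsum N z
    = (gprod N z h - 1 - \sum_(l < N) (gfac l z h - 1))
      + (\sum_(l < N) (gfac l z h - 1) - h * bsum N z) by ring.
  apply: le_trans (cabsD _ _) _; apply: le_trans (lerD P1 P2) _.
  by rewrite le_eqVlt; apply/orP; left; apply/eqP; ring.
rewrite GL.
have -> : Gamma (1 + z) * L - Gamma (1 + z) - h * (Gamma (1 + z) * B)
  = Gamma (1 + z) * (L - 1 - h * B) by ring.
rewrite cabsM -[leRHS]mulrA ler_wpM2l ?cabs_ge0 //.
have cv : (fun N => gprod N z h - 1 - h * bsum N z) @ \oo --> L - 1 - h * B.
  exact: (cvgB (cvgB gL (cvg_cst (1 : C))) (cvgM (cvg_cst h) BB)).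
by apply: (cabs_cvg_le cv); apply: nearW => N; exact: est2.
Qed.

Lemma Gamma1p_derive_digamma z : offpole z ->
  (fun N => bsum N z) @ \oo --> digamma (1 + z) /\
  is_derive (1 + z) 1 Gamma (Gamma (1 + z) * digamma (1 + z)).
Proof.
move=> oz; have [B BB [K [d [d0 T]]]] := Gamma_taylor oz.
have D : is_derive (1 + z) 1 Gamma (Gamma (1 + z) * B) by exact: is_deriveC_taylor T.
have -> : digamma (1 + z) = B; last by split.
by rewrite /digamma derive1E derive_val mulrC mulrA mulVf ?mul1r ?Gamma1p_neq0.
Qed.

Lemma is_derive_Gamma z : ~ Gamma_pole z -> is_derive z 1 Gamma (Gamma z * digamma z).
Proof.
by move=> /offpole_pred/Gamma1p_derive_digamma[_]; rewrite [1 + _]addrC subrK.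
Qed.

Lemma cvg_Gamma_at z : ~ Gamma_pole z -> Gamma @ z --> Gamma z.
Proof.
move=> /is_derive_Gamma [dz _].
have /derivable1_diffP d := dz.
by have := differentiable_continuous d.
Qed.

Lemma cvg_invn_shift z : (fun N => (N%:R + z)^-1) @ \oo --> (0 : C).
Proof.
apply/cvg_cabsP => e e0; near=> N.
have zN : e^-1 + cabs z < N%:R by near: N; exact: nbhs_infty_gtr.
have e1 : 0 < e^-1 by rewrite invr_gt0.
rewrite subr0 cabsV -[ltRHS]invrK ltf_pV2 ?posrE //.
  by apply: lt_le_trans (cabsDge _ _); rewrite cabs_nat; lra.
by apply: lt_le_trans (cabsDge _ _); rewrite cabs_nat; lra.
Unshelve. all: by end_near. Qed.

(** Read off the series: the partial sums at z and z - 1 differ by the telescoping amount 1/z - 1/(N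
    + z). *)
Lemma digammaS z : ~ Gamma_pole z -> digamma (z + 1) = digamma z + z^-1.
Proof.
move=> npz.
have [B1 _] := Gamma1p_derive_digamma (offpole_pred npz).
have [B0 _] := Gamma1p_derive_digamma (offpole_nonpole npz).
rewrite [1 + (z - 1)]addrC subrK in B1.
rewrite addrC; apply: cvgC_unique B0 _.
have -> : (fun N => bsum N z) = (fun N => bsum N (z - 1) + (z^-1 - (N%:R + z)^-1)).
  apply/funext => N; elim: N => [|N IH].
    by rewrite /bsum !big_ord0 !add0r subrr.
  rewrite /bsum !big_ord_recr /= -/(bsum N z) -/(bsum N (z - 1)) IH /bterm.
  have -> : N.+1%:R + (z - 1) = N%:R + z by rewrite -natr1; ring.
  by ring.
apply: cvgD; first exact: B1.
rewrite -[X in _ --> X]subr0; apply: cvgB; first exact: cvg_cst.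
exact: cvg_invn_shift.
Qed.

Lemma nonpole1D h : cabs h < 1 -> ~ Gamma_pole (1 + h).
Proof.
move=> h1 [j e]; have := h1.
have -> : h = - j.+1%:R by rewrite -natr1 opprD -e; ring.
by rewrite cabsN cabs_nat ltNge ler1n.
Qed.

(** The point 1 is the only one at which continuity of digamma is called upon: every other digamma
    value arises from a rational function of eps. Termwise the series changes by at most 2 |h| /
    (l+1)^2, in total by at most 4 |h|. *)
Lemma digamma_cvg1 : (fun h => digamma (1 + h)) @ (0 : C) --> digamma (1 : C).
Proof.
apply/(@cvg_cabsP R C (nbhs (0 : C))) => e e0; apply/near_cabsP.
exists (Num.min 2^-1 (e / 8)).
  by rewrite lt_min invr_gt0 ltr0n divr_gt0.
move=> h; rewrite subr0 lt_min => /andP[h2 he].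
have [B1 _] := Gamma1p_derive_digamma (@offpole0 R).
rewrite addr0 in B1.
have oh : offpole h.
  move=> l; rewrite -cabs_gt0; apply: lt_le_trans (cabsDge _ _); rewrite cabs_nat.
  by have : 1 <= l.+1%:R :> R by [rewrite ler1n]; move: (l.+1%:R : R) => n; lra.
have [B0 _] := Gamma1p_derive_digamma oh.
apply: (@le_lt_trans _ _ (4 * cabs h)); last by have := cabs_ge0 h; lra.
have cv : (fun N => bsum N h - bsum N 0) @ \oo --> digamma (1 + h) - digamma 1.
  by apply: cvgB; [exact: B0|exact: B1].
apply: (cabs_cvg_le cv); apply: nearW => N; rewrite /bsum -sumrB.
apply: le_trans (cabs_sum N (fun l => bterm l h - bterm l 0)) _.
apply: (@le_trans _ _ (\sum_(l < N) (2 * cabs h * l.+1%:R ^- 2))); last first.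
  rewrite -mulr_sumr.
  have -> : 4 * cabs h = 2 * cabs h * 2 by ring.
  by rewrite ler_wpM2l ?sum_inv_sqr_le2 // mulr_ge0 ?cabs_ge0.
apply: ler_sum => l _.
have n1 : 1 <= l.+1%:R :> R by rewrite ler1n.
have n0 : l.+1%:R != 0 :> C by rewrite pnatr_eq0.
have nh : l.+1%:R / 2 <= cabs (l.+1%:R + h).
  apply: le_trans (cabsDge _ _); rewrite cabs_nat.
  by move: (l.+1%:R : R) n1 => n; lra.
have -> : bterm l h - bterm l 0 = h * (l.+1%:R^-1 * (l.+1%:R + h)^-1).
  rewrite /bterm addr0; have := oh l; move: (l.+1%:R : C) n0 => n n0 nh0.
  by field; apply/andP.
rewrite !cabsM !cabsV cabs_nat [2 * _]mulrC -mulrA ler_wpM2l ?cabs_ge0 //.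
have -> : 2 * l.+1%:R ^- 2 = l.+1%:R^-1 * (l.+1%:R / 2)^-1 :> R.
  by move: (l.+1%:R : R) => n; rewrite invf_div -exprVn; ring.
have p0 : 0 < l.+1%:R :> R by rewrite ltr0n.
rewrite ler_wpM2l ?invr_ge0 ?(ltW p0) // lef_pV2 ?posrE ?divr_gt0 //.
by apply: lt_le_trans nh; rewrite divr_gt0.
Qed.

End Digamma.

(** * Residues *)

Definition pos_part (s : int) : nat := if s is Posz j then j else 0%N.
Definition neg_part (s : int) : nat := if s is Negz j then j.+1 else 0%N.

Lemma pos_neg_part (s : int) : s = (pos_part s)%:Z - (neg_part s)%:Z.
Proof. by case: s => j /=; rewrite ?subr0 ?sub0r. Qed.

Lemma nterms_pos_part (s : int) : nterms s = pos_part (s + 1).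
Proof. by case: s => [j|[|j]] //=; rewrite addn1. Qed.

Section RationalPochhammer.
Context {F : numFieldType}.
Implicit Types (x y : F) (s : int) (j : nat).

(* The shifted factorial (x)_s as a rational function of x, for s of any sign. *)
Definition rpoch x s : F :=
  (\prod_(l < pos_part s) (x + l%:R)) / \prod_(l < neg_part s) (x - l.+1%:R).

Definition nonint x : Prop := forall s : int, x != s%:~R.

Lemma nonint_shift x s : nonint x -> nonint (x + s%:~R).
Proof.
move=> nx t; apply: contra_neq (nx (t - s)) => e.
by rewrite rmorphB /= -e addrK.
Qed.

Lemma nonintN x : nonint x -> nonint (- x).
Proof.
by move=> nx t; apply: contra_neq (nx (- t)) => e; rewrite rmorphN /= -e opprK.
Qed.

Lemma nonint_add x j : nonint x -> x + j%:R != 0.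
Proof.
by move=> /(_ (- j%:Z)); rewrite rmorphN /= -subr_eq0 opprK pmulrn.
Qed.

Lemma nonint_sub x j : nonint x -> x - j%:R != 0.
Proof. by move=> /(_ j%:Z); rewrite -subr_eq0 pmulrn. Qed.

Lemma rpoch_neq0 x s : nonint x -> rpoch x s != 0.
Proof.
move=> nx; rewrite mulf_neq0 ?invr_eq0 //; apply/prodf_neq0 => l _.
  exact: nonint_add.
exact: nonint_sub.
Qed.

End RationalPochhammer.

Section Residues.
Local Open Scope classical_set_scope.
Context {R : realType} {r : nat}.
Local Notation C := (Cplx R).
Variables (n m : 'rV[int]_r) (k : int).
Hypothesis mk : forall l, 0 <= m 0 l + k.
Implicit Types (alpha beta : 'rV[C]_r) (i l : 'I_r) (j : nat).

Lemma sum_arith_bernoulli_int (s : int) j (x : C) :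
  \sum_(t < pos_part s) (x + t%:R) ^+ j - \sum_(t < neg_part s) (x - t.+1%:R) ^+ j
  = (bernoulli_poly j.+1 (x + s%:~R) - bernoulli_poly j.+1 x) / j.+1%:R.
Proof.
case: s => d /=; first by rewrite big_ord0 subr0 sum_arith_bernoulli.
have -> : \sum_(t < d.+1) (x - t.+1%:R) ^+ j
    = \sum_(t < d.+1) ((x - d.+1%:R) + t%:R) ^+ j.
  rewrite (reindex_inj rev_ord_inj) /=; apply: eq_bigr => t _.
  have tN := ltn_ord t; rewrite (_ : (d.+1 - t.+1).+1 = (d.+1 - t)%N); last by lia.
  by rewrite natrB 1?ltnW //; congr (_ ^+ _); ring.
rewrite sum_arith_bernoulli subrK big_ord0 NegzE rmorphN /=.
by rewrite sub0r -mulNr opprB.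
Qed.

(* The residue at s = alpha_i - j of the rational function
   prod_l (1 - beta_l + s)_{m_l + k} / prod_l (s - alpha_l)_{n_l + k + 1}. *)
Definition res alpha i beta j : C :=
  (\prod_l rpoch (1 - beta 0 l + alpha 0 i - j%:R) (m 0 l + k))
  * (\prod_(l | l != i) rpoch (alpha 0 i - alpha 0 l - j%:R) (n 0 l + k + 1))^-1
  * ((- 1) ^+ j / (j`!%:R * ((nterms (k + n 0 i)%R).-1 - j)`!%:R)).

Local Notation npoles l := (pos_part (n 0 l + k + 1)%R).
Local Notation nzeros l := (neg_part (n 0 l + k + 1)%R).
Local Notation kC := (k%:~R : C).

(** Poles and zeros in the variable s + k. With this shift the upper ends of the arithmetic
    progressions do not involve k, as in the last two Bernoulli terms of Q_j. When n_l + k + 1 < 0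
    the denominator symbol contributes zeros instead of poles. *)
Definition poles alpha : seq C :=
  [seq alpha 0 l + kC - t%:R | l <- enum 'I_r, t <- iota 0 (npoles l)].
Definition zeros alpha beta : seq C :=
  [seq beta 0 l + kC - 1 - t%:R | l <- enum 'I_r, t <- iota 0 (pos_part (m 0 l + k))]
  ++ [seq alpha 0 l + kC + t.+1%:R | l <- enum 'I_r, t <- iota 0 (nzeros l)].

Lemma big_allpairs_iota (T : Type) (idx : T) (op : Monoid.com_law idx)
    (f : 'I_r -> nat -> C) (N : 'I_r -> nat) (P : pred C) (g : C -> T) :
  \big[op/idx]_(a <- [seq f l t | l <- enum 'I_r, t <- iota 0 (N l)] | P a) g a
  = \big[op/idx]_l \big[op/idx]_(t < N l | P (f l t)) g (f l t).
Proof.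
rewrite big_mkcond big_allpairs_dep big_enum /=; apply: eq_bigr => l _.
by rewrite [RHS]big_mkcond -{1}[N l]subn0 -/(index_iota 0 (N l)) big_mkord.
Qed.


Lemma prod_sub_fact N j : (j <= N)%N ->
  \prod_(t < N.+1 | t != j :> nat) (t%:R - j%:R) = (- 1) ^+ j * (j`!%:R * (N - j)`!%:R) :> C.
Proof.
move=> jN; rewrite -(subnKC jN) addKn; elim: (N - j)%N => {N jN} [|d IH].
  rewrite addn0 mulr1 big_mkcond big_ord_recr /= eqxx mulr1.
  rewrite (eq_bigr (fun t : 'I_j => t%:R - j%:R)) => [|t _]; last first.
    by rewrite ltn_eqF.
  rewrite (reindex_inj rev_ord_inj) /=.
  rewrite (eq_bigr (fun t : 'I_j => - 1 * t.+1%:R)) => [|t _]; last first.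
    by rewrite natrB //; ring.
  rewrite big_split /= prodr_const card_ord; congr (_ * _).
  by elim: j => [|j IH]; [rewrite big_ord0|rewrite big_ord_recr /= IH factS natrM mulrC].
rewrite addnS big_mkcond big_ord_recr /= -big_mkcond IH factS natrM.
rewrite ifT; last by rewrite gtn_eqF // ltnS leq_addr.
rewrite -natrB; last by rewrite -addnS leq_addr.
by rewrite -addnS addKn; ring.
Qed.

Lemma pos_part_nat (s : int) : 0 <= s -> s = (pos_part s)%:Z.
Proof. by case: s. Qed.

Lemma rpoch_inv (x : C) (s : int) :
  (rpoch x s)^-1 = (\prod_(t < neg_part s) (x - t.+1%:R)) / \prod_(t < pos_part s) (x + t%:R).
Proof. by rewrite /rpoch invf_div. Qed.

Definition generic alpha : Prop :=
  forall i l, i != l -> nonint (alpha 0 i - alpha 0 l).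

Lemma uniq_poles alpha : generic alpha -> uniq (poles alpha).
Proof.
move=> ga; apply: allpairs_uniq_dep; first exact: enum_uniq.
  by move=> l _; exact: iota_uniq.
move=> [l t] [l' t'] _ _ /= e.
have ll' : l = l'.
  apply: contrapT => /eqP /ga /(_ (t%:Z - t'%:Z)) /eqP; apply.
  rewrite rmorphB /= -!pmulrn; apply/eqP; rewrite -subr_eq0.
  by move/eqP: e; rewrite -subr_eq0; congr (_ == _); ring.
subst l'; congr existT; apply/eqP; rewrite -(eqr_nat C).
by move/eqP: e; rewrite (inj_eq (addrI _)) eqr_opp.
Qed.

Lemma residue_res alpha beta : generic alpha ->
  residue (poles alpha) (zeros alpha beta) 0
  = \sum_i \sum_(j < nterms (k + n 0 i)) res alpha i beta j.
Proof.
move=> ga; rewrite /residue big_allpairs_iota; apply: eq_bigr => i _.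
rewrite nterms_pos_part [k + _]addrC.
apply: eq_bigr => j _; rewrite expr0 mul1r big_cat !big_allpairs_iota /=.
set a := alpha 0 i + kC - j%:R.
have -> : \prod_l \prod_(t < pos_part (m 0 l + k)) (a - (beta 0 l + kC - 1 - t%:R))
    = \prod_l rpoch (1 - beta 0 l + alpha 0 i - j%:R) (m 0 l + k).
  apply: eq_bigr => l _; rewrite /rpoch.
  have -> : neg_part (m 0 l + k) = 0%N by case: (m 0 l + k) (mk l).
  by rewrite big_ord0 divr1; apply: eq_bigr => t _; rewrite /a; ring.
rewrite /res -!mulrA; congr (_ * _); rewrite -prodf_div -prodfV (bigD1 i) //= mulrC.
congr (_ * _).
  apply: eq_bigr => l li; rewrite rpoch_inv; congr (_ / _).
    by apply: eq_bigr => t _; rewrite /a; ring.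
  have nt (t : nat) : alpha 0 l + kC - t%:R != a.
    rewrite -subr_eq0 /a.
    have := ga _ _ li (t%:Z - j%:Z); rewrite -subr_eq0; apply: contra_neq => e.
    by rewrite rmorphB /= -!pmulrn -[RHS]e; ring.
  apply: eq_big => t; first by rewrite nt.
  by rewrite /a; move=> _; ring.
rewrite nterms_pos_part [k + _]addrC.
move: (nat_of_ord j) (ltn_ord j) @a => {}j; case: (n 0 i + k + 1) => [[|N]|N] //=.
rewrite ltnS => jN; rewrite big_ord0 div1r.
rewrite (eq_bigl (fun t : 'I_N.+1 => t != j :> nat)) => [|t]; last first.
  by rewrite (inj_eq (addrI _)) eqr_opp eqr_nat.
rewrite (eq_bigr (fun t : 'I_N.+1 => t%:R - j%:R)) => [|t _]; last by ring.
by rewrite prod_sub_fact // invfM -exprVn invrN1.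
Qed.

(** Each family of roots is the negative of an increasing arithmetic progression, which explains the
    sign; [sum_arith_bernoulli_int] sums it, the zeros from negative n_l + k + 1 being included with
    the opposite sign. *)
Lemma psum_poles_zeros alpha beta j :
  psum (poles alpha) j - psum (zeros alpha beta) j
  = (- 1) ^+ j.+1 / j.+1%:R * Q_ n m alpha beta j kC.
Proof.
rewrite /psum big_cat !big_allpairs_iota /= opprD addrA addrAC -!sumrB.
rewrite /Q_ mulr_sumr; apply: eq_bigr => l _.
have N1 (x y : C) : x = - y -> x ^+ j = (- 1) ^+ j * y ^+ j.
  by move=> ->; exact: exprNn.
have S1 (s : int) (x : C) :
    \sum_(t < pos_part s) (- x - t%:R) ^+ j - \sum_(t < neg_part s) (- x + t.+1%:R) ^+ j
    = (- 1) ^+ j * ((bernoulli_poly j.+1 (x + s%:~R) - bernoulli_poly j.+1 x) / j.+1%:R).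
  rewrite -sum_arith_bernoulli_int mulrBr !mulr_sumr; congr (_ - _).
    by apply: eq_bigr => t _; apply: N1; ring.
  by apply: eq_bigr => t _; apply: N1; ring.
have E1 := S1 (n 0 l + k + 1) (- (alpha 0 l + kC)).
have E2 := S1 (m 0 l + k) (- (beta 0 l + kC - 1)).
rewrite !opprK in E1 E2.
have neg0 : neg_part (m 0 l + k) = 0%N by case: (m 0 l + k) (mk l).
rewrite neg0 big_ord0 subr0 in E2.
rewrite E1 E2 !rmorphD /=.
have -> : - (alpha 0 l + kC) = - alpha 0 l - kC by ring.
have -> : - alpha 0 l - kC + ((n 0 l)%:~R + kC + 1) = 1 - alpha 0 l + (n 0 l)%:~R by ring.
have -> : - (beta 0 l + kC - 1) = 1 - beta 0 l - kC by ring.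
have -> : 1 - beta 0 l - kC + ((m 0 l)%:~R + kC) = 1 - beta 0 l + (m 0 l)%:~R by ring.
move: (bernoulli_poly _ _) => b1; move: (bernoulli_poly _ _) => b2.
move: (bernoulli_poly _ _) => b3; move: (bernoulli_poly _ _) => b4.
by rewrite exprS; move: (_ ^+ j) (_^-1) => s t; ring.
Qed.

Lemma q_seqE alpha beta y d :
  q_seq n m alpha beta y d
  = newton_seq (fun j => (- 1) ^+ j.+1 / j.+1%:R * Q_ n m alpha beta j y) d.
Proof. by elim: d => //= d ->. Qed.

Lemma size_allpairs_iota (f : 'I_r -> nat -> C) (N : 'I_r -> nat) :
  size [seq f l t | l <- enum 'I_r, t <- iota 0 (N l)] = (\sum_l N l)%N.
Proof.
rewrite size_allpairs_dep sumnE big_map big_enum /=.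
by apply: eq_bigr => l _; rewrite size_iota.
Qed.

(** Zeros plus one minus poles is M - N - r + 1: splitting into positive and negative parts
    preserves differences, and the multiples of k cancel. If this number is negative the sum of
    residues is 0, in agreement with q_(-1) = 0. *)
Lemma sum_res alpha beta : generic alpha ->
  \sum_i \sum_(j < nterms (k + n 0 i)) res alpha i beta j
  = q_poly n m alpha beta (deg_e n m) kC.
Proof.
move=> ga; rewrite -residue_res //.
have hP := newton_seqP (fun j => (- 1) ^+ j.+1 / j.+1%:R * Q_ n m alpha beta j kC).
have {}hP := @eq_newton _ _ (fun j => psum (poles alpha) j - psum (zeros alpha beta) j)
  _ (fun j => esym (psum_poles_zeros alpha beta j.+1)) hP.
rewrite (residue_newton 0 (uniq_poles ga) hP) add0n.
rewrite /poles /zeros size_cat !size_allpairs_iota.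
have sumZ (N : 'I_r -> nat) : (\sum_l N l)%N%:Z = \sum_l (N l)%:Z.
  exact: (big_morph Posz PoszD (erefl _)).
set a := (\sum_l npoles l)%N.
set b := (\sum_l pos_part (m 0 l + k)%R)%N.
set c := (\sum_l nzeros l)%N.
have Eac : (\sum_l n 0 l) + k * r%:Z + r%:Z = a%:Z - c%:Z.
  rewrite /a /c !sumZ -sumrB.
  rewrite -(eq_bigr _ (fun l _ => pos_neg_part (n 0 l + k + 1))).
  by rewrite !big_split /= !sumr_const card_ord -[k *+ r]mulr_natr natz.
have Eb : (\sum_l m 0 l) + k * r%:Z = b%:Z.
  rewrite /b sumZ -(eq_bigr _ (fun l _ => pos_part_nat (mk l))).
  by rewrite big_split /= sumr_const card_ord -[k *+ r]mulr_natr natz.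
have Ed : deg_e n m = Num.max (- 1) ((b + c).+1%:Z - a%:Z).
  rewrite /deg_e; congr (Num.max _ _); lia.
rewrite Ed; case: leqP => le.
  have -> : Num.max (- 1) ((b + c).+1%:Z - a%:Z) = ((b + c).+1 - a)%N%:Z by lia.
  by rewrite /q_poly q_seqE.
by have -> : Num.max (- 1) ((b + c).+1%:Z - a%:Z) = Negz 0 by lia.
Qed.

End Residues.

(** * Shifted arguments *)

#[local] Arguments poch : simpl never.

Section GammaShifts.
Local Open Scope classical_set_scope.
Context {R : realType}.
Local Notation C := (Cplx R).
Implicit Types (x y : C) (j : nat) (s : int).

Lemma poch_nat x j : poch x j = \prod_(l < j) (x + l%:R).
Proof. by []. Qed.

Lemma rpoch_nat x j : rpoch x j = poch x j.
Proof. by rewrite /rpoch big_ord0 divr1. Qed.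

Lemma pochD x i j : poch x (i + j)%N = poch x i * poch (x + i%:R) j.
Proof.
rewrite !poch_nat big_split_ord /=; congr (_ * _).
by apply: eq_bigr => l _; rewrite natrD addrA.
Qed.

Lemma poch_reflect x j : poch (x - j%:R) j = (- 1) ^+ j * poch (1 - x) j.
Proof.
rewrite !poch_nat (reindex_inj rev_ord_inj) /=.
have -> : (- 1) ^+ j = \prod_(l < j) (- 1 : C) by rewrite prodr_const card_ord.
rewrite -big_split /=; apply: eq_bigr => l _.
by rewrite natrB // -natr1; ring.
Qed.

(** Split (x - j)_(j+M) after j and after M factors, and reflect the two blocks of length j. Stated
    without division, so that it also holds where some of the symbols vanish. *)
Lemma poch_subn x (M j : nat) :
  poch (x - j%:R) M * poch (1 - x - M%:R) j = poch x M * poch (1 - x) j.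
Proof.
have H : poch (x - j%:R) j * poch x M = poch (x - j%:R) M * poch (x + M%:R - j%:R) j.
  have := pochD (x - j%:R) j M; rewrite subrK => <-.
  by rewrite [_ + M%:R - _]addrAC -pochD addnC.
apply: (@mulfI _ ((- 1) ^+ j)); first by rewrite signr_eq0.
rewrite [in RHS]mulrCA -poch_reflect mulrC -[RHS]mulrC H mulrC poch_reflect.
by rewrite opprD addrA; ring.
Qed.

Lemma poch_negn N j : (j <= N)%N ->
  poch (- N%:R : C) j = (- 1) ^+ j * N`!%:R / (N - j)`!%:R.
Proof.
elim: j => [|j IH] jN; first by rewrite poch_nat big_ord0 subn0 expr0 mul1r mulfV ?pnatr_eq0 -?lt0n ?fact_gt0.
rewrite poch_nat big_ord_recr /= -poch_nat IH ?(ltnW jN) //.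
have -> : (N - j = (N - j.+1).+1)%N by lia.
rewrite factS natrM; have -> : - N%:R + j%:R = - (N - j.+1).+1%:R :> C.
  by rewrite -subSn // subSS natrB 1?ltnW // opprB addrC.
have f0 : (N - j.+1)`!%:R != 0 :> C by rewrite pnatr_eq0 -lt0n fact_gt0.
have n0 : (N - j.+1).+1%:R != 0 :> C by rewrite pnatr_eq0.
rewrite exprS; move: ((N - j.+1).+1%:R : C) n0 => a a0; move: ((- 1) ^+ j : C) => e.
by field; apply/andP.
Qed.

Lemma poch_negn_eq0 N j : (N < j)%N -> poch (- N%:R : C) j = 0.
Proof.
move=> Nj; rewrite poch_nat (bigD1 (Ordinal Nj)) //= addrC subrr mul0r //.
Qed.

Lemma Gamma_addn x j : ~ Gamma_pole x ->
  [/\ ~ Gamma_pole (x + j%:R), poch x j != 0, Gamma (x + j%:R) = poch x j * Gamma x &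
      digamma (x + j%:R) = digamma x + digamma_incr x j].
Proof.
move=> nx; elim: j => [|j [n1 n2 n3 n4]].
  by rewrite addr0 poch_nat /digamma_incr !big_ord0 mul1r addr0 oner_eq0.
rewrite poch_nat /digamma_incr !big_ord_recr /= -natr1 addrA.
split; first exact: nonpole_succ.
- by rewrite mulf_neq0 // nonpole_neq0.
- by rewrite GammaS // n3 mulrCA mulrA.
- by rewrite digammaS // n4 -addrA.
Qed.

(** The condition (1 - x)_j != 0 excludes x = 1, ..., j, the values for which the shift by -j would
    run into a pole. *)
Lemma Gamma_subn x j : ~ Gamma_pole x -> poch (1 - x) j != 0 ->
  [/\ ~ Gamma_pole (x - j%:R), Gamma x = (- 1) ^+ j * poch (1 - x) j * Gamma (x - j%:R) &
      digamma (x - j%:R) = digamma x + digamma_incr (1 - x) j].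
Proof.
move=> nx px.
have nxj : ~ Gamma_pole (x - j%:R).
  move=> [i e]; have ex : x = j%:R - i%:R by rewrite -e addrC subrK.
  have [ji|ij] := leqP j i.
    by apply: nx; exists (i - j)%N; rewrite ex natrB // opprB.
  have lt : (j - i.+1 < j)%N by lia.
  case/negP: px; rewrite poch_nat (bigD1 (Ordinal lt)) //= ex natrB // -natr1.
  by rewrite (_ : 1 - _ + _ = 0) ?mul0r //; ring.
have [_ _ G D] := Gamma_addn j nxj; rewrite subrK in G D.
split=> //; first by rewrite G poch_reflect.
(* The increments from x - j and from 1 - x run over opposite denominators in reverse order. *)
rewrite D -addrA [_ + digamma_incr _ _](_ : _ = 0) ?addr0 //.
rewrite /digamma_incr (reindex_inj rev_ord_inj) -big_split big1 //= => l _.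
rewrite natrB // -natr1.
have -> : x - j%:R + (j%:R - (l%:R + 1)) = - (1 - x + l%:R) by ring.
by rewrite invrN addNr.
Qed.

Lemma rpoch_neg (x : C) d : rpoch x (Negz d) = (poch (x - d.+1%:R) d.+1)^-1.
Proof.
rewrite /rpoch big_ord0 div1r poch_nat (reindex_inj rev_ord_inj); congr (_^-1).
apply: eq_bigr => l _ /=; have ld : (l < d.+1)%N := ltn_ord l.
rewrite (_ : (d.+1 - l.+1).+1 = (d.+1 - l)%N); last by lia.
by rewrite natrB 1?ltnW //; ring.
Qed.

Lemma Gamma_rpoch x s : ~ Gamma_pole x -> ~ Gamma_pole (x + s%:~R) ->
  rpoch x s != 0 /\ Gamma (x + s%:~R) = Gamma x * rpoch x s.
Proof.
case: s => d nx nxs.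
  by have [_ p0 -> _] := Gamma_addn d nx; rewrite rpoch_nat mulrC.
have := nxs; rewrite NegzE rmorphN /= => ny.
have [_ p0 G _] := Gamma_addn d.+1 ny; rewrite subrK in G.
by rewrite -NegzE rpoch_neg invr_eq0 p0 G mulrC mulrA mulVf ?mul1r.
Qed.

Lemma nonint_nonpole x : nonint x -> ~ Gamma_pole x.
Proof. by move=> nx [j e]; have := nx (- j%:Z); rewrite e rmorphN /= eqxx. Qed.

Lemma poch_rpoch x s : nonint x -> poch x s = rpoch x s.
Proof.
case: s => d nx; first by rewrite rpoch_nat.
have [||r0 e] := @Gamma_rpoch x (Negz d); [|apply: nonint_nonpole; exact: nonint_shift|].
  exact: nonint_nonpole.
by rewrite /poch e mulrC mulKf // Gamma_neq0 //; exact: nonint_nonpole.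
Qed.

Lemma poch_neq0 x j : nonint x -> poch x j != 0.
Proof. by move=> nx; rewrite -rpoch_nat rpoch_neq0. Qed.

(** Counterpart of [poch_subn] for a length s of either sign; for non-integral y both sides are
    Gamma quotients. *)
Lemma rpoch_subn y s j : nonint y ->
  rpoch (y - j%:R) s * poch (1 - y - s%:~R) j = rpoch y s * poch (1 - y) j.
Proof.
move=> ny.
have nyj : nonint (y - j%:R) by have := nonint_shift (- j%:Z) ny; rewrite rmorphN.
have nys := nonint_shift s ny.
have n1 t : nonint t -> nonint (1 - t :> C).
  by move=> nt; rewrite addrC; have := nonint_shift 1 (nonintN nt).
have [_ G1] : rpoch y s != 0 /\ _ := Gamma_rpoch (nonint_nonpole ny) (nonint_nonpole nys).
have nyjs := nonint_shift s nyj.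
have [_ G2] := Gamma_rpoch (nonint_nonpole nyj) (nonint_nonpole nyjs).
have [_ G3 _] := Gamma_subn (nonint_nonpole ny) (poch_neq0 j (n1 _ ny)).
have [_ G4 _] := Gamma_subn (nonint_nonpole nys) (poch_neq0 j (n1 _ nys)).
rewrite [y + _ - _]addrAC in G4.
have g0 := Gamma_neq0 (nonint_nonpole nyj).
apply: (mulfI g0); rewrite mulrA -G2.
apply: (@mulfI _ ((- 1) ^+ j)); first by rewrite signr_eq0.
rewrite -[1 - y - _]addrA -opprD.
transitivity (Gamma (y + s%:~R)); first by rewrite G4; ring.
by rewrite G1 G3; ring.
Qed.

End GammaShifts.

(** * The terms with i >= 3 as sums of residues *)

Section TermI.
Local Open Scope classical_set_scope.
Context {R : realType} {r : nat}.
Local Notation C := (Cplx R).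
Variables (n m : 'rV[int]_r) (k : int).
Hypothesis mk : forall l, 0 <= m 0 l + k.
Implicit Types (alpha beta : 'rV[C]_r) (i l : 'I_r) (j : nat).

Lemma prod_map_enum (f G : _ -> C) :
  \prod_(x <- [seq f l | l <- enum 'I_r]) G x = \prod_l G (f l).
Proof. by rewrite big_map big_enum. Qed.

Lemma prod_map_filter_enum (P : pred 'I_r) (f G : _ -> C) :
  \prod_(x <- [seq f l | l <- [seq l <- enum 'I_r | P l]]) G x = \prod_(l | P l) G (f l).
Proof. by rewrite big_map (big_filter _ P) big_enum_cond. Qed.

Lemma hypergeometric_finite (a b : seq C) N :
  (forall j, (N < j)%N -> hyp_term a b j = 0) ->
  hypergeometric a b 1 = \sum_(j < N.+1) hyp_term a b j.
Proof.
move=> ab0; have hC : hausdorff_space C by exact: norm_hausdorff.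
apply: (cvg_lim hC); apply: cvg_near_cst; exists N.+1 => // M /= NM.
rewrite (big_cat_nat _ NM) //= big_mkord [X in _ + X]big1_seq ?addr0.
  by apply: eq_bigr => j _; rewrite expr1n mulr1.
by move=> j; rewrite mem_index_iota => /andP[_ /andP[Nj _]]; rewrite ab0 ?mul0r.
Qed.

(** Moving alpha_i to alpha_i - j multiplies each Pochhammer symbol of the prefactor by a quotient
    of j-th symbols ([poch_subn], [rpoch_subn]), and (-N)_j supplies the factorials of the
    residue. *)
Lemma term_i_res alpha i beta :
  (forall l, l != i -> nonint (alpha 0 i - alpha 0 l)) ->
  term_i_regular n m alpha k i beta ->
  term_i n m alpha k i beta = \sum_(j < nterms (k + n 0 i)) res n m k alpha i beta j.
Proof.
move=> nai reg; rewrite /term_i.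
(* For k + n_i < 0, [factz] is 0 and its inverse is 0 as well, so the term vanishes like the empty
   sum of residues. *)
case E : (k + n 0 i) => [N|N]; last by rewrite /= mulr0 invr0 mulr0 mul0r big_ord0.
rewrite /= (@hypergeometric_finite _ _ N); last first.
  move=> j Nj; rewrite /hyp_term /term_upper big_cons.
  have -> : (- k - n 0 i)%:~R = - N%:R :> C by rewrite -opprD E rmorphN.
  by rewrite poch_negn_eq0 // !mul0r.
rewrite mulr_sumr; apply: eq_bigr => j _.
have jN : (j <= N)%N by rewrite -ltnS.
have regj c : c \in term_lower m alpha k i beta -> poch c j != 0.
  by move=> cl; apply: reg => //; rewrite E.
rewrite /hyp_term /term_upper /term_lower big_cons !big_cat.
rewrite !prod_map_enum !prod_map_filter_enum.
have -> : (- k - n 0 i)%:~R = - N%:R :> C by rewrite -opprD E rmorphN.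
rewrite poch_negn // /res E /=.
have E1 l : rpoch (1 - beta 0 l + alpha 0 i - j%:R) (m 0 l + k)
  = poch (1 - beta 0 l + alpha 0 i) (m 0 l + k) * poch (beta 0 l - alpha 0 i) j
     / poch (beta 0 l - alpha 0 i - (m 0 l)%:~R - k%:~R) j.
  have p0 : poch (beta 0 l - alpha 0 i - (m 0 l)%:~R - k%:~R) j != 0.
    apply: regj; rewrite mem_cat; apply/orP; left; apply/mapP.
    by exists l; rewrite ?mem_enum.
  apply: (mulIf p0); rewrite divfK //.
  case mkE : (m 0 l + k) (mk l) => [M|//] _.
  rewrite rpoch_nat; have := poch_subn (1 - beta 0 l + alpha 0 i) M j.
  have -> : 1 - (1 - beta 0 l + alpha 0 i) = beta 0 l - alpha 0 i by ring.
  by rewrite -[_ - _ - (m 0 l)%:~R - _]addrA -opprD -rmorphD /= mkE.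
have E2 l : l != i -> (rpoch (alpha 0 i - alpha 0 l - j%:R) (n 0 l + k + 1))^-1
  = (poch (alpha 0 i - alpha 0 l) (n 0 l + k + 1))^-1
     * (poch (alpha 0 l - alpha 0 i - (n 0 l)%:~R - k%:~R) j / poch (1 + alpha 0 l - alpha 0 i) j).
  move=> li; have nl := nai _ li; rewrite (poch_rpoch _ nl).
  have H := rpoch_subn (n 0 l + k + 1) j nl.
  have nlj : nonint (alpha 0 i - alpha 0 l - j%:R).
    by have := nonint_shift (- j%:Z) nl; rewrite rmorphN.
  have r1 := rpoch_neq0 (n 0 l + k + 1) nlj; have r2 := rpoch_neq0 (n 0 l + k + 1) nl.
  have p1 : poch (1 + alpha 0 l - alpha 0 i) j != 0.
    apply: regj; rewrite mem_cat; apply/orP; right; apply/mapP.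
    by exists l => //; rewrite mem_filter li mem_enum.
  have e1 : 1 - (alpha 0 i - alpha 0 l) = 1 + alpha 0 l - alpha 0 i by ring.
  have e2 : 1 - (alpha 0 i - alpha 0 l) - (n 0 l + k + 1)%:~R
    = alpha 0 l - alpha 0 i - (n 0 l)%:~R - k%:~R by rewrite !rmorphD /=; ring.
  rewrite e2 e1 in H.
  apply: (mulfI r1); apply: (mulfI r2); apply: (mulIf p1).
  rewrite (mulfV r1) mulr1 -H.
  move: (rpoch _ _) (rpoch _ _) (poch _ _) (poch _ _) r1 r2 p1 => a b c d a0 b0 d0.
  by field; apply/andP.
rewrite -prodfV (eq_bigr _ (fun l _ => E1 l)) (eq_bigr _ E2) !big_split /= !prodfV.
have f0 : N`!%:R != 0 :> C by rewrite pnatr_eq0 -lt0n fact_gt0.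
rewrite !invfM.
move: (\prod_l poch _ _) (\prod_l poch _ _) ((\prod_l poch _ _)^-1) => P1 P2 P3.
set Q1 := (\prod_(l | _) poch (alpha 0 i - alpha 0 l) _)^-1.
set Q2 := (\prod_(l | _) poch (1 + alpha 0 l - alpha 0 i) j)^-1.
set Q3 := \prod_(l | _) poch _ j.
move: Q1 Q2 Q3 ((j`!)%:R^-1 : C) (((N - j)`!)%:R^-1 : C) => Q1 Q2 Q3 d1 d2.
by field.
Qed.

End TermI.

(** * Derivatives at eps = 0 *)

Section EpsDerivative.
Local Open Scope classical_set_scope.
Context {R : realType} {r : nat}.
Local Notation C := (Cplx R).
Local Notation X := (C * 'rV[C]_r)%type.
Variables (beta0 : 'rV[C]_r) (D : set X).
Implicit Types (f g h b L : X -> C) (c : C).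
Local Notation x0 := ((0 : C), beta0).

(* The derivative of f in the first variable is only needed at the base point
   x0, but the formula g for it holds on D, which need not contain x0; f'
   carries the value from D to x0 by continuity. *)
Definition eder f g : Prop := exists f' : X -> C,
  [/\ f @ x0 --> f x0, f' @ x0 --> f' x0,
      is_derive (0 : C) 1 (fun e => f (e, beta0)) (f' x0) &
      \forall x \near x0, D x -> f' x = g x].

Lemma nearX (P : X -> Prop) : (forall x, P x) -> \forall x \near x0, P x.
Proof. by move=> PX; apply: (@filterS _ (nbhs x0) _ setT P) (fun x _ => PX x) filterT. Qed.

Lemma eder_near f g g' : eder f g -> (\forall x \near x0, D x -> g x = g' x) -> eder f g'.
Proof.
move=> [f' [h1 h2 h3 h4]] gg'; exists f'; split=> //.
by apply: filterS2 h4 gg' => x fg gg Dx; rewrite fg // gg.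
Qed.

Lemma eder_cst c : eder (fun=> c) (fun=> 0).
Proof.
exists (fun=> 0); split; [exact: cvg_cst|exact: cvg_cst|exact: is_derive_cst|].
by apply: nearX.
Qed.

Lemma ederD f g f2 g2 : eder f g -> eder f2 g2 ->
  eder (fun x => f x + f2 x) (fun x => g x + g2 x).
Proof.
move=> [f' [h1 h2 h3 h4]] [k' [k1 k2 k3 k4]]; exists (fun x => f' x + k' x); split.
- exact: (cvgD h1 k1).
- exact: (cvgD h2 k2).
- exact: (is_deriveD h3 k3).
- by apply: filterS2 h4 k4 => x e1 e2 Dx; rewrite e1 // e2.
Qed.

Lemma ederM f g f2 g2 : eder f g -> eder f2 g2 ->
  eder (fun x => f x * f2 x) (fun x => f x * g2 x + f2 x * g x).
Proof.
move=> [f' [h1 h2 h3 h4]] [k' [k1 k2 k3 k4]].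
exists (fun x => f x * k' x + f2 x * f' x); split.
- exact: (cvgM h1 k1).
- exact: (cvgD (cvgM h1 k2) (cvgM k1 h2)).
- exact: (is_deriveM h3 k3).
- by apply: filterS2 h4 k4 => x e1 e2 Dx; rewrite e1 // e2.
Qed.

(** Derivatives are carried in the shape f times L, so that logarithmic derivatives add along
    products without f having to be nonzero. *)
Lemma eder_logM f L f2 L2 :
  eder f (fun x => f x * L x) -> eder f2 (fun x => f2 x * L2 x) ->
  eder (fun x => f x * f2 x) (fun x => f x * f2 x * (L x + L2 x)).
Proof.
move=> h1 h2; apply: eder_near (ederM h1 h2) _.
by apply: nearX => x _; ring.
Qed.

Lemma eder_logV f L : f x0 != 0 ->
  eder f (fun x => f x * L x) -> eder (fun x => (f x)^-1) (fun x => (f x)^-1 * - L x).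
Proof.
move=> f0 [f' [h1 h2 h3 h4]]; exists (fun x => - ((f x)^-1 * (f x)^-1 * f' x)); split.
- exact: (cvgV f0 h1).
- exact: (cvgN (cvgM (cvgM (cvgV f0 h1) (cvgV f0 h1)) h2)).
- have [d3 e3] := h3.
  split; first exact: derivableV.
  rewrite deriveV // e3 -exprVn expr2 scaleNr.
  by [].
- have fn0 : \forall x \near x0, f x != 0 by apply: cvgr_neq0 h1 f0.
  apply: filterS2 h4 fn0 => x e1 fx Dx; rewrite e1 //.
  by field.
Qed.

Lemma eder_sum (I : Type) (s : seq I) (P : pred I) (f g : I -> X -> C) :
  (forall i, P i -> eder (f i) (g i)) ->
  eder (fun x => \sum_(i <- s | P i) f i x) (fun x => \sum_(i <- s | P i) g i x).
Proof.
move=> fg; elim: s => [|i s IH].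
  rewrite (_ : (fun x => _) = fun=> 0); last by apply/funext => x; rewrite big_nil.
  rewrite (_ : (fun x => \sum_(i <- _ | _) g i x) = fun=> 0); first exact: eder_cst.
  by apply/funext => x; rewrite big_nil.
case Pi : (P i); last first.
  rewrite (_ : (fun x => _) = (fun x => \sum_(i <- s | P i) f i x)); last first.
    by apply/funext => x; rewrite big_cons Pi.
  apply: eder_near IH _; apply: nearX => x _; by rewrite big_cons Pi.
rewrite (_ : (fun x => _) = (fun x => f i x + \sum_(i <- s | P i) f i x)); last first.
  by apply/funext => x; rewrite big_cons Pi.
apply: eder_near (ederD (fg _ Pi) IH) _.
by apply: nearX => x _; rewrite big_cons Pi.
Qed.

Lemma eder_log_prod (I : Type) (s : seq I) (P : pred I) (f L : I -> X -> C) :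
  (forall i, P i -> eder (f i) (fun x => f i x * L i x)) ->
  eder (fun x => \prod_(i <- s | P i) f i x)
    (fun x => (\prod_(i <- s | P i) f i x) * \sum_(i <- s | P i) L i x).
Proof.
move=> fg; elim: s => [|i s IH].
  rewrite (_ : (fun x => \prod_(i <- _ | _) f i x) = fun=> 1); last first.
    by apply/funext => x; rewrite big_nil.
  apply: eder_near (eder_cst 1) _.
  by apply: nearX => x _; rewrite !big_nil mulr0.
case Pi : (P i); last first.
  rewrite (_ : (fun x => \prod_(i <- _ | _) f i x) = (fun x => \prod_(i <- s | P i) f i x)); last first.
    by apply/funext => x; rewrite big_cons Pi.
  by apply: eder_near IH _; apply: nearX => x _; rewrite !big_cons Pi.
rewrite (_ : (fun x => \prod_(i <- _ | _) f i x) = (fun x => f i x * \prod_(i <- s | P i) f i x)); last first.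
  by apply/funext => x; rewrite big_cons Pi.
apply: eder_near (eder_logM (fg _ Pi) IH) _.
by apply: nearX => x _; rewrite !big_cons Pi.
Qed.

Definition has_slope b c : Prop :=
  b @ x0 --> b x0 /\ is_derive (0 : C) 1 (fun e => b (e, beta0)) c.

Lemma has_slopeD b c c' : has_slope b c -> has_slope (fun x => b x + c') c.
Proof.
move=> [h1 h2]; have h3 : (fun _ : X => c') @ x0 --> c' by apply: cvg_cst.
split; first by have h4 := cvgD h1 h3; exact: h4.
by have := is_deriveD h2 (is_derive_cst c' (0 : C) (1 : C)); rewrite addr0.
Qed.

(** The constant derivative c equals b (c / b) wherever b is nonzero. At the base point b may vanish
    and c / b be infinite, yet the product extends continuously by c: this resolves the products of
    type 0 times infinity. *)
Lemma eder_log_slope b c : has_slope b c ->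
  c = 0 \/ (\forall x \near x0, D x -> b x != 0) -> eder b (fun x => b x * (c / b x)).
Proof.
move=> [h1 h2] b0; have h3 : (fun _ : X => c) @ x0 --> c by apply: cvg_cst.
exists (fun=> c); split; [exact: h1|exact: h3|exact: h2|].
case: b0 => [->|b0]; first by apply: nearX => x _; rewrite mul0r mulr0.
by apply: filterS b0 => x bx Dx; rewrite mulrC divfK // bx.
Qed.

Lemma eder_poch b c (j : nat) : has_slope b c ->
  c = 0 \/ (\forall x \near x0, D x -> ~ Gamma_pole (b x)) ->
  eder (fun x => poch (b x) j) (fun x => poch (b x) j * (c * (digamma (b x + j%:R) - digamma (b x)))).
Proof.
move=> bc bD.
have H : eder (fun x => poch (b x) j)
    (fun x => poch (b x) j * \sum_(l < j) c / (b x + l%:R)).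
  apply: eder_log_prod => l _; apply: eder_log_slope; first exact: has_slopeD.
  case: bD => [->|bD]; [by left|right].
  apply: filterS bD => x nb Dx; apply: nonpole_neq0.
  by have [] := Gamma_addn l (nb Dx).
apply: eder_near H _; case: bD => [->|bD].
  by apply: nearX => x _; rewrite mul0r big1 // => l _; rewrite mul0r.
apply: filterS bD => x nb Dx.
have [_ _ _ ->] := Gamma_addn j (nb Dx).
by congr (_ * _); rewrite [_ + digamma_incr _ _]addrC addrK /digamma_incr mulr_sumr.
Qed.

Lemma eder_rpoch b c s : has_slope b c ->
  (forall l : 'I_(neg_part s), b x0 - l.+1%:R != 0) ->
  c = 0 \/ (\forall x \near x0, D x -> ~ Gamma_pole (b x) /\ ~ Gamma_pole (b x + s%:~R)) ->
  eder (fun x => rpoch (b x) s)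
    (fun x => rpoch (b x) s * (c * (digamma (b x + s%:~R) - digamma (b x)))).
Proof.
case: s => d bc bx0 bD.
  have {}bD : c = 0 \/ \forall x \near x0, D x -> ~ Gamma_pole (b x).
    by case: bD => [|bD]; [left|right; apply: filterS bD => x h /h[]].
  rewrite (_ : (fun x => rpoch (b x) d) = (fun x => poch (b x) d)); last first.
    by apply/funext => x; rewrite rpoch_nat.
  apply: eder_near (eder_poch d bc bD) _.
  by apply: nearX => x _; rewrite rpoch_nat.
rewrite (_ : (fun x => rpoch (b x) _) = (fun x => (poch (b x - d.+1%:R) d.+1)^-1)); last first.
  by apply/funext => x; rewrite rpoch_neg.
have bc' := has_slopeD (- d.+1%:R) bc.
have bsD' : c = 0 \/ \forall x \near x0, D x -> ~ Gamma_pole (b x - d.+1%:R).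
  case: bD => [|bD]; [by left|right; apply: filterS bD => x h /h[_]].
  by rewrite NegzE rmorphN.
apply: eder_near (eder_logV _ (eder_poch d.+1 bc' bsD')) _.
  rewrite poch_nat; apply/prodf_neq0 => l _.
  have := bx0 (rev_ord l); apply: contra_neq => e.
  have ld := ltn_ord l; rewrite /= (_ : (d.+1 - l.+1).+1 = (d.+1 - l)%N); last by lia.
  by rewrite natrB 1?ltnW // -[RHS]e; ring.
apply: nearX => x _; rewrite rpoch_neg subrK NegzE rmorphN /=; ring.
Qed.

(** The sign c is that of eta = eps or eta = - eps. The derivative at 0 comes from [Gamma_taylor] at
    z = 0, its continuity from [digamma_cvg1]. *)
Lemma eder_Gamma1 c : (c == 1) || (c == -1) ->
  eder (fun x => Gamma (1 + c * x.1))
    (fun x => Gamma (1 + c * x.1) * (c * digamma (1 + c * x.1))).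
Proof.
move=> c1; have cc : cabs c = 1 by case/orP: c1 => /eqP ->; rewrite ?cabsN cabs1.
have cx : (fun x : X => c * x.1) @ x0 --> (0 : C).
  rewrite -[X in _ --> X](mulr0 c); apply: cvgM; first exact: cvg_cst.
  exact: cvg_fst.
have np1 : ~ Gamma_pole (1 : C).
  by have := @nonpole1D R 0; rewrite addr0 cabs0; apply.
have G1 : (fun x : X => Gamma (1 + c * x.1)) @ x0 --> (Gamma 1 : C).
  have h : (fun x : X => 1 + c * x.1) @ x0 --> (1 : C).
    by rewrite -[X in _ --> X]addr0; apply: cvgD; [exact: cvg_cst|exact: cx].
  exact: (cvg_comp _ _ h (cvg_Gamma_at np1)).
have P1 : (fun x : X => digamma (1 + c * x.1)) @ x0 --> (digamma 1 : C).
  exact: (cvg_comp _ _ cx (@digamma_cvg1 R)).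
exists (fun x => Gamma (1 + c * x.1) * (c * digamma (1 + c * x.1))); split.
- rewrite /= mulr0 addr0; exact: G1.
- have h3 : (fun _ : X => c) @ x0 --> c by apply: cvg_cst.
  have h4 := cvgM G1 (cvgM h3 P1).
  rewrite /= mulr0 addr0; exact: h4.
- rewrite /= mulr0 addr0.
  have [B BB [K [d [d0 T]]]] := Gamma_taylor (@offpole0 R).
  have [B1 _] := Gamma1p_derive_digamma (@offpole0 R).
  have E := cvgC_unique BB B1; rewrite addr0 in E T; rewrite E in T.
  apply: (@is_deriveC_taylor _ _ _ _ K d d0) => h hd.
  rewrite add0r mulr0 addr0.
  have := T (c * h); rewrite cabsM cc mul1r => /(_ hd).
  by congr (cabs _ <= _); ring.
- by apply: nearX.
Qed.

(** The function u; classically sin(pi y) / (pi y), with value 1 at 0. *)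
Definition rgamma1 (y : C) : C := (Gamma (1 - y) * Gamma (1 + y))^-1.

Lemma eder_rgamma1 c : (c == 1) || (c == -1) ->
  eder (fun x => rgamma1 (c * x.1))
    (fun x => rgamma1 (c * x.1) * (c * (digamma (1 - c * x.1) - digamma (1 + c * x.1)))).
Proof.
move=> c1; have c1' : (- c == 1) || (- c == -1).
  by case/orP: c1 => /eqP ->; rewrite ?opprK eqxx ?orbT.
have H1 := eder_Gamma1 c1; have H2 := eder_Gamma1 c1'.
have H := eder_logV _ (eder_logM H2 H1); rewrite /= !mulr0 addr0 in H.
have {H} := H _; rewrite Gamma1 mulr1 oner_eq0 => /(_ isT) H.
have -> : (fun x : X => rgamma1 (c * x.1))
   = (fun x => (Gamma (1 + - c * x.1) * Gamma (1 + c * x.1))^-1).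
  by apply/funext => x; rewrite /rgamma1 mulNr.
apply: eder_near H _; apply: nearX => x _.
by rewrite /rgamma1 mulNr; congr (_ * _); ring.
Qed.

(** Converts a joint limit into a one-variable derivative: near the base point K agrees on D with
    the continuous f', and the value of f' at the base point is the derivative of f along beta =
    beta0. *)
Lemma eder_value f g (K : X -> C) : closure D x0 -> eder f g ->
  (\forall x \near x0, D x -> K x = g x) ->
  extends_to K D x0 /\ is_derive (0 : C) 1 (fun e => f (e, beta0)) (value_at K D x0).
Proof.
move=> clD [f' [h1 h2 h3 h4]] Kg.
have PF : ProperFilter (within D (nbhs x0)) by exact: within_nbhs_proper.
have Kc : K @ within D (nbhs x0) --> f' x0.
  apply: cvg_trans (cvg_within_filter D h2); apply: near_eq_cvg.
  by apply: filterS2 h4 Kg => x e1 e2 Dx; rewrite e1 // e2.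
split; first by split; [exact: clD|apply/cvg_ex; exists (f' x0); exact: Kc].
have hC : hausdorff_space C by exact: norm_hausdorff.
by rewrite /value_at (cvg_lim hC Kc).
Qed.

End EpsDerivative.

(** * Integer shifts in Gamma(1 - z) Gamma(z) and the confluent pair of Gamma factors *)

Section Reflection.
Local Open Scope classical_set_scope.
Context {R : realType}.
Local Notation C := (Cplx R).
Implicit Types (x y z eta : C) (j : nat) (s P nu : int).

Lemma nonint_one_sub z : nonint z -> nonint (1 - z).
Proof. by move=> nz; rewrite addrC; have := nonint_shift 1 (nonintN nz). Qed.

(** The part of the reflection formula that concerns periodicity; it is a consequence of the
    functional equation alone. *)
Lemma Gamma_reflect_shift z s : nonint z ->
  Gamma (1 - (z + s%:~R)) * Gamma (z + s%:~R) = (- 1) ^ s * (Gamma (1 - z) * Gamma z).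
Proof.
have Hn (j : nat) y : nonint y ->
    Gamma (1 - (y + j%:R)) * Gamma (y + j%:R) = (- 1) ^+ j * (Gamma (1 - y) * Gamma y).
  move=> ny; elim: j => [|j IH]; first by rewrite addr0 mul1r.
  have nj : nonint (y + j%:R) by exact: (nonint_shift j%:Z ny).
  have nj1 : nonint (1 - (y + j.+1%:R)) by apply: nonint_one_sub; exact: (nonint_shift j.+1%:Z ny).
  rewrite exprS -mulrA -IH.
  have -> : 1 - (y + j%:R) = 1 - (y + j.+1%:R) + 1 by rewrite -natr1; ring.
  rewrite GammaS; last exact: nonint_nonpole.
  have -> : y + j.+1%:R = y + j%:R + 1 by rewrite -natr1 addrA.
  rewrite GammaS; last exact: nonint_nonpole.
  by ring.
move=> nz; case: s => d; first exact: Hn.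
have := Hn d.+1 _ (nonint_shift (Negz d) nz).
have -> : z + (Negz d)%:~R + d.+1%:R = z.
  by rewrite NegzE rmorphN /= subrK.
move=> ->; rewrite -[(- 1) ^ (Negz d)]/((- 1) ^- d.+1).
by rewrite mulrA mulVf ?mul1r // signr_eq0.
Qed.

(* With y = P + eta this is 1 / (Gamma (1 - y + j) Gamma (y + nu + 1 - j)),
   written so that it stays regular as eta -> 0. *)
Definition rgamma_pair eta P nu j : C :=
  rgamma1 eta * (rpoch (1 - eta + (j%:Z - P)%:~R) (P - j%:Z)
               * rpoch (1 + eta + (P + nu - j%:Z)%:~R) (- (P + nu - j%:Z))).

Lemma rgamma_pairE eta P nu j :
  ~ Gamma_pole (1 - eta) -> ~ Gamma_pole (1 + eta) ->
  ~ Gamma_pole (1 - (P%:~R + eta) + j%:R) ->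
  ~ Gamma_pole (P%:~R + eta + nu%:~R + 1 - j%:R) ->
  rgamma_pair eta P nu j
  = (Gamma (1 - (P%:~R + eta) + j%:R) * Gamma (P%:~R + eta + nu%:~R + 1 - j%:R))^-1.
Proof.
move=> h1 h2 h3 h4; rewrite /rgamma_pair /rgamma1.
have e1 : 1 - eta + (j%:Z - P)%:~R = 1 - (P%:~R + eta) + j%:R.
  by rewrite rmorphB /=; ring.
have e2 : 1 + eta + (P + nu - j%:Z)%:~R = P%:~R + eta + nu%:~R + 1 - j%:R.
  by rewrite rmorphB rmorphD /=; ring.
have s1 : 1 - (P%:~R + eta) + j%:R + (P - j%:Z)%:~R = 1 - eta.
  by rewrite rmorphB /=; ring.
have s2 : P%:~R + eta + nu%:~R + 1 - j%:R + (- (P + nu - j%:Z))%:~R = 1 + eta.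
  by rewrite rmorphN rmorphB rmorphD /=; ring.
have [_ ] := @Gamma_rpoch _ _ (P - j%:Z) h3 (ltac:(by rewrite s1)).
have [_ ] := @Gamma_rpoch _ _ (- (P + nu - j%:Z)) h4 (ltac:(by rewrite s2)).
rewrite s1 s2 e1 e2 => G2 G1.
have g3 := Gamma_neq0 h3; have g4 := Gamma_neq0 h4.
have := Gamma_neq0 h1; have := Gamma_neq0 h2; rewrite G1 G2.
move: (Gamma _) (Gamma _) (rpoch _ _) (rpoch _ _) g3 g4 => a b c d a0 b0.
rewrite !mulf_eq0 !negb_or => /andP[_ d0] /andP[_ c0].
by field; apply/and4P.
Qed.

(** With w = P + eta - j, the pair is Gamma(1 - w) Gamma(w) times (w)_(nu+1). The first two factors
    reduce to Gamma(1 - eta) Gamma(eta) up to sign, and Gamma(1 + eta) = eta Gamma(eta) produces the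
    factor eta that compensates the collision of poles. *)
Lemma rgamma_pair_res eta P nu j : nonint eta ->
  rgamma_pair eta P nu j
  = (- 1) ^ P * (- 1) ^+ j * (eta * rgamma1 eta) / rpoch (P%:~R + eta - j%:R) (nu + 1).
Proof.
move=> ne; have nm := nonint_one_sub ne.
have np : nonint (1 + eta) by rewrite addrC; exact: (nonint_shift 1 ne).
set w := P%:~R + eta - j%:R.
have we : w = eta + (P - j%:Z)%:~R by rewrite /w rmorphB /=; ring.
have nw : nonint w by rewrite we; exact: nonint_shift.
have nw1 := nonint_one_sub nw; have nwn := nonint_shift (nu + 1) nw.
have e1 : 1 - (P%:~R + eta) + j%:R = 1 - w by rewrite /w; ring.
have e2 : P%:~R + eta + nu%:~R + 1 - j%:R = w + (nu + 1)%:~R by rewrite /w rmorphD /=; ring.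
rewrite rgamma_pairE; try (by apply: nonint_nonpole); rewrite ?e1 ?e2; try (by apply: nonint_nonpole).
have [r0 ->] := Gamma_rpoch (nonint_nonpole nw) (nonint_nonpole nwn).
have := Gamma_reflect_shift (P - j%:Z) ne; rewrite -we => E.
rewrite mulrA E /rgamma1 [1 + eta]addrC GammaS; last exact: nonint_nonpole.
have g1 := Gamma_neq0 (nonint_nonpole ne); have g2 := Gamma_neq0 (nonint_nonpole nm).
have eta0 : eta != 0 by exact: (ne 0).
have sg : ((- 1 : C) ^ (P - j%:Z))^-1 = (- 1) ^ P * (- 1) ^+ j.
  rewrite expfzDr ?oppr_eq0 ?oner_eq0 // invfM -exprnN invrK; congr (_ * _).
  case: P {w we nw nw1 nwn e1 e2 r0 E} => d; first by rewrite -exprnP invr_sign.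
  by rewrite -[(- 1) ^ (Negz d)]/((- 1) ^- d.+1) invrK invr_sign.
move: (rpoch w (nu + 1)) => a; rewrite !invfM sg; move: (a^-1) => {}a; set b := _ ^ P; set c := _ ^+ j; clearbody b c.
by field; rewrite g1 g2 eta0.
Qed.

End Reflection.

(** * The summands of comb and combh *)

Section Confluent.
Local Open Scope classical_set_scope.
Context {R : realType} {r : nat}.
Local Notation C := (Cplx R).
Local Notation X := (C * 'rV[C]_r)%type.
Variables (n m : 'rV[int]_r) (alpha : 'rV[C]_r) (k : int) (i1 i2 : 'I_r) (p : int).
Hypothesis mk : forall l, 0 <= m 0 l + k.
Implicit Types (a eta : C) (beta : 'rV[C]_r) (P nu : int) (N j : nat).

Local Notation rest := (rest i1 i2).

(* Common form of G_k H_j (a = alpha_1 + p + eps, eta = eps) and of the hatted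
   product (a = alpha_1, eta = - eps). *)
Definition Eterm a eta beta P nu N j : C :=
  (- 1) ^ P / (j`!%:R * (N - j)`!%:R)
  * ((\prod_l rpoch (1 - beta 0 l + a - j%:R) (m 0 l + k))
     * (\prod_(l | rest l) (rpoch (a - alpha 0 l - j%:R) (n 0 l + k + 1))^-1)
     * rgamma_pair eta P nu j).

(** Logarithmic derivative of [Eterm] in eps when a has slope a' and eta has slope c. The plain case
    has a' = c = 1; the hatted one has a' = 0 and c = -1, which is why the hatted Theta and Psi
    contain no terms in A or B. *)
Definition Elog a eta beta P nu (a' c : C) j : C :=
  (\sum_l a' * (digamma (1 - beta 0 l + a - j%:R + (m 0 l + k)%:~R)
               - digamma (1 - beta 0 l + a - j%:R)))
  + (\sum_(l | rest l) - (a' * (digamma (a - alpha 0 l - j%:R + (n 0 l + k + 1)%:~R)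
               - digamma (a - alpha 0 l - j%:R))))
  + c * (digamma (1 - (P%:~R + eta) + j%:R)
        - digamma (P%:~R + eta + nu%:~R + 1 - j%:R)).

Lemma has_slope_fst (beta0 : 'rV[C]_r) (c0 c : C) :
  has_slope beta0 (fun x => c0 + c * x.1) c.
Proof.
have h1 : (fun _ : X => c0) @ ((0 : C), beta0) --> c0 by apply: cvg_cst.
have h2 : (fun _ : X => c) @ ((0 : C), beta0) --> c by apply: cvg_cst.
have h3 : (fun x : X => x.1) @ ((0 : C), beta0) --> (0 : C) by exact: cvg_fst.
split; first by have h4 := cvgD h1 (cvgM h2 h3); exact: h4.
have d1 := is_derive_cst c0 (0 : C) (1 : C).
have d2 := is_derive_cst c (0 : C) (1 : C).
have d3 := @is_derive_id _ C (0 : C) (1 : C).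
have := is_deriveD d1 (is_deriveM d2 d3).
by rewrite scaler0 addr0 add0r [_ *: _]mulr1.
Qed.

(** At eta = 0 the denominators in the two rational factors of [rgamma_pair] are positive
    integers. *)
Lemma neg_part_shift_neq0 (s : int) (l : 'I_(neg_part s)) :
  1 + (- s)%:~R - l.+1%:R != 0 :> C.
Proof.
case: s l => [d []//|d l]; have : (l < d.+1)%N := ltn_ord l; move: (nat_of_ord l) => {}l ld.
rewrite NegzE opprK -pmulrn (_ : _ - _ = (d.+1 - l)%:R); last first.
  by rewrite natrB 1?ltnW //; ring.
by rewrite pnatr_eq0 -lt0n subn_gt0.
Qed.

Section EtermDerivative.
Variables (beta0 : 'rV[C]_r) (D : set X) (a : X -> C) (a' c : C) (P nu : int) (N j : nat).
Local Notation x0 := ((0 : C), beta0).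

Hypothesis c1 : (c == 1) || (c == -1).

Lemma near_nonpole1 (s : C) : cabs s = 1 ->
  \forall x \near x0, ~ Gamma_pole (1 + s * x.1).
Proof.
move=> s1; have h3 : (fun x : X => x.1) @ x0 --> (0 : C) by exact: cvg_fst.
have h4 : \forall x \near x0, cabs (x.1 - 0) < 1 by move/cvg_cabsP : h3; apply.
apply: filterS h4 => x; rewrite subr0 => x1.
by apply: nonpole1D; rewrite cabsM s1 mul1r.
Qed.

(** Differentiability at the base point comes from the regular form of [Eterm]; the conditions on D
    make the digamma formula for its derivative valid at regular points. *)
Lemma eder_Eterm : has_slope beta0 a a' ->
  (forall l, rest l -> nonint (a x0 - alpha 0 l)) ->
  a' = 0 \/ (\forall x \near x0, D x -> forall l, ~ Gamma_pole (1 - x.2 0 l + a x - j%:R)) ->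
  (\forall x \near x0, D x -> forall l, rest l ->
     ~ Gamma_pole (a x - alpha 0 l - j%:R) /\
     ~ Gamma_pole (a x - alpha 0 l - j%:R + (n 0 l + k + 1)%:~R)) ->
  (\forall x \near x0, D x -> ~ Gamma_pole (1 - (P%:~R + c * x.1) + j%:R)) ->
  (\forall x \near x0, D x -> ~ Gamma_pole (P%:~R + c * x.1 + nu%:~R + 1 - j%:R)) ->
  eder beta0 D (fun x => Eterm (a x) (c * x.1) x.2 P nu N j)
    (fun x => Eterm (a x) (c * x.1) x.2 P nu N j * Elog (a x) (c * x.1) x.2 P nu a' c j).
Proof.
move=> [ac ad] ai D1 D2 D3 D4.
have cc : cabs c = 1 by case/orP: c1 => /eqP ->; rewrite ?cabsN cabs1.
have F1 : eder beta0 D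
   (fun x => \prod_l rpoch (1 - x.2 0 l + a x - j%:R) (m 0 l + k))
   (fun x => (\prod_l rpoch (1 - x.2 0 l + a x - j%:R) (m 0 l + k))
     * \sum_l a' * (digamma (1 - x.2 0 l + a x - j%:R + (m 0 l + k)%:~R)
               - digamma (1 - x.2 0 l + a x - j%:R))).
  apply: eder_log_prod => l _; apply: eder_rpoch.
  - have h1 : (fun _ : X => 1 : C) @ x0 --> (1 : C) by apply: cvg_cst.
    have h2 : (fun x : X => x.2) @ x0 --> beta0 by exact: cvg_snd.
    have h3 : (fun x : X => x.2 0 l) @ x0 --> beta0 0 l.
      exact: (cvg_comp _ _ h2 (@coord_continuous _ _ _ 0 l beta0)).
    apply: has_slopeD; split; first by have h4 := cvgD (cvgB h1 h3) ac; exact: h4.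
    have d1 := is_derive_cst (1 - beta0 0 l) (0 : C) (1 : C).
    by have := is_deriveD d1 ad; rewrite add0r.
  - by case: (m 0 l + k) (mk l) => // d _ [].
  - case: D1 => [|D1]; [by left|right].
    apply: filterS D1 => x h Dx; split; first exact: h.
    by case: (m 0 l + k) (mk l) => // d _; have [] := Gamma_addn d (h Dx l).
have F2 : eder beta0 D
   (fun x => \prod_(l | rest l) (rpoch (a x - alpha 0 l - j%:R) (n 0 l + k + 1))^-1)
   (fun x => (\prod_(l | rest l) (rpoch (a x - alpha 0 l - j%:R) (n 0 l + k + 1))^-1)
     * \sum_(l | rest l) - (a' * (digamma (a x - alpha 0 l - j%:R + (n 0 l + k + 1)%:~R)
               - digamma (a x - alpha 0 l - j%:R)))).
  apply: eder_log_prod => l rl; have nl := ai _ rl.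
  have nlj : nonint (a x0 - alpha 0 l - j%:R).
    by have := nonint_shift (- j%:Z) nl; rewrite rmorphN.
  apply: eder_logV; first exact: rpoch_neq0.
  apply: eder_rpoch.
  - by do 2 apply: has_slopeD.
  - by move=> t; exact: nonint_sub.
  - by right; apply: filterS D2 => x h Dx; exact: h.
have F3 := eder_rgamma1 beta0 D c1.
have e4 (x : X) : 1 - c * x.1 + (j%:Z - P)%:~R = 1 - (P%:~R + c * x.1) + j%:R.
  by rewrite rmorphB /=; ring.
have e4' (x : X) : 1 - c * x.1 + (j%:Z - P)%:~R + (P - j%:Z)%:~R = 1 + - c * x.1.
  by rewrite !rmorphB /=; ring.
have F4 : eder beta0 D (fun x => rpoch (1 - c * x.1 + (j%:Z - P)%:~R) (P - j%:Z))
   (fun x => rpoch (1 - c * x.1 + (j%:Z - P)%:~R) (P - j%:Z)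
     * (- c * (digamma (1 - c * x.1 + (j%:Z - P)%:~R + (P - j%:Z)%:~R)
             - digamma (1 - c * x.1 + (j%:Z - P)%:~R)))).
  apply: eder_rpoch.
  - apply: has_slopeD.
    rewrite (_ : (fun x : X => _) = (fun x => 1 + - c * x.1)); first exact: has_slope_fst.
    by apply/funext => x; rewrite mulNr.
  - by move=> l; rewrite /= mulr0 subr0 -(opprB P); exact: neg_part_shift_neq0.
  - have cN : cabs (- c) = 1 by rewrite cabsN.
    right; apply: filterS2 D3 (near_nonpole1 cN) => x h h' Dx.
    by rewrite e4' e4; split; [exact: h|exact: h'].
have e5 (x : X) : 1 + c * x.1 + (P + nu - j%:Z)%:~R = P%:~R + c * x.1 + nu%:~R + 1 - j%:R.
  by rewrite rmorphB rmorphD /=; ring.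
have e5' (x : X) : 1 + c * x.1 + (P + nu - j%:Z)%:~R + (- (P + nu - j%:Z))%:~R = 1 + c * x.1.
  by rewrite rmorphN /= addrK.
have F5 : eder beta0 D (fun x => rpoch (1 + c * x.1 + (P + nu - j%:Z)%:~R) (- (P + nu - j%:Z)))
   (fun x => rpoch (1 + c * x.1 + (P + nu - j%:Z)%:~R) (- (P + nu - j%:Z))
     * (c * (digamma (1 + c * x.1 + (P + nu - j%:Z)%:~R + (- (P + nu - j%:Z))%:~R)
             - digamma (1 + c * x.1 + (P + nu - j%:Z)%:~R)))).
  apply: eder_rpoch.
  - by apply: has_slopeD; exact: has_slope_fst.
  - move=> l; rewrite /= mulr0 addr0.
    by have := neg_part_shift_neq0 l; rewrite opprK.
  - right; apply: filterS2 D4 (near_nonpole1 cc) => x h h' Dx.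
    by rewrite e5' e5; split; [exact: h|exact: h'].
(* The digamma values at 1 - eta and 1 + eta contributed by [F3] cancel against those of [F4] and
   [F5]. *)
have F := eder_logM (eder_logM F1 F2) (eder_logM F3 (eder_logM F4 F5)).
have := ederM (eder_cst beta0 D ((- 1) ^ P / (j`!%:R * (N - j)`!%:R))) F.
move=> /eder_near; apply; apply: nearX => x _.
rewrite mulr0 addr0 /Eterm -/(rgamma_pair _ _ _ _) /Elog -!mulrA; congr (_ * (_ * (_ * (_ * _)))).
rewrite e4' e4 e5' e5 [- c * x.1]mulNr.
by ring.
Qed.

End EtermDerivative.

End Confluent.

(** * From Gamma and Pochhammer quotients to shifted factorials *)

Section Identification.
Local Open Scope classical_set_scope.
Context {R : realType} {r : nat}.
Local Notation C := (Cplx R).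
Local Notation X := (C * 'rV[C]_r)%type.
Variables (n m : 'rV[int]_r) (alpha : 'rV[C]_r) (k : int) (i1 i2 : 'I_r) (p : int).
Hypothesis mk : forall l, 0 <= m 0 l + k.
Local Notation rest := (rest i1 i2).
Local Notation M l := ((m 0 l + k)%:~R : C).
Local Notation S l := ((n 0 l + k + 1)%:~R : C).

(** For s >= 0 the polynomial identity [poch_subn] permits (1 - x)_j = 0. This matters at the points
    of [combh_regular], where the upper symbols (1 - B + p)_j may vanish. *)
Lemma GammaM_subn (x : C) (s : int) (j : nat) : 0 <= s ->
  ~ Gamma_pole x -> ~ Gamma_pole (x + s%:~R) -> poch (1 - (x + s%:~R)) j != 0 ->
  rpoch (x - j%:R) s = Gamma (x + s%:~R) / Gamma x * (poch (1 - x) j / poch (1 - (x + s%:~R)) j).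
Proof.
case: s => // d _ nx nxs p0; have [_ _ -> _] := Gamma_addn d nx.
have := poch_subn x d j; rewrite -[1 - x - _]addrA -opprD => E.
rewrite rpoch_nat mulfK ?Gamma_neq0 //; apply: (mulIf p0).
by rewrite E mulrA divfK.
Qed.

Lemma GammaS_subn (x : C) (s : int) (j : nat) :
  ~ Gamma_pole x -> ~ Gamma_pole (x + s%:~R) ->
  poch (1 - x) j != 0 -> poch (1 - (x + s%:~R)) j != 0 ->
  [/\ ~ Gamma_pole (x - j%:R), ~ Gamma_pole (x - j%:R + s%:~R) &
  (rpoch (x - j%:R) s)^-1
  = Gamma x / Gamma (x + s%:~R) * (poch (1 - (x + s%:~R)) j / poch (1 - x) j)].
Proof.
move=> nx nxs p0 p1.
have [n1 -> _] := Gamma_subn nx p0; have [n2 -> _] := Gamma_subn nxs p1.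
rewrite addrAC in n2 *; split=> //.
have [r0 ->] := Gamma_rpoch n1 n2; have g0 := Gamma_neq0 n1.
have s0 : (- 1) ^+ j != 0 :> C by rewrite signr_eq0.
move: (poch _ _) (poch _ _) (Gamma _) (rpoch _ _) ((- 1) ^+ j : C) p0 p1 r0 g0 s0.
move=> a b c d e a0 b0 d0 c0 e0; field.
by rewrite a0 b0 c0 d0 e0.
Qed.

(** Serves both products: b, a, g, q stand for B, A - 1, 1 - p, p + n_1 + k + 1 or for their hatted
    counterparts. The pair g, q is kept as Gamma values, to be matched with [rgamma_pair]. *)
Lemma GH_gen (s g q : C) (b a : 'I_r -> C) (N j : nat) : (j <= N)%N ->
  (forall l, [/\ ~ Gamma_pole (b l), ~ Gamma_pole (b l + M l) & poch (1 - (b l + M l)) j != 0]) ->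
  (forall l, rest l -> [/\ ~ Gamma_pole (a l), ~ Gamma_pole (a l + S l),
     poch (1 - a l) j != 0 & poch (1 - (a l + S l)) j != 0]) ->
  ~ Gamma_pole g -> ~ Gamma_pole q -> poch (1 - q) j != 0 ->
  s * (\prod_l Gamma (b l + M l)) * (\prod_(l | rest l) Gamma (a l))
    / ((\prod_l Gamma (b l)) * (\prod_(l | rest l) Gamma (a l + S l)) * Gamma g * Gamma q * N`!%:R)
  * (poch (- N%:R) j * (poch (1 - q) j
        * ((\prod_l poch (1 - b l) j) * \prod_(l | rest l) poch (1 - (a l + S l)) j))
     / (poch g j * ((\prod_l poch (1 - (b l + M l)) j) * \prod_(l | rest l) poch (1 - a l) j) * j`!%:R))
  = s / (j`!%:R * (N - j)`!%:R)
    * ((\prod_l rpoch (b l - j%:R) (m 0 l + k))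
       * (\prod_(l | rest l) (rpoch (a l - j%:R) (n 0 l + k + 1))^-1)
       * (Gamma (g + j%:R) * Gamma (q - j%:R))^-1).
Proof.
move=> jN bP aP gP qP q0.
have E1 l : rpoch (b l - j%:R) (m 0 l + k)
  = Gamma (b l + M l) / Gamma (b l) * (poch (1 - b l) j / poch (1 - (b l + M l)) j).
  by have [h1 h2 h3] := bP l; exact: GammaM_subn.
have E2 l : rest l -> (rpoch (a l - j%:R) (n 0 l + k + 1))^-1
  = Gamma (a l) / Gamma (a l + S l) * (poch (1 - (a l + S l)) j / poch (1 - a l) j).
  by move=> rl; have [h1 h2 h3 h4] := aP l rl; have [] := GammaS_subn h1 h2 h3 h4.
rewrite (eq_bigr _ (fun l _ => E1 l)) (eq_bigr _ E2) !big_split /= !prodfV.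
have [_ pg0 -> _] := Gamma_addn j gP; have [nq -> _] := Gamma_subn qP q0.
have gg := Gamma_neq0 gP; have gq := Gamma_neq0 nq.
rewrite poch_negn //.
have f0 : N`!%:R != 0 :> C by rewrite pnatr_eq0 -lt0n fact_gt0.
have s0 : (- 1) ^+ j != 0 :> C by rewrite signr_eq0.
have -> : s * (\prod_l Gamma (b l + M l)) * (\prod_(l | rest l) Gamma (a l))
    / ((\prod_l Gamma (b l)) * (\prod_(l | rest l) Gamma (a l + S l)) * Gamma g
        * ((- 1) ^+ j * poch (1 - q) j * Gamma (q - j%:R)) * N`!%:R)
  = s * (\prod_l Gamma (b l + M l)) * (\prod_(l | rest l) Gamma (a l))
    * ((\prod_l Gamma (b l))^-1 * (\prod_(l | rest l) Gamma (a l + S l))^-1 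
        * (Gamma g * ((- 1) ^+ j * poch (1 - q) j * Gamma (q - j%:R)) * N`!%:R)^-1).
  by rewrite -!invfM; congr (_ / _); ring.
rewrite [in LHS](_ : (poch g j * _ * _)^-1
   = (\prod_l poch (1 - (b l + M l)) j)^-1 * (\prod_(l | rest l) poch (1 - a l) j)^-1
     * (poch g j * j`!%:R)^-1); last first.
  by rewrite -!invfM; congr (_^-1); ring.
set B1 := \prod_l _; set B2 := (\prod_l _)^-1; set B3 := \prod_l _; set B4 := (\prod_l _)^-1.
set A1 := \prod_(l | _) _; set A2 := (\prod_(l | _) _)^-1.
set A3 := \prod_(l | _) _; set A4 := (\prod_(l | _) _)^-1.
have f1 : j`!%:R != 0 :> C by rewrite pnatr_eq0 -lt0n fact_gt0.
have f2 : (N - j)`!%:R != 0 :> C by rewrite pnatr_eq0 -lt0n fact_gt0.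
move: (N`!%:R : C) (j`!%:R : C) ((N - j)`!%:R : C) f0 f1 f2 => F0 F1 F2 f0 f1 f2.
move: ((- 1) ^+ j : C) s0 => e e0.
move: (poch g j) (poch (1 - q) j) (Gamma g) (Gamma (q - _)) pg0 q0 gg gq => u v w z u0 v0 w0 z0.
clearbody B1 B2 B3 B4 A1 A2 A3 A4.
by field; rewrite f0 f1 f2 e0 u0 v0 w0 z0.
Qed.

End Identification.

Section Comb.
Local Open Scope classical_set_scope.
Context {R : realType} {r : nat}.
Local Notation C := (Cplx R).
Local Notation X := (C * 'rV[C]_r)%type.
Variables (n m : 'rV[int]_r) (alpha : 'rV[C]_r) (k : int) (i1 i2 : 'I_r) (p : int).
Hypothesis mk : forall l, 0 <= m 0 l + k.
Local Notation rest := (rest i1 i2).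
Local Notation M l := ((m 0 l + k)%:~R : C).
Local Notation S l := ((n 0 l + k + 1)%:~R : C).
Local Notation kC := (k%:~R : C).

Lemma mem_map_enum (f : 'I_r -> C) l : f l \in [seq f l | l <- enum 'I_r].
Proof. by rewrite map_f // mem_enum. Qed.

Lemma mem_map_filter_enum (P : pred 'I_r) (f : 'I_r -> C) l : P l ->
  f l \in [seq f l | l <- [seq l <- enum 'I_r | P l]].
Proof. by move=> Pl; rewrite map_f // mem_filter Pl mem_enum. Qed.

Section Regular.
Variables (eps : C) (beta : 'rV[C]_r).
Local Notation B l := (B_ alpha i1 p eps beta l).
Local Notation A l := (A_ alpha i1 p eps l).
Local Notation y := (p_ p eps).
Local Notation q1 := (y + (n 0 i1)%:~R + kC + 1).
Local Notation q2 := (- y + (n 0 i2)%:~R + kC + 1).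

(** Puts the arguments in the form x and x + s with s an integer, to which the Gamma shift lemmas
    apply. *)
Lemma comb_regularP j : comb_regular n m alpha k i1 i2 p (eps, beta) ->
  (j < nterms (k + n 0 i2)%R)%N ->
  [/\ forall l, [/\ ~ Gamma_pole (B l), ~ Gamma_pole (B l + M l), poch (1 - B l) j != 0
                  & poch (1 - (B l + M l)) j != 0],
      forall l, rest l -> [/\ ~ Gamma_pole (A l - 1), ~ Gamma_pole (A l - 1 + S l),
         poch (1 - (A l - 1)) j != 0 & poch (1 - (A l - 1 + S l)) j != 0],
      ~ Gamma_pole (1 - y), ~ Gamma_pole q1 & poch (1 - q1) j != 0].
Proof.
rewrite /comb_regular /= => -[h1 h2] jN.
have {}h2 c := h2 c j ^~ jN.
split.
- move=> l; split.
  + by apply: h1; rewrite /Gamma_args !mem_cat (mem_map_enum (fun l => B l)).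
  + have -> : B l + M l = B l + (m 0 l)%:~R + kC by rewrite rmorphD addrA.
    by apply: h1; rewrite /Gamma_args !mem_cat (mem_map_enum (fun l => B l + (m 0 l)%:~R + kC)) ?orbT.
  + by apply: h2; rewrite /H_upper /H_lower /= !inE !mem_cat !inE !mem_cat (mem_map_enum (fun l => 1 - B l)) ?orbT.
  + have -> : 1 - (B l + M l) = 1 - B l - (m 0 l)%:~R - kC by rewrite rmorphD /=; ring.
    by apply: h2; rewrite /H_upper /H_lower /= !inE !mem_cat !inE !mem_cat (mem_map_enum (fun l => 1 - B l - (m 0 l)%:~R - kC)) ?orbT.
- move=> l rl; split.
  + by apply: h1; rewrite /Gamma_args !mem_cat (mem_map_filter_enum (fun l => A l - 1) rl) ?orbT.
  + have -> : A l - 1 + S l = A l + (n 0 l)%:~R + kC by rewrite !rmorphD /=; ring.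
    by apply: h1; rewrite /Gamma_args !mem_cat (mem_map_filter_enum (fun l => A l + (n 0 l)%:~R + kC) rl) ?orbT.
  + have -> : 1 - (A l - 1) = 2 - A l by ring.
    by apply: h2; rewrite /H_upper /H_lower /= !inE !mem_cat !inE !mem_cat (mem_map_filter_enum (fun l => 2 - A l) rl) ?orbT.
  + have -> : 1 - (A l - 1 + S l) = 1 - A l - (n 0 l)%:~R - kC by rewrite !rmorphD /=; ring.
    by apply: h2; rewrite /H_upper /H_lower /= !inE !mem_cat !inE !mem_cat (mem_map_filter_enum (fun l => 1 - A l - (n 0 l)%:~R - kC) rl) ?orbT.
- by apply: h1; rewrite /Gamma_args !mem_cat !inE eqxx ?orbT.
- by apply: h1; rewrite /Gamma_args !mem_cat !inE eqxx ?orbT.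
- have -> : 1 - q1 = - y - (n 0 i1)%:~R - kC by ring.
  by apply: h2; rewrite /H_upper /H_lower /= !inE eqxx.
Qed.

Lemma combh_regularP j : combh_regular n m alpha k i1 i2 p (eps, beta) ->
  (j < nterms (k + n 0 i1)%R)%N ->
  [/\ forall l, [/\ ~ Gamma_pole (B l - y), ~ Gamma_pole (B l - y + M l)
                  & poch (1 - (B l - y + M l)) j != 0],
      ~ Gamma_pole (1 + y), ~ Gamma_pole q2 & poch (1 - q2) j != 0].
Proof.
rewrite /combh_regular /= => -[h1 h2] jN.
have {}h2 c := h2 c j ^~ jN.
split.
- move=> l; split.
  + by apply: h1; rewrite /Gammah_args !mem_cat (mem_map_enum (fun l => B l - y)).
  + have -> : B l - y + M l = B l - y + (m 0 l)%:~R + kC by rewrite rmorphD addrA.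
    by apply: h1; rewrite /Gammah_args !mem_cat (mem_map_enum (fun l => B l - y + (m 0 l)%:~R + kC)) ?orbT.
  + have -> : 1 - (B l - y + M l) = 1 - B l + y - (m 0 l)%:~R - kC by rewrite rmorphD /=; ring.
    by apply: h2; rewrite /Hh_lower !inE !mem_cat (mem_map_enum (fun l => 1 - B l + y - (m 0 l)%:~R - kC)) ?orbT.
- by apply: h1; rewrite /Gammah_args !mem_cat !inE eqxx ?orbT.
- by apply: h1; rewrite /Gammah_args !mem_cat !inE eqxx ?orbT.
- have -> : 1 - q2 = y - (n 0 i2)%:~R - kC by ring.
  by apply: h2; rewrite !inE eqxx.
Qed.

(** The bound on eps keeps 1 - eps and 1 + eps off the poles, as [rgamma_pairE] requires. *)
Lemma comb_Eterm N j : comb_regular n m alpha k i1 i2 p (eps, beta) -> cabs eps < 1 ->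
  k + n 0 i2 = N%:Z -> (j <= N)%N ->
  G_ n m alpha k i1 i2 p eps beta * H_ n m alpha k i1 i2 p eps beta j
  = Eterm n m alpha k i1 i2 (alpha 0 i1 + y) (1 * eps) beta p (n 0 i1 + k) N j.
Proof.
move=> reg e1 kN jN.
have jN' : (j < nterms (k + n 0 i2)%R)%N by rewrite kN.
have [bP aP gP qP q0] := comb_regularP reg jN'.
have bP' l : [/\ ~ Gamma_pole (B l), ~ Gamma_pole (B l + M l) & poch (1 - (B l + M l)) j != 0].
  by have [] := bP l.
have := @GH_gen _ _ n m k i1 i2 mk ((- 1) ^ p) _ _ _ _ N j jN bP' aP gP qP q0.
have E1 : \prod_l Gamma (B l + M l) = \prod_l Gamma (B l + (m 0 l)%:~R + kC).
  by apply: eq_bigr => l _; rewrite rmorphD addrA.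
have E2 : \prod_(l | rest l) Gamma (A l - 1 + S l)
    = \prod_(l | rest l) Gamma (A l + (n 0 l)%:~R + kC).
  by apply: eq_bigr => l _; congr (Gamma _); rewrite !rmorphD /=; ring.
have E4 : \prod_(l | rest l) poch (1 - (A l - 1 + S l)) j
    = \prod_(l | rest l) poch (1 - A l - (n 0 l)%:~R - kC) j.
  by apply: eq_bigr => l _; congr (poch _ _); rewrite !rmorphD /=; ring.
have E5 : \prod_l poch (1 - (B l + M l)) j = \prod_l poch (1 - B l - (m 0 l)%:~R - kC) j.
  by apply: eq_bigr => l _; congr (poch _ _); rewrite !rmorphD /=; ring.
have E6 : \prod_(l | rest l) poch (1 - (A l - 1)) j = \prod_(l | rest l) poch (2 - A l) j.
  by apply: eq_bigr => l _; congr (poch _ _); ring.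
have E7 : - N%:R = - kC - (n 0 i2)%:~R by rewrite -opprD -rmorphD /= kN.
have E8 : 1 - q1 = - y - (n 0 i1)%:~R - kC by ring.
rewrite E1 E2 E4 E5 E6 E7 E8 {E1 E2 E4 E5 E6 E7 E8}.
rewrite /G_ /H_ /hyp_term /H_upper /H_lower !big_cons !big_cat !prod_map_enum !prod_map_filter_enum kN.
move=> ->; rewrite /Eterm.
have E1 : \prod_l rpoch (B l - j%:R) (m 0 l + k)
    = \prod_l rpoch (1 - beta 0 l + (alpha 0 i1 + y) - j%:R) (m 0 l + k).
  by apply: eq_bigr => l _; congr (rpoch _ _); rewrite /B_; ring.
have E2 : \prod_(l | rest l) (rpoch (A l - 1 - j%:R) (n 0 l + k + 1))^-1
    = \prod_(l | rest l) (rpoch (alpha 0 i1 + y - alpha 0 l - j%:R) (n 0 l + k + 1))^-1.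
  by apply: eq_bigr => l _; congr ((rpoch _ _)^-1); rewrite /A_; ring.
have [nq _ _] := Gamma_subn qP q0; have [ng _ _ _] := Gamma_addn j gP.
have e2 : 1 - (p%:~R + 1 * eps) + j%:R = 1 - y + j%:R by rewrite /p_ mul1r.
have e3 : p%:~R + 1 * eps + (n 0 i1 + k)%:~R + 1 - j%:R = q1 - j%:R.
  by rewrite /p_ rmorphD /=; ring.
rewrite E1 E2 rgamma_pairE ?e2 ?e3 //.
- by apply: nonpole1D; rewrite mul1r cabsN.
- by apply: nonpole1D; rewrite mul1r.
Qed.

(** Each digamma increment in Theta_j moves the argument of one digamma value of Psi_k by j or by -j
    ([Gamma_addn], [Gamma_subn]), which produces the shifted values in [Elog]. *)
Lemma comb_Elog N j : comb_regular n m alpha k i1 i2 p (eps, beta) ->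
  k + n 0 i2 = N%:Z -> (j <= N)%N ->
  Theta_ n m alpha k i1 i2 p eps beta j - Psi_ n m alpha k i1 i2 p eps beta
  = Elog n m alpha k i1 i2 (alpha 0 i1 + y) (1 * eps) beta p (n 0 i1 + k) 1 1 j.
Proof.
move=> reg kN jN.
have jN' : (j < nterms (k + n 0 i2)%R)%N by rewrite kN.
have [bP aP gP qP q0] := comb_regularP reg jN'.
rewrite /Elog !mul1r.
have e1 l : digamma (1 - beta 0 l + (alpha 0 i1 + y) - j%:R)
  = digamma (B l) + digamma_incr (1 - B l) j.
  have [h1 _ h2 _] := bP l; have [_ _ <-] := Gamma_subn h1 h2.
  by congr digamma; rewrite /B_; ring.
have e2 l : digamma (1 - beta 0 l + (alpha 0 i1 + y) - j%:R + M l)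
  = digamma (B l + (m 0 l)%:~R + kC) + digamma_incr (1 - B l - (m 0 l)%:~R - kC) j.
  have [_ h1 _ h2] := bP l; have [_ _] := Gamma_subn h1 h2.
  have -> : 1 - (B l + M l) = 1 - B l - (m 0 l)%:~R - kC by rewrite rmorphD /=; ring.
  have -> : B l + M l = B l + (m 0 l)%:~R + kC by rewrite rmorphD addrA.
  by move=> <-; congr digamma; rewrite /B_ rmorphD /=; ring.
have e3 l : rest l -> digamma (alpha 0 i1 + y - alpha 0 l - j%:R)
  = digamma (A l - 1) + digamma_incr (2 - A l) j.
  move=> rl; have [h1 _ h2 _] := aP l rl; have [_ _] := Gamma_subn h1 h2.
  have -> : 1 - (A l - 1) = 2 - A l by ring.
  by move=> <-; congr digamma; rewrite /A_; ring.
have e4 l : rest l -> digamma (alpha 0 i1 + y - alpha 0 l - j%:R + S l)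
  = digamma (A l + (n 0 l)%:~R + kC) + digamma_incr (1 - A l - (n 0 l)%:~R - kC) j.
  move=> rl; have [_ h1 _ h2] := aP l rl; have [_ _] := Gamma_subn h1 h2.
  have -> : 1 - (A l - 1 + S l) = 1 - A l - (n 0 l)%:~R - kC by rewrite !rmorphD /=; ring.
  have -> : A l - 1 + S l = A l + (n 0 l)%:~R + kC by rewrite !rmorphD /=; ring.
  by move=> <-; congr digamma; rewrite /A_ !rmorphD /=; ring.
have e5 : digamma (1 - (p%:~R + eps) + j%:R) = digamma (1 - y) + digamma_incr (1 - y) j.
  by have [_ _ _ <-] := Gamma_addn j gP.
have e6 : digamma (p%:~R + eps + (n 0 i1 + k)%:~R + 1 - j%:R)
    = digamma q1 + digamma_incr (- y - (n 0 i1)%:~R - kC) j.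
  have [_ _] := Gamma_subn qP q0.
  have -> : 1 - q1 = - y - (n 0 i1)%:~R - kC by ring.
  by move=> <-; congr digamma; rewrite /p_ rmorphD /=; ring.
rewrite e5 e6.
rewrite [\sum_l _](eq_bigr (fun l => digamma (B l + (m 0 l)%:~R + kC)
   + digamma_incr (1 - B l - (m 0 l)%:~R - kC) j - (digamma (B l) + digamma_incr (1 - B l) j))); last first.
  by move=> l _; rewrite mul1r e1 e2.
rewrite [\sum_(l | rest l) _](eq_bigr (fun l => - (digamma (A l + (n 0 l)%:~R + kC)
   + digamma_incr (1 - A l - (n 0 l)%:~R - kC) j - (digamma (A l - 1) + digamma_incr (2 - A l) j)))); last first.
  by move=> l rl; rewrite mul1r e3 // e4.
rewrite sumrN !sumrB !big_split /= /Theta_ /Psi_.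
ring.
Qed.

End Regular.
End Comb.

Section CombH.
Local Open Scope classical_set_scope.
Context {R : realType} {r : nat}.
Local Notation C := (Cplx R).
Variables (n m : 'rV[int]_r) (alpha : 'rV[C]_r) (k : int) (i1 i2 : 'I_r) (p : int).
Hypothesis mk : forall l, 0 <= m 0 l + k.
Local Notation rest := (rest i1 i2).
Local Notation M l := ((m 0 l + k)%:~R : C).
Local Notation S l := ((n 0 l + k + 1)%:~R : C).
Local Notation kC := (k%:~R : C).
Hypothesis nonint1 : forall l, rest l -> nonint (alpha 0 i1 - alpha 0 l).
Variables (eps : C) (beta : 'rV[C]_r).
Local Notation B l := (B_ alpha i1 p eps beta l).
Local Notation A l := (A_ alpha i1 p eps l).
Local Notation y := (p_ p eps).
Local Notation q1 := (y + (n 0 i1)%:~R + kC + 1).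
Local Notation q2 := (- y + (n 0 i2)%:~R + kC + 1).

Lemma sign_oppz (s : int) : (- 1 : C) ^ (- s) = (- 1) ^ s.
Proof. by rewrite -invr_expz; case: s => d; rewrite /exprz /= ?invrK invr_sign. Qed.

Lemma combh_Eterm N j : combh_regular n m alpha k i1 i2 p (eps, beta) -> cabs eps < 1 ->
  k + n 0 i1 = N%:Z -> (j <= N)%N ->
  Gh_ n m alpha k i1 i2 p eps beta * Hh_ n m alpha k i1 i2 p eps beta j
  = Eterm n m alpha k i1 i2 (alpha 0 i1) (- 1 * eps) beta (- p) (n 0 i2 + k) N j.
Proof.
move=> reg e1 kN jN.
have jN' : (j < nterms (k + n 0 i1)%R)%N by rewrite kN.
have [bP gP qP q0] := combh_regularP reg jN'.
(* Here eps cancels: the hatted A arguments are constants, kept off the poles by [nonint1]. *)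
have aE l : A l - y - 1 = alpha 0 i1 - alpha 0 l by rewrite /A_; ring.
have aP l : rest l -> [/\ ~ Gamma_pole (A l - y - 1), ~ Gamma_pole (A l - y - 1 + S l),
     poch (1 - (A l - y - 1)) j != 0 & poch (1 - (A l - y - 1 + S l)) j != 0].
  move=> rl; have nl := nonint1 rl; rewrite aE.
  have nl' := nonint_shift (n 0 l + k + 1) nl.
  split; try exact: nonint_nonpole; try (apply: poch_neq0; exact: nonint_one_sub).
have := @GH_gen _ _ n m k i1 i2 mk ((- 1) ^ p) _ _ _ _ N j jN bP aP gP qP q0.
have E1 : \prod_l Gamma (B l - y + M l) = \prod_l Gamma (B l - y + (m 0 l)%:~R + kC).
  by apply: eq_bigr => l _; rewrite rmorphD addrA.
have E2 : \prod_(l | rest l) Gamma (A l - y - 1 + S l)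
    = \prod_(l | rest l) Gamma (A l - y + (n 0 l)%:~R + kC).
  by apply: eq_bigr => l _; congr (Gamma _); rewrite !rmorphD /=; ring.
have E3 : \prod_l poch (1 - (B l - y)) j = \prod_l poch (1 - B l + y) j.
  by apply: eq_bigr => l _; congr (poch _ _); ring.
have E4 : \prod_(l | rest l) poch (1 - (A l - y - 1 + S l)) j
    = \prod_(l | rest l) poch (1 - A l + y - (n 0 l)%:~R - kC) j.
  by apply: eq_bigr => l _; congr (poch _ _); rewrite !rmorphD /=; ring.
have E5 : \prod_l poch (1 - (B l - y + M l)) j = \prod_l poch (1 - B l + y - (m 0 l)%:~R - kC) j.
  by apply: eq_bigr => l _; congr (poch _ _); rewrite !rmorphD /=; ring.
have E6 : \prod_(l | rest l) poch (1 - (A l - y - 1)) j = \prod_(l | rest l) poch (2 - A l + y) j.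
  by apply: eq_bigr => l _; congr (poch _ _); ring.
have E7 : - N%:R = - kC - (n 0 i1)%:~R by rewrite -opprD -rmorphD /= kN.
have E8 : 1 - q2 = y - (n 0 i2)%:~R - kC by ring.
rewrite E1 E2 E3 E4 E5 E6 E7 E8 {E1 E2 E3 E4 E5 E6 E7 E8}.
rewrite /Gh_ /Hh_ /hyp_term /Hh_upper /Hh_lower !big_cons !big_cat !prod_map_enum !prod_map_filter_enum kN.
move=> ->; rewrite /Eterm sign_oppz.
have E1 : \prod_l rpoch (B l - y - j%:R) (m 0 l + k)
    = \prod_l rpoch (1 - beta 0 l + alpha 0 i1 - j%:R) (m 0 l + k).
  by apply: eq_bigr => l _; congr (rpoch _ _); rewrite /B_; ring.
have E2 : \prod_(l | rest l) (rpoch (A l - y - 1 - j%:R) (n 0 l + k + 1))^-1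
    = \prod_(l | rest l) (rpoch (alpha 0 i1 - alpha 0 l - j%:R) (n 0 l + k + 1))^-1.
  by apply: eq_bigr => l _; rewrite aE.
have [nq _ _] := Gamma_subn qP q0; have [ng _ _ _] := Gamma_addn j gP.
have e2 : 1 - ((- p)%:~R + -1 * eps) + j%:R = 1 + y + j%:R.
  by rewrite /p_ rmorphN /=; ring.
have e3 : (- p)%:~R + -1 * eps + (n 0 i2 + k)%:~R + 1 - j%:R = q2 - j%:R.
  by rewrite /p_ rmorphN rmorphD /=; ring.
rewrite E1 E2 rgamma_pairE ?e2 ?e3 //.
- by apply: nonpole1D; rewrite mulN1r opprK.
- by apply: nonpole1D; rewrite mulN1r cabsN.
Qed.

Lemma combh_Elog N j : combh_regular n m alpha k i1 i2 p (eps, beta) ->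
  k + n 0 i1 = N%:Z -> (j <= N)%N ->
  Thetah_ n k i2 p eps j + Psih_ n k i2 p eps
  = Elog n m alpha k i1 i2 (alpha 0 i1) (- 1 * eps) beta (- p) (n 0 i2 + k) 0 (- 1) j.
Proof.
move=> reg kN jN.
have jN' : (j < nterms (k + n 0 i1)%R)%N by rewrite kN.
have [bP gP qP q0] := combh_regularP reg jN'.
rewrite /Elog big1 => [|l _]; last by rewrite mul0r.
rewrite big1 => [|l _]; last by rewrite mul0r oppr0.
have e2 : 1 - ((- p)%:~R + -1 * eps) + j%:R = 1 + y + j%:R.
  by rewrite /p_ rmorphN /=; ring.
have e3 : (- p)%:~R + -1 * eps + (n 0 i2 + k)%:~R + 1 - j%:R = q2 - j%:R.
  by rewrite /p_ rmorphN rmorphD /=; ring.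
have [_ _ d1] := Gamma_subn qP q0; have [_ _ _ d2] := Gamma_addn j gP.
have E8 : 1 - q2 = y - (n 0 i2)%:~R - kC by ring.
rewrite e2 e3 d1 d2 E8 /Thetah_ /Psih_.
by ring.
Qed.

End CombH.

(** * Regular points and limits *)

Section NearNonint.
Local Open Scope classical_set_scope.
Context {R : realType}.
Local Notation C := (Cplx R).

Lemma cabs_int (t : int) : t != 0 -> 1 <= cabs (t%:~R : C).
Proof.
case: t => d d0; first by rewrite cabs_nat ler1n lt0n.
by rewrite NegzE rmorphN /= cabsN cabs_nat ler1n.
Qed.

(* Two values of e in the ball of radius 1/2 for which z + s e is an integer
   coincide, so at most one nonzero value has to be avoided. *)
Lemma near_nonint (z s : C) : cabs s = 1 -> \forall e \near (0 : C)^', nonint (z + s * e).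
Proof.
move=> s1; apply/near_cabsP.
have [[e0 [e00 e0h [t0 et0]]]|none] :=
  pselect (exists e : C, [/\ e != 0, cabs e < 2^-1 & exists t : int, z + s * e = t%:~R]).
  exists (cabs e0); first by rewrite cabs_gt0.
  move=> e; rewrite subr0 => ee0 e_n0 t; apply/eqP => et.
  have : cabs ((t - t0)%:~R : C) < 1.
    rewrite rmorphB /= -et -et0 (_ : _ - _ = s * (e - e0)); last by ring.
    rewrite cabsM s1 mul1r; apply: le_lt_trans (cabs_leB _ _) _; lra.
  have [tt0 _|tt0] := eqVneq (t - t0) 0; last by rewrite ltNge cabs_int.
  have : e = e0.
    have s0 : s != 0 by rewrite -cabs_gt0 s1.
    apply: (mulfI s0); apply: (@addrI _ z); rewrite et et0.
    by move/eqP: tt0; rewrite subr_eq0 => /eqP ->.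
  by move=> E; rewrite E ltxx in ee0.
exists 2^-1; first by rewrite invr_gt0.
move=> e; rewrite subr0 => eh e_n0 t; apply/eqP => et.
by apply: none; exists e; split=> //; exists t.
Qed.

Lemma closure_path (T : topologicalType) (f : C -> T) (D : set T) (x : T) :
  f @ (0 : C)^' --> x -> (\forall e \near (0 : C)^', D (f e)) -> closure D x.
Proof.
move=> fx fD A /fx Ax.
by have [e [De Ae]] := filter_ex (filterI fD Ax); exists (f e).
Qed.

Lemma cvg_id_dnbhs0 : (fun e : C => e) @ (0 : C)^' --> (0 : C).
Proof. exact: nbhs_dnbhs. Qed.

Lemma cvg_prodC (T : Type) (F : set_system T) (FF : Filter F) (I : Type) (s : seq I)
    (P : pred I) (f : I -> T -> C) (l : I -> C) :
  (forall i, P i -> f i @ F --> l i) ->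
  (fun x => \prod_(i <- s | P i) f i x) @ F --> \prod_(i <- s | P i) l i.
Proof. by move=> fl; apply: cvg_big => //; exact: mul_continuous. Qed.

Lemma cvg_sumC (T : Type) (F : set_system T) (FF : Filter F) (I : Type) (s : seq I)
    (P : pred I) (f : I -> T -> C) (l : I -> C) :
  (forall i, P i -> f i @ F --> l i) ->
  (fun x => \sum_(i <- s | P i) f i x) @ F --> \sum_(i <- s | P i) l i.
Proof. by move=> fl; apply: cvg_big => //; exact: add_continuous. Qed.

Lemma cvg_rpoch (T : Type) (F : set_system T) (FF : Filter F) (f : T -> C) (z : C) (s : int) :
  f @ F --> z -> (forall l : 'I_(neg_part s), z - l.+1%:R != 0) ->
  (fun x => rpoch (f x) s) @ F --> rpoch z s.
Proof.
move=> fz z0.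
have H (c : C) : (fun x => f x + c) @ F --> z + c.
  have h : (fun _ : T => c) @ F --> c by exact: cvg_cst.
  exact: (cvgD fz h).
have P1 : (fun x => \prod_(l < pos_part s) (f x + l%:R)) @ F --> \prod_(l < pos_part s) (z + l%:R).
  by apply: cvg_prodC => l _; exact: H.
have P2 : (fun x => \prod_(l < neg_part s) (f x - l.+1%:R)) @ F --> \prod_(l < neg_part s) (z - l.+1%:R).
  by apply: cvg_prodC => l _; exact: H.
have n0 : \prod_(l < neg_part s) (z - l.+1%:R) != 0 by apply/prodf_neq0 => l _; exact: z0.
exact: (cvgM P1 (cvgV n0 P2)).
Qed.

End NearNonint.

Section Extensions.
Local Open Scope classical_set_scope.
Context {R : realType} {r : nat}.
Local Notation C := (Cplx R).
Local Notation X := (C * 'rV[C]_r)%type.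
Variables (n m : 'rV[int]_r) (alpha : 'rV[C]_r) (k : int) (i1 i2 : 'I_r) (p : int).
Hypothesis mk : forall l, 0 <= m 0 l + k.
Local Notation rest := (rest i1 i2).
Local Notation kC := (k%:~R : C).

Lemma mapP_enum (f : 'I_r -> C) (Q : C -> Prop) : (forall l, Q (f l)) ->
  forall z, z \in [seq f l | l <- enum 'I_r] -> Q z.
Proof. by move=> Qf z /mapP[l _ ->]. Qed.

Lemma mapP_filter_enum (P : pred 'I_r) (f : 'I_r -> C) (Q : C -> Prop) :
  (forall l, P l -> Q (f l)) ->
  forall z, z \in [seq f l | l <- [seq l <- enum 'I_r | P l]] -> Q z.
Proof. by move=> Qf z /mapP[l]; rewrite mem_filter => /andP[Pl _] ->; exact: Qf. Qed.

Lemma mem_cat_prop (Q : C -> Prop) (s t : seq C) :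
  (forall z, z \in s -> Q z) -> (forall z, z \in t -> Q z) -> forall z, z \in s ++ t -> Q z.
Proof. by move=> sQ tQ z; rewrite mem_cat => /orP[/sQ|/tQ]. Qed.

Lemma mem_cons_prop (Q : C -> Prop) (x : C) (s : seq C) :
  Q x -> (forall z, z \in s -> Q z) -> forall z, z \in x :: s -> Q z.
Proof. by move=> xQ sQ z; rewrite inE => /predU1P[->|/sQ]. Qed.

Lemma mem_nil_prop (Q : C -> Prop) : forall z, z \in ([::] : seq C) -> Q z.
Proof. by []. Qed.

Lemma nonint_eq (x y : C) (s : int) : nonint x -> y = x + s%:~R -> nonint y.
Proof. by move=> nx ->; exact: nonint_shift. Qed.

Lemma nonint_eqN (x y : C) (s : int) : nonint x -> y = - x + s%:~R -> nonint y.
Proof. by move=> nx; apply: nonint_eq; exact: nonintN. Qed.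

Section Regularity.
Variables (eps : C) (beta : 'rV[C]_r).
Local Notation B l := (B_ alpha i1 p eps beta l).
Local Notation A l := (A_ alpha i1 p eps l).

Lemma comb_regular_nonint : (forall l, nonint (B l)) -> (forall l, rest l -> nonint (A l)) ->
  nonint eps -> comb_regular n m alpha k i1 i2 p (eps, beta).
Proof.
move=> nB nA ne; have ny : nonint (p_ p eps) by apply: (nonint_eq (s := p) ne); rewrite addrC.
split=> [z zG|c j cH _ /=].
  apply: nonint_nonpole; move: z zG; rewrite /= /Gamma_args.
  do 4?[apply: mem_cat_prop]; first exact: mapP_enum.
  - by apply: mapP_enum => l; do 2 apply: nonint_shift.
  - by apply: mapP_filter_enum => l /nA nl; exact: (nonint_eq (s := -1) nl).
  - by apply: mapP_filter_enum => l /nA nl; do 2 apply: nonint_shift.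
  - apply: mem_cons_prop; first exact: nonint_one_sub.
    apply: mem_cons_prop; last exact: mem_nil_prop.
    by apply: (nonint_shift 1); do 2 apply: nonint_shift.
apply: poch_neq0; move: c cH; rewrite /= /H_upper /H_lower /=.
have H1 l : nonint (1 - B l - (m 0 l)%:~R - kC).
  by apply: (nonint_eqN (s := 1 - m 0 l - k) (nB l)); rewrite !rmorphB /=; ring.
have H2 l : rest l -> nonint (1 - A l - (n 0 l)%:~R - kC).
  by move=> /nA nl; apply: (nonint_eqN (s := 1 - n 0 l - k) nl); rewrite !rmorphB /=; ring.
apply: mem_cons_prop.
  by apply: (nonint_eqN (s := - n 0 i1 - k) ny); rewrite rmorphB rmorphN /=; ring.
apply: mem_cat_prop; first apply: mem_cat_prop.
- by apply: mapP_enum => l; exact: nonint_one_sub.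
- exact: mapP_filter_enum.
apply: mem_cons_prop; first exact: nonint_one_sub.
apply: mem_cat_prop; first exact: mapP_enum.
apply: mapP_filter_enum => l /nA nl.
by apply: (nonint_eqN (s := 2) nl); rewrite addrC.
Qed.

Lemma combh_regular_nonint :
  (forall l, nonint (B l - p_ p eps)) -> (forall l, rest l -> nonint (A l - p_ p eps)) ->
  nonint eps -> combh_regular n m alpha k i1 i2 p (eps, beta).
Proof.
move=> nB nA ne; have ny : nonint (p_ p eps) by apply: (nonint_eq (s := p) ne); rewrite addrC.
split=> [z zG|c j cH _ /=].
  apply: nonint_nonpole; move: z zG; rewrite /= /Gammah_args.
  do 4?[apply: mem_cat_prop]; first exact: mapP_enum.
  - by apply: mapP_enum => l; do 2 apply: nonint_shift.
  - by apply: mapP_filter_enum => l /nA nl; exact: (nonint_eq (s := -1) nl).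
  - by apply: mapP_filter_enum => l /nA nl; do 2 apply: nonint_shift.
  - apply: mem_cons_prop; first by apply: (nonint_eq (s := 1) ny); rewrite addrC.
    apply: mem_cons_prop; last exact: mem_nil_prop.
    by apply: (nonint_shift 1); do 2 apply: nonint_shift; exact: nonintN.
apply: poch_neq0; move: c cH; rewrite /= /Hh_lower /=.
apply: mem_cons_prop.
  by apply: (nonint_eq (s := - n 0 i2 - k) ny); rewrite rmorphB rmorphN /=; ring.
apply: mem_cons_prop; first by apply: (nonint_eq (s := 1) ny); rewrite addrC.
apply: mem_cat_prop.
  apply: mapP_enum => l.
  by apply: (nonint_eqN (s := 1 - m 0 l - k) (nB l)); rewrite !rmorphB /=; ring.
apply: mapP_filter_enum => l /nA nl.
by apply: (nonint_eqN (s := 2) nl); ring.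
Qed.

End Regularity.

Lemma term_i_regular_nonint (i : 'I_r) (beta : 'rV[C]_r) :
  (forall l, nonint (beta 0 l - alpha 0 i)) -> (forall l, l != i -> nonint (alpha 0 i - alpha 0 l)) ->
  term_i_regular n m alpha k i beta.
Proof.
move=> nb na c j + _; move=> cT; apply: poch_neq0; move: c cT; rewrite /term_lower.
apply: mem_cat_prop.
  apply: mapP_enum => l; apply: (nonint_eq (s := - m 0 l - k) (nb l)).
  by rewrite rmorphB rmorphN /=; ring.
by apply: mapP_filter_enum => l /na nl; apply: (nonint_eqN (s := 1) nl); ring.
Qed.

Hypothesis rest_nonint1 : forall l, rest l -> nonint (alpha 0 i1 - alpha 0 l).
Variable (beta0 : 'rV[C]_r).

Lemma cvg_shift_path : (fun e : C => beta0 + e *: const_mx 1) @ (0 : C)^' --> beta0.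
Proof.
have h : (fun e : C => e *: const_mx 1) @ (0 : C)^' --> (0 *: const_mx 1 : 'rV[C]_r).
  by apply: cvgZr_tmp; exact: cvg_id_dnbhs0.
have h2 : (fun _ : C => beta0) @ (0 : C)^' --> beta0 by exact: cvg_cst.
have h3 : (fun e : C => beta0 + e *: const_mx 1) @ (0 : C)^' --> beta0 + 0 *: const_mx 1.
  exact: (cvgD h2 h).
rewrite scale0r addr0 in h3.
exact: h3.
Qed.

Lemma comb_regular_closure : closure (comb_regular n m alpha k i1 i2 p) ((0 : C), beta0).
Proof.
(* Since B and A move with eps, varying eps alone reaches regular points. *)
apply: (@closure_path _ _ (fun e => (e, beta0))).
  have h : (fun _ : C => beta0) @ (0 : C)^' --> beta0 by exact: cvg_cst.
  exact: (cvg_pair (@cvg_id_dnbhs0 R) h).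
have nB : \forall e \near (0 : C)^', forall l, nonint (B_ alpha i1 p e beta0 l).
  apply: filter_forall => l; have := near_nonint (1 - beta0 0 l + alpha 0 i1 + p%:~R) (@cabs1 R).
  by apply: filterS => e; rewrite mul1r -addrA.
have nA : \forall e \near (0 : C)^', forall l, nonint (A_ alpha i1 p e l).
  apply: filter_forall => l; have := near_nonint (1 - alpha 0 l + alpha 0 i1 + p%:~R) (@cabs1 R).
  by apply: filterS => e; rewrite mul1r -addrA.
have ne := near_nonint (0 : C) (@cabs1 R).
apply: filterS3 nB nA ne => e h1 h2 h3; apply: comb_regular_nonint => // .
by move: h3; rewrite add0r mul1r.
Qed.

Lemma combh_regular_closure : closure (combh_regular n m alpha k i1 i2 p) ((0 : C), beta0).
Proof.
(* The hatted arguments B - p do not depend on eps, so beta has to move too in order to leave its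
   singular values. *)
apply: (@closure_path _ _ (fun e => (e, beta0 + e *: const_mx 1))).
  exact: (cvg_pair (@cvg_id_dnbhs0 R) cvg_shift_path).
have nB : \forall e \near (0 : C)^', forall l, nonint (1 - beta0 0 l + alpha 0 i1 - e).
  apply: filter_forall => l.
  have c1 : cabs (-1 : C) = 1 by rewrite cabsN cabs1.
  have := near_nonint (1 - beta0 0 l + alpha 0 i1) c1.
  by apply: filterS => e; rewrite mulN1r.
have ne := near_nonint (0 : C) (@cabs1 R).
apply: filterS2 nB ne => e h1 h3; apply: combh_regular_nonint.
- move=> l; apply: (nonint_eq (s := 0) (h1 l)).
  by rewrite /B_ /p_ !mxE mulr1 /=; ring.
- move=> l rl; apply: (nonint_eq (s := 1) (rest_nonint1 rl)).
  by rewrite /A_ /=; ring.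
- by move: h3; rewrite add0r mul1r.
Qed.

(** At regular points with |eps| < 1, [comb] is the eps-derivative formula of the sum of the
    [Eterm], and that sum is differentiable at the base point; [eder_value] then identifies the
    value of [comb] there. *)
Lemma comb_extends : (forall l, rest l -> nonint (alpha 0 i1 + p%:~R - alpha 0 l)) ->
  let K := comb n m alpha k i1 i2 p in
  let D := comb_regular n m alpha k i1 i2 p in
  let N := nterms (k + n 0 i2) in
  extends_to K D (0, beta0) /\
  is_derive (0 : C) 1 (fun e => \sum_(j < N) Eterm n m alpha k i1 i2
     (alpha 0 i1 + p_ p e) (1 * e) beta0 p (n 0 i1 + k) N.-1 j) (value_at K D (0, beta0)).
Proof.
move=> na K D N.
have aff : has_slope beta0 (fun x : X => alpha 0 i1 + p_ p x.1) 1.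
  rewrite (_ : (fun x : X => _) = (fun x => (alpha 0 i1 + p%:~R) + 1 * x.1)); last first.
    by apply/funext => x; rewrite /p_ mul1r addrA.
  exact: has_slope_fst.
have H : eder beta0 D
  (fun x => \sum_(j < N) Eterm n m alpha k i1 i2 (alpha 0 i1 + p_ p x.1) (1 * x.1) x.2 p (n 0 i1 + k) N.-1 j)
  (fun x => \sum_(j < N) Eterm n m alpha k i1 i2 (alpha 0 i1 + p_ p x.1) (1 * x.1) x.2 p (n 0 i1 + k) N.-1 j
     * Elog n m alpha k i1 i2 (alpha 0 i1 + p_ p x.1) (1 * x.1) x.2 p (n 0 i1 + k) 1 1 j).
  apply: eder_sum => j _.
  have reg (x : X) : D x -> _ := fun Dx => @comb_regularP _ _ n m alpha k i1 i2 p x.1 x.2 j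
     (ltac:(by rewrite -surjective_pairing)) (ltn_ord j).
  apply: eder_Eterm => //.
  - by rewrite eqxx.
  - by move=> l rl /=; rewrite /p_ addr0; exact: na.
  - right; apply: nearX => x /reg[bP _ _ _ _] l; have [h1 _ h2 _] := bP l.
    have [+ _ _] := Gamma_subn h1 h2; congr (~ Gamma_pole _).
    by rewrite /B_; ring.
  - apply: nearX => x /reg[_ aP _ _ _] l rl; have [h1 h2 h3 h4] := aP l rl.
    have [+ + _] := GammaS_subn h1 h2 h3 h4.
    have -> : A_ alpha i1 p x.1 l - 1 - j%:R = alpha 0 i1 + p_ p x.1 - alpha 0 l - j%:R.
      by rewrite /A_; ring.
    by split.
  - apply: nearX => x /reg[_ _ gP _ _]; have [+ _ _ _] := Gamma_addn j gP.
    by rewrite mul1r.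
  - apply: nearX => x /reg[_ _ _ qP q0]; have [+ _ _] := Gamma_subn qP q0.
    by congr (~ Gamma_pole _); rewrite /p_ mul1r rmorphD /=; ring.
have := eder_value comb_regular_closure H (K := K).
apply.
have h3 : (fun x : X => x.1) @ ((0 : C), beta0) --> (0 : C) by exact: cvg_fst.
have h4 : \forall x \near ((0 : C), beta0), cabs (x.1 - 0) < 1 by move/cvg_cabsP : h3; apply.
apply: filterS h4 => -[e beta] /=; rewrite subr0 => e1 Dx.
rewrite /K /comb big_mkord; apply: eq_bigr => j _.
have N0 : (0 < N)%N := leq_ltn_trans (leq0n j) (ltn_ord j).
have E : k + n 0 i2 = (N.-1)%:Z by move: N0; rewrite /N; case: (k + n 0 i2).
have jN : (j <= N.-1)%N by rewrite -ltnS prednK // ltn_ord.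
by rewrite (comb_Eterm mk Dx e1 E) // (comb_Elog Dx E).
Qed.

Lemma combh_extends :
  let K := combh n m alpha k i1 i2 p in
  let D := combh_regular n m alpha k i1 i2 p in
  let N := nterms (k + n 0 i1) in
  extends_to K D (0, beta0) /\
  is_derive (0 : C) 1 (fun e => \sum_(j < N) Eterm n m alpha k i1 i2
     (alpha 0 i1) (- 1 * e) beta0 (- p) (n 0 i2 + k) N.-1 j) (value_at K D (0, beta0)).
Proof.
move=> K D N.
have aff : has_slope beta0 (fun x : X => alpha 0 i1) 0.
  split; first exact: cvg_cst.
  exact: is_derive_cst.
have H : eder beta0 D
  (fun x => \sum_(j < N) Eterm n m alpha k i1 i2 (alpha 0 i1) (- 1 * x.1) x.2 (- p) (n 0 i2 + k) N.-1 j)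
  (fun x => \sum_(j < N) Eterm n m alpha k i1 i2 (alpha 0 i1) (- 1 * x.1) x.2 (- p) (n 0 i2 + k) N.-1 j
     * Elog n m alpha k i1 i2 (alpha 0 i1) (- 1 * x.1) x.2 (- p) (n 0 i2 + k) 0 (- 1) j).
  apply: eder_sum => j _.
  have reg (x : X) : D x -> _ := fun Dx => @combh_regularP _ _ n m alpha k i1 i2 p x.1 x.2 j
     (ltac:(by rewrite -surjective_pairing)) (ltn_ord j).
  apply: (eder_Eterm mk (a := fun=> alpha 0 i1)) => //.
  - by rewrite eqxx orbT.
  (* The slope of a is 0, so no regularity of the shifted beta arguments is asked for. *)
  - by left.
  - apply: nearX => x _ l rl; have nl := rest_nonint1 rl.
    have nlj := nonint_shift (- j%:Z) nl; rewrite rmorphN /= in nlj.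
    by split; apply: nonint_nonpole => //; exact: nonint_shift.
  - apply: nearX => x /reg[_ gP _ _]; have [+ _ _ _] := Gamma_addn j gP.
    by congr (~ Gamma_pole _); rewrite /p_ rmorphN /=; ring.
  - apply: nearX => x /reg[_ _ qP q0]; have [+ _ _] := Gamma_subn qP q0.
    by congr (~ Gamma_pole _); rewrite /p_ rmorphN rmorphD /=; ring.
have := eder_value combh_regular_closure H (K := K).
apply.
have h3 : (fun x : X => x.1) @ ((0 : C), beta0) --> (0 : C) by exact: cvg_fst.
have h4 : \forall x \near ((0 : C), beta0), cabs (x.1 - 0) < 1 by move/cvg_cabsP : h3; apply.
apply: filterS h4 => -[e beta] /=; rewrite subr0 => e1 Dx.
rewrite /K /combh big_mkord; apply: eq_bigr => j _.
have N0 : (0 < N)%N := leq_ltn_trans (leq0n j) (ltn_ord j).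
have E : k + n 0 i1 = (N.-1)%:Z by move: N0; rewrite /N; case: (k + n 0 i1).
have jN : (j <= N.-1)%N by rewrite -ltnS prednK // ltn_ord.
by rewrite (combh_Eterm mk rest_nonint1 Dx e1 E) // (combh_Elog Dx E).
Qed.

End Extensions.

(** * Continuity of q_e and of the residues in the parameters *)

Section Continuity.
Local Open Scope classical_set_scope.
Context {R : realType} {r : nat}.
Local Notation C := (Cplx R).
Variables (n m : 'rV[int]_r) (k : int).
Context {T : Type} {F : set_system T} {FF : Filter F}.

Lemma cvg_expC (f : T -> C) (z : C) (d : nat) : f @ F --> z -> (fun t => f t ^+ d) @ F --> z ^+ d.
Proof.
move=> fz; elim: d => [|d IH]; first exact: cvg_cst.
rewrite (_ : (fun t => _) = (fun t => f t * f t ^+ d)); last by apply/funext => t; rewrite exprS.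
rewrite exprS; exact: (cvgM fz IH).
Qed.

Lemma cvg_bernoulli_poly (f : T -> C) (z : C) (d : nat) :
  f @ F --> z -> (fun t => bernoulli_poly d (f t)) @ F --> bernoulli_poly d z.
Proof.
move=> fz; apply: cvg_sumC => l _.
have h2 := @cvg_expC f z (d - l)%N fz.
apply: cvgM; [exact: cvg_cst|exact: h2].
Qed.

Lemma cvg_newton_seq (p : T -> nat -> C) (p0 : nat -> C) :
  (forall j, (fun t => p t j) @ F --> p0 j) ->
  forall d i, (fun t => (newton_seq (p t) d)`_i) @ F --> (newton_seq p0 d)`_i.
Proof.
move=> pp d; elim: d => [|d IH] i.
  exact: cvg_cst.
rewrite (_ : (fun t => _) = (fun t => if (i < d.+1)%N then (newton_seq (p t) d)`_i else
   if i == d.+1 then d.+1%:R^-1 * \sum_(1 <= j < d.+2) p t j * (newton_seq (p t) d)`_(d.+1 - j) else 0)).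
  rewrite /= nth_rcons size_newton_seq; case: ifP => _; first exact: IH.
  have cst (c : C) : (fun _ : T => c) @ F --> c by exact: cvg_cst.
  case: ifP => _; last exact: (cst 0).
  have h := cst (d.+1%:R^-1).
  have h2 : (fun t => \sum_(1 <= j < d.+2) p t j * (newton_seq (p t) d)`_(d.+1 - j)) @ F -->
      \sum_(1 <= j < d.+2) p0 j * (newton_seq p0 d)`_(d.+1 - j).
    by apply: cvg_sumC => j _; exact: (cvgM (pp j) (IH (d.+1 - j)%N)).
  exact: (cvgM h h2).
by apply/funext => t; rewrite /= nth_rcons size_newton_seq.
Qed.

Variables (alphat : T -> 'rV[C]_r) (alpha : 'rV[C]_r).
Hypothesis alpha_cvg : forall l, (fun t => alphat t 0 l) @ F --> alpha 0 l.

Lemma cvg_Q_ beta j (y : C) :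
  (fun t => Q_ n m (alphat t) beta j y) @ F --> Q_ n m alpha beta j y.
Proof.
apply: cvg_sumC => l _.
have cst (c : C) : (fun _ : T => c) @ F --> c by exact: cvg_cst.
have h1 : (fun t => - alphat t 0 l - y) @ F --> - alpha 0 l - y.
  by apply: cvgB; [apply: cvgN; exact: alpha_cvg|exact: cst].
have h2 : (fun t => 1 - alphat t 0 l + (n 0 l)%:~R) @ F --> 1 - alpha 0 l + (n 0 l)%:~R.
  by apply: cvgD; [apply: cvgB; [exact: cst|exact: alpha_cvg]|exact: cst].
apply: cvgB; last exact: (@cvg_bernoulli_poly _ _ j.+1 h2).
apply: cvgD; last exact: cst.
by apply: cvgB; [exact: (@cvg_bernoulli_poly _ _ j.+1 h1)|exact: cst].
Qed.

Lemma cvg_q_poly beta (e : int) (y : C) :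
  (fun t => q_poly n m (alphat t) beta e y) @ F --> q_poly n m alpha beta e y.
Proof.
have cst (c : C) : (fun _ : T => c) @ F --> c by exact: cvg_cst.
case: e => d /=; last exact: (cst 0).
rewrite q_seqE (_ : (fun t => _) = (fun t => (newton_seq (fun j => (- 1) ^+ j.+1 / j.+1%:R
  * Q_ n m (alphat t) beta j y) d)`_d)); last by apply/funext => t; rewrite q_seqE.
apply: cvg_newton_seq => j.
by apply: cvgM; [exact: cst|exact: cvg_Q_].
Qed.

Lemma cvg_res (betat : T -> 'rV[C]_r) (beta : 'rV[C]_r) i j : (forall l, 0 <= m 0 l + k) ->
  (forall l, l != i -> nonint (alpha 0 i - alpha 0 l)) ->
  (forall l, (fun t => betat t 0 l) @ F --> beta 0 l) ->
  (fun t => res n m k (alphat t) i (betat t) j) @ F --> res n m k alpha i beta j.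
Proof.
move=> mk na beta_cvg.
have cst (c : C) : (fun _ : T => c) @ F --> c by exact: cvg_cst.
have P1 : (fun t => \prod_l rpoch (1 - betat t 0 l + alphat t 0 i - j%:R) (m 0 l + k)) @ F -->
    \prod_l rpoch (1 - beta 0 l + alpha 0 i - j%:R) (m 0 l + k).
  apply: cvg_prodC => l _; apply: cvg_rpoch.
    apply: cvgB; last exact: cst.
    by apply: cvgD; [apply: cvgB; [exact: cst|exact: beta_cvg]|exact: alpha_cvg].
  by case: (m 0 l + k) (mk l) => // d _ [].
have nj l : l != i -> nonint (alpha 0 i - alpha 0 l - j%:R).
  by move=> li; have := nonint_shift (- j%:Z) (na _ li); rewrite rmorphN.
have P2 : (fun t => \prod_(l | l != i) rpoch (alphat t 0 i - alphat t 0 l - j%:R) (n 0 l + k + 1)) @ F -->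
    \prod_(l | l != i) rpoch (alpha 0 i - alpha 0 l - j%:R) (n 0 l + k + 1).
  apply: cvg_prodC => l li; apply: cvg_rpoch.
    by apply: cvgB; [apply: cvgB; exact: alpha_cvg|exact: cst].
  by move=> t; apply: nonint_sub; exact: nj.
have P0 : \prod_(l | l != i) rpoch (alpha 0 i - alpha 0 l - j%:R) (n 0 l + k + 1) != 0.
  by apply/prodf_neq0 => l li; apply: rpoch_neq0; exact: nj.
apply: cvgM; last exact: cst.
exact: (cvgM P1 (cvgV P0 P2)).
Qed.

End Continuity.

Section Limits.
Local Open Scope classical_set_scope.
Context {R : realType} {r : nat}.
Local Notation C := (Cplx R).
Variables (n m : 'rV[int]_r) (alpha : 'rV[C]_r) (k : int).
Hypothesis mk : forall l, 0 <= m 0 l + k.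

Lemma value_at_eq (T : topologicalType) (f g : T -> C) (D : set T) (x : T) :
  closure D x -> (forall y, D y -> f y = g y) -> g @ x --> g x ->
  extends_to f D x /\ value_at f D x = g x.
Proof.
move=> clD fg gx.
have PF : ProperFilter (within D (nbhs x)) by exact: within_nbhs_proper.
have fx : f @ within D (nbhs x) --> g x.
  apply: cvg_trans (cvg_within_filter D gx); apply: near_eq_cvg.
  have h2 : \forall y \near x, D y -> g y = f y by apply: filterE => y Dy; rewrite fg.
  exact: h2.
split; first by split; [exact: clD|apply/cvg_ex; eexists; exact: fx].
have hC : hausdorff_space C by exact: norm_hausdorff.
exact: (cvg_lim hC fx).
Qed.

(** As m_l + k >= 0, the sum of residues is polynomial in beta; it is thus the continuous extension
    of the term through its removable singularities. *)
Lemma term_i_extends (i : 'I_r) (beta0 : 'rV[C]_r) :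
  (forall l, l != i -> nonint (alpha 0 i - alpha 0 l)) ->
  let T := term_i n m alpha k i in
  let D := term_i_regular n m alpha k i in
  extends_to T D beta0 /\
  value_at T D beta0 = \sum_(j < nterms (k + n 0 i)) res n m k alpha i beta0 j.
Proof.
move=> na T D.
have clD : closure D beta0.
  apply: (@closure_path _ _ (fun e => beta0 + e *: const_mx 1)); first exact: cvg_shift_path.
  have nB : \forall e \near (0 : C)^', forall l, nonint (beta0 0 l - alpha 0 i + e).
    apply: filter_forall => l; have := near_nonint (beta0 0 l - alpha 0 i) (@cabs1 R).
    by apply: filterS => e; rewrite mul1r.
  apply: filterS nB => e h; apply: term_i_regular_nonint => // l.
  by apply: (nonint_eq (s := 0) (h l)); rewrite !mxE mulr1 /=; ring.
pose g beta := \sum_(j < nterms (k + n 0 i)) res n m k alpha i beta j.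
apply: (@value_at_eq _ T g) => //; first by move=> beta Db; rewrite /T term_i_res.
have FF : Filter (nbhs beta0) := nbhs_filter beta0.
apply: (@cvg_sumC _ _ (nbhs beta0) FF) => j _.
apply: (@cvg_res _ _ n m k _ (nbhs beta0) FF (fun=> alpha) alpha _ id) => // l.
  exact: (@cvg_cst _ _ _ (nbhs beta0) FF).
exact: coord_continuous.
Qed.

(** Here i is the family of poles considered and i' its confluent partner, at distance P + eta. The
    denominator factor of index i' in the residue is the one supplied by [rgamma_pair_res]. *)
Lemma Eterm_res (i1 i2 i i' : 'I_r) (alpha' : 'rV[C]_r) (a eta : C) (P : int) (beta : 'rV[C]_r) (j : nat) :
  (forall l, (l != i) && (l != i') = rest i1 i2 l) -> i' != i ->
  alpha' 0 i = a -> alpha' 0 i' = a - (P%:~R + eta) ->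
  (forall l, rest i1 i2 l -> alpha' 0 l = alpha 0 l) -> nonint eta ->
  Eterm n m alpha k i1 i2 a eta beta P (n 0 i' + k) (nterms (k + n 0 i)%R).-1 j
  = eta * rgamma1 eta * res n m k alpha' i beta j.
Proof.
move=> restE ii' ai ai' ar ne.
rewrite /Eterm /res rgamma_pair_res // (bigD1 i' ii') /= ai ai'.
have E : \prod_(l < r | (l != i) && (l != i')) rpoch (a - alpha' 0 l - j%:R) (n 0 l + k + 1)
   = \prod_(l | rest i1 i2 l) rpoch (a - alpha 0 l - j%:R) (n 0 l + k + 1).
  by apply: eq_big => // l; rewrite restE => /ar ->.
rewrite E (_ : a - (a - (P%:~R + eta)) = P%:~R + eta); last by ring.
rewrite prodfV.
(* One sign belongs to [Eterm], the other comes from [rgamma_pair_res]. *)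
have sg : ((- 1 : C) ^ P) * (- 1) ^ P = 1.
  by rewrite -expfzMl mulrNN mulr1 exp1rz.
move: (rpoch (P%:~R + eta - j%:R) _) (\prod_(l | rest i1 i2 l) _) => v w.
move: (\prod_l rpoch _ _) (rgamma1 eta) => b u.
rewrite !invfM; move: (v^-1) (w^-1) (j`!%:R^-1 : C) (((_ - j)`!)%:R^-1 : C) => {}v {}w d d'.
set s := _ ^ P in sg *; set t := _ ^+ j.
transitivity (s * s * (eta * u * (b * (v * w) * (t * (d * d'))))); first by ring.
by rewrite sg mul1r.
Qed.

Lemma rgamma1N (y : C) : rgamma1 (- y) = rgamma1 y.
Proof. by rewrite /rgamma1 opprK mulrC. Qed.

Lemma cvg_rgamma1 : (fun e : C => rgamma1 e) @ (0 : C)^' --> (1 : C).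
Proof.
have np1 : ~ Gamma_pole (1 : C).
  by have := @nonpole1D R 0; rewrite addr0 cabs0; apply.
have cst : (fun _ : C => 1 : C) @ (0 : C)^' --> (1 : C) by exact: cvg_cst.
have h1 : (fun e : C => 1 - e) @ (0 : C)^' --> (1 : C).
  by have := cvgB cst (@cvg_id_dnbhs0 R); rewrite subr0; apply.
have h2 : (fun e : C => 1 + e) @ (0 : C)^' --> (1 : C).
  by have := cvgD cst (@cvg_id_dnbhs0 R); rewrite addr0; apply.
have g1 := cvg_comp _ _ h1 (cvg_Gamma_at np1).
have g2 := cvg_comp _ _ h2 (cvg_Gamma_at np1).
rewrite Gamma1 in g1 g2.
have n0 : (1 : C) * 1 != 0 by rewrite mulr1 oner_eq0.
have := cvgV n0 (cvgM g1 g2); rewrite mulr1 invr1; apply.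
Qed.

End Limits.

(** * The theorem *)

Section Assembly.
Local Open Scope classical_set_scope.
Context {R : realType} {r : nat}.
Local Notation C := (Cplx R).
Variables (n m : 'rV[int]_r) (alpha beta : 'rV[C]_r) (k : int) (i1 i2 : 'I_r) (p : int).
Hypothesis mk : forall l, 0 <= m 0 l + k.
Hypothesis i12 : i1 != i2.
Hypothesis alpha12 : alpha 0 i2 = alpha 0 i1 + p%:~R.
Hypothesis rest_nonint : forall i l, rest i1 i2 i -> l != i -> nonint (alpha 0 i - alpha 0 l).

Definition alpha_eps (eps : C) : 'rV[C]_r :=
  \row_l (if l == i2 then alpha 0 i1 + p_ p eps else alpha 0 l).

Lemma alpha_eps2 eps : alpha_eps eps 0 i2 = alpha 0 i1 + p_ p eps.
Proof. by rewrite mxE eqxx. Qed.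

Lemma alpha_eps_ne eps l : l != i2 -> alpha_eps eps 0 l = alpha 0 l.
Proof. by move=> /negPf li; rewrite mxE li. Qed.

Lemma alpha_eps_cvg l : (fun e => alpha_eps e 0 l) @ (0 : C)^' --> alpha 0 l.
Proof.
have cst (c : C) : (fun _ : C => c) @ (0 : C)^' --> c by exact: cvg_cst.
have [->|l2] := eqVneq l i2.
  rewrite (_ : (fun e => _) = (fun e => alpha 0 i2 + e)); last first.
    by apply/funext => e; rewrite alpha_eps2 alpha12 /p_ addrA.
  have h : (fun e => alpha 0 i2 + e) @ (0 : C)^' --> alpha 0 i2 + 0.
    by apply: cvgD; [exact: cst|exact: cvg_id_dnbhs0].
  by rewrite addr0 in h; exact: h.
rewrite (_ : (fun e => _) = (fun=> alpha 0 l)); first exact: cst.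
by apply/funext => e; rewrite alpha_eps_ne.
Qed.

Lemma near_generic : \forall e \near (0 : C)^', nonint e /\ generic (alpha_eps e).
Proof.
have h1 : \forall e \near (0 : C)^', forall l, nonint (alpha 0 i2 - alpha 0 l + e).
  apply: filter_forall => l; have := near_nonint (alpha 0 i2 - alpha 0 l) (@cabs1 R).
  by apply: filterS => e; rewrite mul1r.
have ne := near_nonint (0 : C) (@cabs1 R).
apply: filterS2 h1 ne => e h1; rewrite add0r mul1r => ne; split=> // i l il.
have h2 l' : l' != i2 -> nonint (alpha_eps e 0 i2 - alpha_eps e 0 l').
  move=> l2; rewrite alpha_eps2 alpha_eps_ne //.
  by apply: (nonint_eq (s := 0) (h1 l')); rewrite alpha12 /p_ /=; ring.
have [i2E|i2E] := eqVneq i i2; first by rewrite i2E; apply: h2; rewrite -i2E eq_sym.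
have [l2E|l2E] := eqVneq l i2.
  by rewrite l2E -opprB; apply: nonintN; exact: h2.
rewrite !alpha_eps_ne //.
have [i1E|i1E] := eqVneq i i1.
  rewrite -opprB; apply: nonintN; apply: rest_nonint => //.
  by rewrite /rest l2E -i1E eq_sym il.
by apply: rest_nonint; rewrite ?/rest ?i1E ?i2E // eq_sym.
Qed.

Lemma sum_split (V : nmodType) (f : 'I_r -> V) :
  \sum_i f i = f i2 + f i1 + \sum_(i | rest i1 i2 i) f i.
Proof.
rewrite (bigD1 i2) //= (bigD1 i1) //= addrA; congr (_ + _).
by apply: eq_bigl => l; rewrite /rest andbC.
Qed.

Lemma Eterm_sums e : nonint e -> generic (alpha_eps e) ->
  (\sum_(j < nterms (k + n 0 i2)) Eterm n m alpha k i1 i2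
     (alpha 0 i1 + p_ p e) (1 * e) beta p (n 0 i1 + k) (nterms (k + n 0 i2)%R).-1 j)
  - (\sum_(j < nterms (k + n 0 i1)) Eterm n m alpha k i1 i2
     (alpha 0 i1) (- 1 * e) beta (- p) (n 0 i2 + k) (nterms (k + n 0 i1)%R).-1 j)
  = e * (rgamma1 e * (q_poly n m (alpha_eps e) beta (deg_e n m) k%:~R
      - \sum_(i | rest i1 i2 i) \sum_(j < nterms (k + n 0 i)) res n m k (alpha_eps e) i beta j)).
Proof.
move=> ne ge; rewrite -(@sum_res _ _ n m k mk _ beta ge) sum_split addrK.
have ar l : rest i1 i2 l -> alpha_eps e 0 l = alpha 0 l.
  by move=> /andP[_ l2]; rewrite alpha_eps_ne.
have E2 (j : nat) : Eterm n m alpha k i1 i2 (alpha 0 i1 + p_ p e) (1 * e) beta p (n 0 i1 + k)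
    (nterms (k + n 0 i2)%R).-1 j = e * rgamma1 e * res n m k (alpha_eps e) i2 beta j.
  rewrite mul1r; apply: Eterm_res => //.
  - by move=> l; rewrite andbC.
  - exact: alpha_eps2.
  - by rewrite alpha_eps_ne // /p_; ring.
(* Now eta = - e; [rgamma1] is even, so only the factor eta changes sign. *)
have E1 (j : nat) : Eterm n m alpha k i1 i2 (alpha 0 i1) (- 1 * e) beta (- p) (n 0 i2 + k)
    (nterms (k + n 0 i1)%R).-1 j = - (e * rgamma1 e * res n m k (alpha_eps e) i1 beta j).
  rewrite mulN1r (@Eterm_res _ _ _ _ _ _ _ _ i1 i2 (alpha_eps e)) //.
  - by rewrite rgamma1N !mulNr.
  - by rewrite eq_sym.
  - exact: alpha_eps_ne.
  - by rewrite alpha_eps2 /p_ rmorphN /=; ring.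
  - exact: nonintN.
rewrite (eq_bigr _ (fun (j : 'I__) _ => E2 j)) (eq_bigr _ (fun (j : 'I__) _ => E1 j)).
by rewrite sumrN opprK -!mulr_sumr -mulrDr mulrA.
Qed.

Lemma comb_sub_combh :
  let K := comb n m alpha k i1 i2 p in
  let Kreg := comb_regular n m alpha k i1 i2 p in
  let Kh := combh n m alpha k i1 i2 p in
  let Khreg := combh_regular n m alpha k i1 i2 p in
  [/\ extends_to K Kreg ((0 : C), beta), extends_to Kh Khreg ((0 : C), beta) &
    value_at K Kreg ((0 : C), beta) - value_at Kh Khreg ((0 : C), beta)
    = q_poly n m alpha beta (deg_e n m) k%:~R
      - \sum_(i | rest i1 i2 i) \sum_(j < nterms (k + n 0 i)) res n m k alpha i beta j].
Proof.
have ra1 l : rest i1 i2 l -> nonint (alpha 0 i1 - alpha 0 l).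
  move=> rl; rewrite -opprB; apply: nonintN; apply: rest_nonint => //.
  by case/andP: rl; rewrite eq_sym.
have ra2 l : rest i1 i2 l -> nonint (alpha 0 i1 + p%:~R - alpha 0 l).
  move=> rl; rewrite -alpha12 -opprB; apply: nonintN; apply: rest_nonint => //.
  by case/andP: rl => _; rewrite eq_sym.
move=> K Kreg Kh Khreg.
have [ext dK] := @comb_extends _ _ n m alpha k i1 i2 p mk beta ra2.
have [exth dKh] := @combh_extends _ _ n m alpha k i1 i2 p mk ra1 beta.
split; [exact: ext|exact: exth|].
set S0 := RHS; pose S e := q_poly n m (alpha_eps e) beta (deg_e n m) k%:~R
      - \sum_(i | rest i1 i2 i) \sum_(j < nterms (k + n 0 i)) res n m k (alpha_eps e) i beta j.
have cS : S @ (0 : C)^' --> S0.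
  apply: cvgB; first by apply: cvg_q_poly; exact: alpha_eps_cvg.
  apply: cvg_sumC => i ri; apply: cvg_sumC => j _.
  apply: (@cvg_res _ _ n m k _ _ _ alpha_eps alpha alpha_eps_cvg (fun=> beta)).
  - exact: mk.
  - by move=> l li; exact: rest_nonint.
  - by move=> l; exact: cvg_cst.
have dF := is_deriveB dK dKh.
set F := (X in is_derive _ _ X _) in dF.
have nF : \forall e \near (0 : C)^', F e = e * (rgamma1 e * S e).
  by apply: filterS near_generic => e [ne ge]; exact: Eterm_sums.
have cG : (fun e => rgamma1 e * S e) @ (0 : C)^' --> S0.
  by have := cvgM (@cvg_rgamma1 R) cS; rewrite mul1r; apply.
(* The factorisation [nF] is available only off 0; since F is differentiable, hence continuous, its
   value at 0 is the limit of e u(e) S(e). *)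
have F0 : F 0 = 0.
  have [/derivable1_diffP /differentiable_continuous cF _] := dF.
  have c1 : F @ (0 : C)^' --> F 0 by move=> A /cF; exact: nbhs_dnbhs.
  apply: cvgC_unique c1 _.
  have c2 : (fun e => e * (rgamma1 e * S e)) @ (0 : C)^' --> (0 : C).
    by have := cvgM (@cvg_id_dnbhs0 R) cG; rewrite mul0r; apply.
  by apply: cvg_trans c2; apply: near_eq_cvg; apply: filterS nF => e ->.
(* As F(0) = 0, the difference quotient of F at 0 is u(e) S(e), which tends to S(0). *)
move/is_deriveCP: dF => dF; apply: cvgC_unique dF _.
apply: cvg_trans cG; apply: near_eq_cvg.
have n0 : \forall e \near (0 : C)^', e != 0 by exact: nbhs_dnbhs_neq.
by apply: filterS2 nF n0 => e Fe e0; rewrite add0r F0 subr0 Fe [e * _]mulrC mulfK.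
Qed.

End Assembly.

Theorem theorem3p1 (R : realType) (r : nat) (r_ge2 : (1 < r)%N)
    (p : int) (n m : 'rV[int]_r) (alpha beta : 'rV[Cplx R]_r) (k : int) :
  let i1 : 'I_r := Ordinal (ltnW r_ge2) in
  let i2 : 'I_r := Ordinal r_ge2 in
  alpha 0 i2 = alpha 0 i1 + p%:~R ->
  (forall i j : 'I_r, i != j -> [set i; j]%SET != [set i1; i2]%SET ->
     forall z : int, alpha 0 i - alpha 0 j != z%:~R) ->
  - (\big[Order.min/m 0 i1]_(i < r) m 0 i) <= k ->
  let K := comb n m alpha k i1 i2 p in
  let Kreg := comb_regular n m alpha k i1 i2 p in
  let Kh := combh n m alpha k i1 i2 p in
  let Khreg := combh_regular n m alpha k i1 i2 p in
  let T := term_i n m alpha k in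
  let Treg := term_i_regular n m alpha k in
  [/\ extends_to K Kreg (0, beta),
      extends_to Kh Khreg (0, beta),
      (forall i, rest i1 i2 i -> extends_to (T i) (Treg i) beta)
    & value_at K Kreg (0, beta) - value_at Kh Khreg (0, beta)
      = q_poly n m alpha beta (deg_e n m) k%:~R
        - \sum_(i | rest i1 i2 i) value_at (T i) (Treg i) beta].
Proof.
move=> i1 i2 alpha12 alphaN mk K Kreg Kh Khreg T Treg.
have {}mk l : 0 <= m 0 l + k.
  rewrite addrC -lerBlDr sub0r; apply: le_trans mk.
  by rewrite lerN2; exact: bigmin_le.
have rest_nonint i l : rest i1 i2 i -> l != i -> nonint (alpha 0 i - alpha 0 l).
  move=> ri li; apply: alphaN; first by rewrite eq_sym.
  (* A pair containing an index outside {1, 2} cannot be the pair {1, 2}. *)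
  apply: contraTneq ri => E.
  have : i \in [set i1; i2]%SET by rewrite -E set21.
  by rewrite /rest !inE => /orP[] /eqP ->; rewrite eqxx ?andbF.
have Tv i : rest i1 i2 i -> _ := fun ri =>
  @term_i_extends _ _ n m alpha k mk i beta (fun l li => rest_nonint i l ri li).
have [e1 e2 ->] := @comb_sub_combh _ _ n m alpha beta k i1 i2 p mk isT alpha12 rest_nonint.
split; [exact: e1|exact: e2|by move=> i /Tv[]|].
congr (_ - _); apply: eq_bigr => i /Tv[_ E].
by rewrite -E.
Qed.
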